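(* Let $d\ge 1$. There is a constant $C>0$ depending only on $d$ such that the following holds. Let $D\ge d$, let $A,B\subset\mathbb{R}^D$ be open sets, let $\varphi:B\to A$ be a $C^1$ bijection, and let $\mathcal{U}$ be a $d$-dimensional linear subspace of $\mathbb{R}^D$. Let $r\ge 1$, $p\ge 1$, $\alpha>0$, $\tau_0>0$ and $0<\omega<1$. Suppose $f\in L^1(\mathbb{R}^D)\cap L^r(\mathbb{R}^D)$ is supported on $A$ and satisfies $\|f_\varphi\|_{M^r(\mathcal{U})}\le \|f\|_{M^r(\mathcal{U})}<\infty$. Let $\varepsilon=\varepsilon(\varphi)=\max_{x\in B}|x-\varphi(x)|$ and suppose $\varepsilon<\sqrt{\tau_0}$. Then $$\mathrm{D}_{\alpha,p,r}(\mathcal{P}_{\mathcal{U}} f,\ \mathcal{P}_{\mathcal{U}} f_\varphi)\ \le\ C\cdot\|f\|_{M^r(\mathcal{U})}\cdot\frac{\tau_0^{\alpha/2}}{1-\omega^{1/2}}\cdot\Delta_{\alpha,p}\big(\varepsilon/\sqrt{\tau_0}\big).$$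
   Context: Functions are real-valued; $|\cdot|$ is the Euclidean norm. Deformation: for a $C^1$ bijection $\varphi:B\to A$ between open subsets of $\mathbb{R}^D$ and $f$ supported on $A$, $f_\varphi(x)=f(\varphi(x))\,|\nabla\varphi(x)|$ for $x\in B$, where $|\nabla\varphi(x)|$ is the absolute value of the determinant of the Jacobian matrix of $\varphi$ at $x$; $f_\varphi$ is extended by $0$ outside $B$. Projection: for a $d$-dimensional subspace $\mathcal{U}\subset\mathbb{R}^D$, writing points of $\mathbb{R}^D$ as $(x,y)$ with $x\in\mathcal{U}$, $y\in\mathcal{U}^\perp$, $(\mathcal{P}_{\mathcal{U}}f)(x)=\int_{\mathcal{U}^\perp}f(x,y)\,dy$, viewed as a function on $\mathcal{U}\cong\mathbb{R}^d$. If $d=D$, $\mathcal{P}_{\mathcal{U}}f=f$. Mixed norm: $\|f\|_{M^r(\mathcal{U})}=\Big(\int_{\mathcal{U}}\big(\int_{\mathcal{U}^\perp}|f(x,y)|\,dy\big)^r dx\Big)^{1/r}=\|\mathcal{P}_{\mathcal{U}}(|f|)\|_{L^r(\mathcal{U})}$ (equal to the $L^r$ norm if $d=D$). Scale-space metric: for $\tau>0$ let $G_\tau(x)=(\pi\tau)^{-d/2}e^{-|x|^2/\tau}$ on $\mathbb{R}^d$. With fixed $\tau_0>0$, $0<\omega<1$, set $\tau_k=\tau_0\omega^k$, $k\ge 0$. For $u,v\in L^r(\mathbb{R}^d)$, $$\mathrm{D}_{\alpha,p,r}(u,v)=\Big(\sum_{k\ge 0}\tau_k^{p\alpha/2}\,\|G_{\tau_k}*(u-v)\|_{L^r}^p\Big)^{1/p}.$$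 The function $\Delta_{\alpha,p}$: for $0<\epsilon<1$, $$\Delta_{\alpha,p}(\epsilon)=\begin{cases}\epsilon^\alpha/(\alpha-\alpha^2)^{1/p}, & 0<\alpha<1,\\ \epsilon\,(\log(1/\epsilon)+1)^{1/p}, & \alpha=1,\\ \epsilon/\min\{(\alpha-1)^{1/p},1\}, & \alpha>1,\end{cases}$$ and $\Delta_{\alpha,p}(0)=0$. *)

(* Defs.v *)
From HB Require Import structures.
From mathcomp Require Import all_boot all_order all_algebra.
From mathcomp Require Import all_classical all_reals all_analysis.

Set Implicit Arguments.
Unset Strict Implicit.
Unset Printing Implicit Defensive.

Import Order.TTheory GRing.Theory Num.Theory.
Import numFieldNormedType.Exports.

Local Open Scope classical_set_scope.
Local Open Scope ring_scope.

(* The sigma-algebra on row vectors generated by the coordinates, as for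
   [n.-tuple T] in the library; for [T = R] it is the Borel sigma-algebra. *)
Definition measure_rV_display : measure_display -> measure_display.
Proof. exact. Qed.

Section measurable_rV.
Context {d} {T : sigmaRingType d}.
Variable n : nat.

Let coors : 'I_n -> 'rV[T]_n -> T := fun i x => x ord0 i.

Let rV_set0 : g_sigma_preimage coors set0.
Proof. exact: sigma_algebra0. Qed.

Let rV_setC A : g_sigma_preimage coors A -> g_sigma_preimage coors (~` A).
Proof. exact: sigma_algebraC. Qed.

Let rV_bigcup (F : (set 'rV[T]_n)^nat) :
  (forall i, g_sigma_preimage coors (F i)) ->
  g_sigma_preimage coors (\bigcup_i (F i)).
Proof. exact: sigma_algebra_bigcup. Qed.

HB.instance Definition _ := @isMeasurable.Build (measure_rV_display d)
  'rV[T]_n (g_sigma_preimage coors) rV_set0 rV_setC rV_bigcup.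

End measurable_rV.

Section measurable_rV_theory.
Context d1 d2 (T1 : measurableType d1) (T2 : measurableType d2).

Lemma measurable_coord n (i : 'I_n) :
  measurable_fun [set: 'rV[T2]_n] (fun x : 'rV[T2]_n => x ord0 i).
Proof.
move=> _ Y mY; rewrite setTI; apply: sub_sigma_algebra => /=.
rewrite -bigcup_seq/=; exists i => /=; first by rewrite mem_index_enum.
by exists Y => //; rewrite setTI.
Qed.

Lemma measurable_fun_rVP n (f : T1 -> 'rV[T2]_n) :
  measurable_fun [set: T1] f <->
  forall i, measurable_fun [set: T1] (fun x => f x ord0 i).
Proof.
split=> [mf i|mf].
  exact: (measurableT_comp (measurable_coord i) mf).
move=> _ Y; rewrite setTI => mY; move: Y mY.
have -> : (@measurable _ 'rV[T2]_n : set (set 'rV[T2]_n)) =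
  g_sigma_preimage (fun (i : 'I_n) (x : 'rV[T2]_n) => x ord0 i) by [].
apply: (smallest_sub (C := sigma_algebra [set: 'rV[T2]_n])
  (X := [set Y | measurable (f @^-1` Y)])).
  split=> /=.
  - by rewrite preimage_set0; exact: measurable0.
  - by move=> A /= mA; rewrite setTD -preimage_setC; exact: measurableC.
  - move=> F /= mF; rewrite preimage_bigcup.
    by apply: bigcupT_measurable.
move=> A; rewrite -bigcup_seq/= => -[i _ [B mB <-]] /=; rewrite setTI.
by rewrite -comp_preimage -[X in measurable X]setTI; exact: mf.
Qed.

Lemma measurable_rV_box n (I : 'I_n -> set T2) :
  (forall i, measurable (I i)) ->
  measurable [set x : 'rV[T2]_n | forall i, I i (x ord0 i)].
Proof.
move=> mI; rewrite (_ : mkset _ =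
    \bigcap_(i in [set: 'I_n]) ((fun x : 'rV[T2]_n => x ord0 i) @^-1` I i)).
  apply: fin_bigcap_measurable => // i _.
  by rewrite -[X in measurable X]setTI; exact: measurable_coord.
by apply/seteqP; split => [x Ix i _|x Ix i]; [exact: Ix|exact: (Ix i)].
Qed.

End measurable_rV_theory.

(* Lebesgue measure on R^n, by recursion on n: [cons_measure mu] is the product
   of the Lebesgue measure on R with mu, carried over to 'rV[R]_(n.+1). *)
Section cons_measure.
Context {R : realType} (n : nat).
Implicit Type mu : {sigma_finite_measure set 'rV[R]_n -> \bar R}.

Definition rV_cons (p : measurableTypeR R * 'rV[R]_n) : 'rV[R]_n.+1 :=
  row_mx (const_mx p.1 : 'rV[R]_1) p.2.

Let rV_uncons (v : 'rV[R]_n.+1) : measurableTypeR R * 'rV[R]_n :=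
  (v ord0 ord0, \row_(j < n) v ord0 (lift ord0 j)).

Lemma rV_consE0 p : rV_cons p ord0 ord0 = p.1.
Proof.
by rewrite /rV_cons !mxE; case: splitP => // j _; rewrite mxE.
Qed.

Lemma rV_consES p j : rV_cons p ord0 (lift ord0 j) = p.2 ord0 j.
Proof.
rewrite /rV_cons mxE; case: splitP => [[[]//]|k] /=.
by rewrite /bump/= => -[/val_inj <-].
Qed.

Let rV_unconsK : cancel rV_uncons rV_cons.
Proof.
move=> v; apply/rowP => i; case: (unliftP ord0 i) => [j|] ->.
  by rewrite rV_consES mxE.
by rewrite rV_consE0.
Qed.

Let rV_consK : cancel rV_cons rV_uncons.
Proof.
move=> [x v]; rewrite /rV_uncons rV_consE0; congr pair.
by apply/rowP => j; rewrite mxE rV_consES.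
Qed.

Lemma measurable_rV_cons : measurable_fun setT rV_cons.
Proof.
apply/measurable_fun_rVP => i; case: (unliftP ord0 i) => [j|] ->.
  under eq_fun do rewrite rV_consES.
  exact: (measurableT_comp (measurable_coord j) measurable_snd).
under eq_fun do rewrite rV_consE0.
exact: measurable_fst.
Qed.

Let measurable_rV_uncons : measurable_fun setT rV_uncons.
Proof.
apply/measurable_fun_pairP; split; first exact: measurable_coord.
apply/measurable_fun_rVP => j /=; under eq_fun do rewrite mxE.
exact: measurable_coord.
Qed.

Definition cons_measure mu : set 'rV[R]_n.+1 -> \bar R :=
  pushforward (lebesgue_measure \x mu)%E rV_cons.

Variable mu : {sigma_finite_measure set 'rV[R]_n -> \bar R}.

Let cons0 : cons_measure mu set0 = 0%E.
Proof. by rewrite /cons_measure /pushforward preimage_set0 measure0. Qed.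

Let cons_ge0 A : (0 <= cons_measure mu A)%E.
Proof. by rewrite /cons_measure /pushforward; exact: measure_ge0. Qed.

Let cons_sigma_additive : semi_sigma_additive (cons_measure mu).
Proof.
have := @measure_semi_sigma_additive _ _ _
  (measure_function_pushforward__canonical__measure_function_Measure
     (lebesgue_measure \x mu)%E measurable_rV_cons).
exact.
Qed.

HB.instance Definition _ := isMeasure.Build _ _ _ (cons_measure mu)
  cons0 cons_ge0 cons_sigma_additive.

Let cons_sigma_finite : sigma_finite setT (cons_measure mu).
Proof.
have /sigma_finiteP[F [TF ndF Foo]] := sigma_finiteT (@lebesgue_measure R).
have /sigma_finiteP[G [TG ndG Goo]] := sigma_finiteT mu.
exists (fun k => rV_uncons @^-1` (F k `*` G k)).
  rewrite -preimage_bigcup (_ : \bigcup_k (F k `*` G k) = setT) ?preimage_setT//.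
  rewrite -subTset => -[x y] _.
  have [i _ Fix] : (\bigcup_k F k) x by rewrite -TF.
  have [k _ Gky] : (\bigcup_k G k) y by rewrite -TG.
  exists (maxn i k) => //; split.
  - by move: x Fix; exact/subsetPset/ndF/leq_maxl.
  - by move: y Gky; exact/subsetPset/ndG/leq_maxr.
move=> k; have [mF F_fin] := Foo k; have [mG G_fin] := Goo k; split.
  rewrite -[X in measurable X]setTI.
  by apply: measurable_rV_uncons => //; exact: measurableX.
rewrite /cons_measure /pushforward -comp_preimage.
rewrite (_ : rV_uncons \o rV_cons = id); last exact/funext/rV_consK.
by rewrite preimage_id product_measure1E// lte_mul_pinfty// ge0_fin_numE.
Qed.

HB.instance Definition _ := Measure_isSigmaFinite.Build _ _ _ (cons_measure mu)
  cons_sigma_finite.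

End cons_measure.

Fixpoint lebesgue_rV {R : realType} (n : nat) :
    {sigma_finite_measure set 'rV[R]_n -> \bar R} :=
  if n is n'.+1 then cons_measure (lebesgue_rV n') else \d_(0 : 'rV[R]_0).

Lemma lebesgue_rV_box {R : realType} (n : nat) (I : 'I_n -> set R) :
  (forall i, measurable (I i)) ->
  lebesgue_rV n [set x : 'rV[R]_n | forall i, I i (x ord0 i)] =
  (\prod_(i < n) lebesgue_measure (I i))%E.
Proof.
elim: n I => [|n IHn] I mI.
  by rewrite big_ord0 /= /dirac indicE mem_set// => -[].
rewrite big_ord_recl /= /cons_measure /pushforward.
rewrite (_ : _ @^-1` _ = I ord0 `*`
    [set x : 'rV[R]_n | forall i, I (lift ord0 i) (x ord0 i)]).
  rewrite product_measure1E//; first by rewrite (IHn (fun i => I (lift ord0 i))).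
    exact: mI.
  apply: (measurable_rV_box (I := fun i => I (lift ord0 i))) => i.
  exact: mI.
apply/seteqP; split => [[x y] /= Ixy|[x y] /= [Ix Iy] i].
  split=> [|i]; first by have := Ixy ord0; rewrite rV_consE0.
  by have := Ixy (lift ord0 i); rewrite rV_consES.
by case: (unliftP ord0 i) => [j|] ->; [rewrite rV_consES|rewrite rV_consE0].
Qed.

Section scale_space.
Context {R : realType}.

(* The library norm [`|x|] on row vectors is the sup norm. *)
Definition enorm n (x : 'rV[R]_n) : R := Num.sqrt (\sum_(i < n) x ord0 i ^+ 2).

Definition C1_on n m (B : set 'rV[R]_n) (phi : 'rV[R]_n -> 'rV[R]_m) : Prop :=
  (forall x, B x -> differentiable phi x) /\ {within B, continuous (jacobian phi)}.

Definition deform n (phi : 'rV[R]_n -> 'rV[R]_n) (B : set 'rV[R]_n)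
    (f : 'rV[R]_n -> R) : 'rV[R]_n -> R :=
  fun x => if x \in B then f (phi x) * `|\det ('J phi x)| else 0.

(* Supremum of |x - phi x| over B; it is -oo, with [fine] equal to 0, when B is
   empty. *)
Definition displacement n (phi : 'rV[R]_n -> 'rV[R]_n) (B : set 'rV[R]_n) :
    \bar R :=
  ereal_sup [set (enorm (x - phi x))%:E | x in B].

Definition orthogonal_compl n (U : {vspace 'rV[R]_n}) : set 'rV[R]_n :=
  [set v | forall u, u \in U -> u *m v^T = 0].

(* The rows of E are an orthonormal basis of the subspace S, so that
   x |-> x *m E is a linear isometry from R^k onto S. *)
Definition orthonormal_coordinates k n (E : 'M[R]_(k, n)) (S : set 'rV[R]_n) :
    Prop :=
  E *m E^T = 1%:M /\ range (fun x : 'rV[R]_k => x *m E) = S.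

Section mixed.
Context (d m n : nat) (E : 'M[R]_(d, n)) (F : 'M[R]_(m, n)).

(* Here E and F give orthonormal coordinates on a subspace U and on its
   orthogonal complement; the point (x, y) of U + U^perp is x *m E + y *m F. *)
Definition subspace_proj (f : 'rV[R]_n -> R) : 'rV[R]_d -> R :=
  fun x => \int[lebesgue_rV m]_y f (x *m E + y *m F).

Definition mixed_norm (r : R) (f : 'rV[R]_n -> R) : \bar R :=
  'N[lebesgue_rV d]_(r%:E)
    [(fun x => \int[lebesgue_rV m]_y `|f (x *m E + y *m F)|%:E)]%E.

End mixed.

Definition gauss_kernel d (tau : R) (x : 'rV[R]_d) : R :=
  (pi * tau) `^ (- (d%:R / 2)) * expR (- (enorm x ^+ 2 / tau)).

Definition convolution d (g u : 'rV[R]_d -> R) : 'rV[R]_d -> R :=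
  fun x => \int[lebesgue_rV d]_y (g (x - y) * u y).

Definition scale_metric d (tau0 omega alpha p r : R) (u v : 'rV[R]_d -> R) :
    \bar R :=
  let tau k := tau0 * omega ^+ k in
  ((\sum_(0 <= k <oo)
     (tau k `^ (p * alpha / 2))%:E *
     'N[lebesgue_rV d]_(r%:E)
       [EFin \o convolution (gauss_kernel (tau k)) (u \- v)%R] `^ p) `^ p^-1)%E.

Definition Delta (alpha p e : R) : R :=
  if e == 0 then 0
  else if alpha < 1 then e `^ alpha / (alpha - alpha ^+ 2) `^ p^-1
  else if alpha == 1 then e * (ln (1 / e) + 1) `^ p^-1
  else e / Num.min ((alpha - 1) `^ p^-1) 1.

End scale_space.

(* Main.v *)
(** Write [G] for the Gaussian kernel at scale [tau].  Orthogonal Fubini and the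
change of variables [y = phi x] turn [(G * P f_phi)(x)] into the integral over
[y] of [G (x - pi (phi^-1 y)) f(y)], where [pi] is the orthogonal projection on
[U]; hence [G * P f - G * P f_phi] only involves kernel values at points moved
by at most [eps].  When [eps <= sqrt tau] such a shift changes [G] by at most a
constant times [(eps / sqrt tau)] times the Gaussian at scale [4 * tau], and
Young's inequality bounds the norm by [c (eps / sqrt tau) ||f||]; for larger
[eps] the triangle inequality and [||f_phi|| <= ||f||] give [2 ||f||].  It
remains to sum [min (1, eps / sqrt tau_k)] over the geometric scales.

The change of variables compares the measures [Q |-> |phi Q|] and
[Q |-> \int_Q |det J phi|] on boxes: by repeated bisection it is enough to
compare them, up to a small multiple of [|Q|], on small boxes around each point
[a].  There [phi Q] is contained in a thickening of the affine image of [Q],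
and when [J phi a] is invertible the contraction principle shows that it also
contains a slightly smaller affine copy. *)

Require Import Defs.
From HB Require Import structures.
From mathcomp Require Import all_boot all_order all_algebra.
From mathcomp Require Import all_classical all_reals all_analysis.
From mathcomp Require Import measurable_realfun.
From mathcomp Require Import ring lra.

Set Implicit Arguments.
Unset Strict Implicit.
Unset Printing Implicit Defensive.

Import Order.TTheory GRing.Theory Num.Theory.
Import numFieldNormedType.Exports.

Local Open Scope classical_set_scope.
Local Open Scope ring_scope.

(** * Affine changes of variables *)

(** The constant may depend on [d] only, so every estimate has to happen on the subspace: the kernel
    lives on row vectors of length [d], orthogonal projection does not increase Euclidean length,
    and Young's inequality for a kernel of mass one has constant 1 for every [r]. The value is
    [2 * (3 * expR 1 * 2 ^+ d)]: [3 * expR 1] bounds the variation of the Gaussian profile, whose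
    slope is not bounded by a multiple of its height and is therefore compared with a wider
    Gaussian; [2 ^+ d] is the ratio of the normalising factors at the two scales; the leading 2 is
    lost in the sum over scales. The main obstacle is the change of variables. A C1 bijection may
    have critical points, so its inverse need not be differentiable and enters only as a measurable
    map. At a critical point only the upper volume estimate has content. Moreover [lebesgue_rV] is
    an iterated product over coordinates, so even its behaviour under linear maps has to be derived,
    by Gaussian elimination. *)

Section lebesgue_affine.
Context {R : realType}.
Notation leb := (@lebesgue_measure R).

Lemma measurable_affine (a b : R) :
  measurable_fun [set: measurableTypeR R]
    (fun x : measurableTypeR R => a * x + b : measurableTypeR R).
Proof.
by apply: measurable_funD => //; apply: measurable_funM.
Qed.

(** Uniqueness of Lebesgue measure reduces this to half-open intervals: the rescaled pushforward
    must give each of them its length. For [a < 0] the preimage is closed at the other end, hence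
    the two cases. *)
Lemma lebesgue_measure_affine (a b : R) (A : set (measurableTypeR R)) :
  a != 0 -> measurable A ->
  (`|a|%:E * leb ((fun x => (a * x + b)%R) @^-1` A) = leb A)%E.
Proof.
move=> a0 mA.
pose mf := measurable_affine a b.
have na0 : (0 <= `|a|)%R by [].
pose nu : {measure set (measurableTypeR R) -> \bar R} :=
  mscale (NngNum na0)
  (measure_function_pushforward__canonical__measure_function_Measure leb mf).
transitivity (nu A); first by rewrite /nu /= /mscale /pushforward.
apply/esym; apply: (lebesgue_measure_unique (mu := nu)) => //.
move=> X [[u v] _ <-]; rewrite /nu /= /mscale /pushforward /=.
rewrite lebesgue_measure_itv/= lte_fin.
have [a_gt0|a_lt0|a_eq0] := ltgtP 0 a; last by rewrite -a_eq0 eqxx in a0.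
- transitivity (`|a|%:E * leb [set` `](u - b) / a, (v - b) / a]%R])%E;
  last first.
    congr (_ * leb _)%E; apply/seteqP; split => x /=;
      by rewrite !in_itv/= ltr_pdivrMr// ler_pdivlMr// ltrBlDr lerBrDr mulrC.
  rewrite lebesgue_measure_itv/= lte_fin ltr_pM2r ?invr_gt0// ltrD2r.
  case: ifPn => uv; last by rewrite mule0.
  by rewrite -!EFinB -EFinM gtr0_norm//; congr EFin; field; exact: lt0r_neq0.
- transitivity (`|a|%:E * leb [set` `[(v - b) / a, (u - b) / a[%R])%E;
  last first.
    congr (_ * leb _)%E; apply/seteqP; split => x /=;
      by rewrite !in_itv/= ltr_ndivlMr// ler_ndivrMr// ltrBlDr lerBrDr mulrC
        andbC.
  rewrite lebesgue_measure_itv/= lte_fin ltr_nM2r ?invr_lt0// ltrD2r.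
  case: ifPn => uv; last by rewrite mule0.
  by rewrite -!EFinB -EFinM ltr0_norm//; congr EFin; field; exact: ltr0_neq0.
Qed.

Lemma ge0_integral_affine (a b : R) (h : measurableTypeR R -> \bar R) :
  a != 0 -> measurable_fun setT h -> (forall x, 0 <= h x)%E ->
  (`|a|%:E * \int[leb]_x h (a * x + b)%R = \int[leb]_x h x)%E.
Proof.
move=> a0 mh h0.
pose mf := measurable_affine a b.
have na0 : (0 <= `|a|)%R by [].
pose nu : {measure set (measurableTypeR R) -> \bar R} :=
  mscale (NngNum na0)
  (measure_function_pushforward__canonical__measure_function_Measure leb mf).
transitivity (\int[nu]_x h x)%E.
  rewrite ge0_integral_mscale//=.
  congr (_ * _)%E.
  rewrite ge0_integral_pushforward// ?preimage_setT //.
apply: eq_measure_integral => A mA _.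
exact: (lebesgue_measure_affine b a0 mA).
Qed.

End lebesgue_affine.

Section lebesgue_rV_cons.
Context {R : realType}.
Notation leb := (@lebesgue_measure R).

Lemma integral_rV_cons n (h : 'rV[R]_n.+1 -> \bar R) :
  measurable_fun setT h -> (forall x, 0 <= h x)%E ->
  (\int[lebesgue_rV n.+1]_z h z =
   \int[leb]_x \int[lebesgue_rV n]_y h (rV_cons (x, y)))%E.
Proof.
move=> mh h0.
transitivity (\int[(leb \x lebesgue_rV n)%E]_z h (rV_cons z))%E.
  rewrite [LHS](_ : _ = \int[pushforward (leb \x lebesgue_rV n)%E
     (@rV_cons R n)]_z h z)%E //.
  rewrite (@ge0_integral_pushforward _ _ _ _ _ _ (@measurable_rV_cons R n)) //.
rewrite fubini_tonelli1 //.
by apply: measurableT_comp => //; exact: measurable_rV_cons.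
Qed.

Lemma integral_rV_cons2 n (h : 'rV[R]_n.+1 -> \bar R) :
  measurable_fun setT h -> (forall x, 0 <= h x)%E ->
  (\int[lebesgue_rV n.+1]_z h z =
   \int[lebesgue_rV n]_y \int[leb]_x h (rV_cons (x, y)))%E.
Proof.
move=> mh h0; rewrite integral_rV_cons//
  (fubini_tonelli (fun z => h (rV_cons z)))//.
by apply: measurableT_comp => //; exact: measurable_rV_cons.
Qed.

Lemma integral_rV0 (h : 'rV[R]_0 -> \bar R) :
  measurable_fun setT h -> (\int[lebesgue_rV 0]_z h z = h (0%R : 'rV[R]_0))%E.
Proof. by move=> mh; rewrite /= integral_dirac // diracT mul1e. Qed.

End lebesgue_rV_cons.

Section integral_linear.
Context {R : realType}.
Notation leb := (@lebesgue_measure R).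

Lemma measurable_rV_affine m n (T : 'M[R]_(m, n)) (b : 'rV[R]_n) :
  measurable_fun setT (fun x : 'rV[R]_m => x *m T + b).
Proof.
apply/measurable_fun_rVP => j; under eq_fun do rewrite !mxE.
apply: measurable_funD => //; apply: measurable_sum => i.
by apply: measurable_funM => //; exact: measurable_coord.
Qed.

(** Phrased for all nonnegative integrands and all translations [b], so that the property passes to
    products of matrices and can be used on inner integrals, where the remaining coordinates act as
    a translation. *)
Definition affine_scaling n (T : 'M[R]_n) :=
  forall (h : 'rV[R]_n -> \bar R) b, measurable_fun setT h ->
  (forall x, 0 <= h x)%E ->
  (`|\det T|%:E * \int[lebesgue_rV n]_x h (x *m T + b)%R =
   \int[lebesgue_rV n]_x h x)%E.

Lemma affine_scalingM n (S T : 'M[R]_n) :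
  affine_scaling S -> affine_scaling T -> affine_scaling (S *m T).
Proof.
move=> sS sT h b mh h0.
transitivity (`|\det T|%:E * (`|\det S|%:E *
    \int[lebesgue_rV n]_x h ((x *m S + 0) *m T + b)%R))%E.
  rewrite det_mulmx normrM mulrC EFinM -muleA; congr (_ * (_ * _))%E.
  by apply: eq_integral => x _; rewrite addr0 mulmxA.
rewrite (sS (fun x => h (x *m T + b)))//; first exact: sT.
by apply: measurableT_comp => //; exact: measurable_rV_affine.
Qed.

Lemma rV_eq_cons n (v : 'rV[R]_(1 + n)) :
  v = rV_cons (v ord0 ord0, rsubmx v).
Proof.
rewrite -[LHS]hsubmxK /rV_cons/=; congr row_mx.
by apply/rowP => i; rewrite !mxE ord1; congr (v _ _); apply/val_inj.
Qed.

Lemma measurable_rV_cons_fst n (y : 'rV[R]_n) :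
  measurable_fun setT (fun x : measurableTypeR R => rV_cons (x, y)).
Proof. exact: measurableT_comp (@measurable_rV_cons R n) _. Qed.

Lemma measurable_rV_cons_snd n (x : measurableTypeR R) :
  measurable_fun setT (fun y : 'rV[R]_n => rV_cons (x, y)).
Proof. exact: measurableT_comp (@measurable_rV_cons R n) _. Qed.

(** Integrating the first coordinate innermost turns the shear into a translation of one real
    variable by an amount depending on [y]. The hypothesis on the identity supplies translation
    invariance in the other coordinates. *)
Lemma affine_scaling_lower n (c : 'cV[R]_n) :
  affine_scaling (1%:M : 'M[R]_n) ->
  affine_scaling (block_mx 1%:M 0 c 1%:M : 'M[R]_(1 + n)).
Proof.
move=> s1 h b mh h0; have [b0 [b' ->]] : exists b0 b', b = rV_cons (b0, b').
  by exists (b ord0 ord0), (rsubmx b); exact: rV_eq_cons.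
rewrite det_lblock !det1 mulr1 normr1 mul1e.
pose L : 'M[R]_(1 + n) := block_mx 1%:M 0 c 1%:M.
have mhL : measurable_fun setT (fun x : 'rV[R]_(1 + n) =>
  h (x *m L + rV_cons (b0, b'))).
  by apply: measurableT_comp => //; exact: measurable_rV_affine.
rewrite (integral_rV_cons2 mh h0) (integral_rV_cons2 mhL (fun x => h0 _)).
pose g (y : 'rV[R]_n) := (\int[leb]_x h (rV_cons (x, y)))%E.
have mg : measurable_fun setT g.
  apply: (@measurable_fun_fubini_tonelli_G _ _ _ _ _ leb
    (fun z => h (rV_cons z))) => //.
  by apply: measurableT_comp => //; exact: measurable_rV_cons.
have g0 y : (0 <= g y)%E by apply: integral_ge0.
have := s1 g b' mg g0; rewrite det1 normr1 mul1e /g => <-.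
apply: eq_integral => y _.
pose e := (y *m c) ord0 ord0 + b0.
have := @ge0_integral_affine R 1 e (fun x => h (rV_cons (x, y *m 1%:M + b'))).
rewrite normr1 mul1e => <- //; last first.
  by apply: measurableT_comp => //; exact: measurable_rV_cons_fst.
apply: eq_integral => x _; congr h.
rewrite /rV_cons/= mul_row_block add_row_mx mulmx1 mulmx0 add0r !mulmx1.
congr row_mx; apply/rowP => i; rewrite ord1 /e !mxE.
by rewrite mul1r addrA.
Qed.

(** Here the first coordinate is frozen instead: [B] then only translates [y], [D] scales the inner
    integral and [a] the outer one. *)
Lemma affine_scaling_upper n (a : R) (B : 'rV[R]_n) (D : 'M[R]_n) :
  a != 0 -> affine_scaling D ->
  affine_scaling (block_mx a%:M B 0 D : 'M[R]_(1 + n)).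
Proof.
move=> a0 sD h b mh h0; have [b0 [b' ->]] : exists b0 b', b = rV_cons (b0, b').
  by exists (b ord0 ord0), (rsubmx b); exact: rV_eq_cons.
rewrite det_ublock det_scalar1 normrM EFinM -muleA.
pose T : 'M[R]_(1 + n) := block_mx a%:M B 0 D.
have mhT : measurable_fun setT (fun x : 'rV[R]_(1 + n) =>
  h (x *m T + rV_cons (b0, b'))).
  by apply: measurableT_comp => //; exact: measurable_rV_affine.
rewrite (integral_rV_cons mh h0) (integral_rV_cons mhT (fun x => h0 _)).
have mF : measurable_fun setT (fun x : measurableTypeR R =>
    \int[lebesgue_rV n]_y h (rV_cons (x, y)))%E.
  apply: (@measurable_fun_fubini_tonelli_F _ _ _ _ _ _ (fun z => h (rV_cons z)))
    => //.
  by apply: measurableT_comp => //; exact: measurable_rV_cons.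
rewrite -(ge0_integral_affine b0 a0 mF); last by move=> x; exact: integral_ge0.
congr (_ * _)%E; rewrite -ge0_integralZl_EFin//; last 2 first.
- by move=> x _; exact: integral_ge0.
- apply: (@measurable_fun_fubini_tonelli_F _ _ _ _ _ _ (fun z => h (rV_cons z *m
      block_mx a%:M B 0 D + rV_cons (b0, b')))) => //.
  apply: measurableT_comp => //.
  apply: (measurableT_comp (measurable_rV_affine _ _)).
  exact: measurable_rV_cons.
apply: eq_integral => x _.
rewrite -(sD (fun y => h (rV_cons (a * x + b0, y))) (x *: B + b'))//;
  last first.
  by apply: measurableT_comp => //; exact: measurable_rV_cons_snd.
congr (_ * _)%E; apply: eq_integral => y _; congr h.
rewrite /rV_cons/= mul_row_block add_row_mx mulmx0 addr0; congr row_mx.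
  by apply/rowP => i; rewrite !mxE big_ord1 !mxE !ord1 eqxx mulr1n mulrC.
rewrite addrA [y *m D + _]addrC; congr (_ + _ + _).
by apply/rowP => i; rewrite !mxE big_ord1 !mxE.
Qed.

(** Induction on the size: a nonzero corner allows a block LU factorisation, and a zero corner is
    first repaired by a column operation. *)
Lemma unitmx_affine_scaling n (T : 'M[R]_n) : T \in unitmx -> affine_scaling T.
Proof.
elim: n T => [|n IH] T uT.
  move=> h b mh h0; rewrite det_mx00 normr1 mul1e !integral_rV0//.
    by congr h; apply/rowP => -[].
  by apply: measurableT_comp => //; exact: measurable_rV_affine.
have s1 : affine_scaling (1%:M : 'M[R]_n) by apply: IH; exact: unitmx1.
have corner (S : 'M[R]_(1 + n)) :
    S \in unitmx -> S ord0 ord0 != 0 -> affine_scaling S.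
  rewrite -[S]submxK.
  set a := ulsubmx S; set B := ursubmx S; set c := dlsubmx S;
    set D := drsubmx S.
  have -> : block_mx a B c D ord0 ord0 = a ord0 ord0.
    by rewrite submxK /a !mxE; congr (S _ _); apply/val_inj.
  rewrite [a]mx11_scalar !mxE; set a0 := S _ _ => uS a00.
  (* The lower right block is the Schur complement of the corner; it is invertible because the whole
     matrix is, so induction applies to it. *)
  have ES : block_mx a0%:M B c D = block_mx 1%:M 0 (a0^-1 *: c) 1%:M *m
     (block_mx a0%:M B 0 (D - a0^-1 *: c *m B) : 'M[R]_(1 + n)).
    rewrite mulmx_block !mul1mx !mul0mx !addr0 addrC.
    by rewrite addrNK mul_mx_scalar scalerA mulfV// scale1r.
  move: uS; rewrite ES unitmx_mul => /andP[_]; rewrite unitmxE det_ublock.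
  rewrite unitrM => /andP[_]; rewrite -unitmxE => uD.
  apply: affine_scalingM; first exact: affine_scaling_lower.
  by apply: affine_scaling_upper => //; exact: IH.
have [T00|] := eqVneq (T ord0 ord0) 0; last exact: (corner T).
have [j Tj] : exists j : 'I_n, T ord0 (rshift 1 j) != 0.
  apply/existsP; apply: contraT; rewrite negb_exists => /forallP T0.
  move: uT; rewrite unitmxE (expand_det_row _ ord0) big1 ?unitr0// => i _.
  case: (unliftP ord0 i) => [k ->|->]; last by rewrite T00 mul0r.
  have -> : lift ord0 k = rshift 1 k by apply/val_inj.
  by have /eqP -> := negbNE (T0 k); rewrite mul0r.
(* Right multiplication by [L 1] adds column [j] to the first column, which makes the corner
   nonzero; [L (- 1)] undoes it and is of the lower type already treated. *)
pose L (s : R) : 'M[R]_(1 + n) := block_mx 1%:M 0 (s *: delta_mx j ord0) 1%:M.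
have LK : L 1 *m L (- 1) = 1%:M.
  rewrite mulmx_block !mul1mx !mul0mx !addr0 !mulmx0 !mulmx1 add0r.
  by rewrite scale1r scaleN1r subrr -scalar_mx_block.
have -> : T = (T : 'M[R]_(1 + n)) *m L 1 *m L (- 1).
  by rewrite -mulmxA LK mulmx1.
apply: affine_scalingM; last exact: affine_scaling_lower.
apply: (corner (_ *m L 1)).
  by rewrite unitmx_mul; apply/andP; split => //; case/mulmx1_unit : LK.
rewrite -[X in X *m _](@submxK _ 1 n 1 n) mulmx_block.
rewrite scale1r.
rewrite (_ : ord0 = lshift n (ord0 : 'I_1)); last exact/val_inj.
rewrite block_mxEul mulmx1 mxE [X in X + _]mxE [X in X + _]mxE.
rewrite (_ : T _ _ = 0) ?add0r; last by rewrite -T00; congr (T _ _);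
  exact/val_inj.
rewrite mxE (bigD1 j)//= big1 ?addr0.
  rewrite !mxE !eqxx mulr1.
  by apply: contra_neq Tj => <-; congr (T _ _); exact/val_inj.
by move=> i ij; rewrite !mxE (negbTE ij) mulr0.
Qed.

End integral_linear.

(** * Boxes and bisection *)

Section rV_boxes.
Context {R : realType}.

(** Provides the completeness of row vectors on which the contraction principle relies. *)
HB.instance Definition _ n := Complete.on 'M[R]_(1, n).

Lemma rV_norm_ltP n (x : 'rV[R]_n) (e : R) : 0 < e ->
  (`|x| < e) <-> forall j, `|x ord0 j| < e.
Proof.
move=> e0; rewrite {1}/Num.norm/= mx_normrE; split.
  by move/bigmax_ltP => [_ H] j; exact: (H (ord0, j)).
by move=> H; apply/bigmax_ltP; split => // -[i j] _; rewrite ord1.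
Qed.

Lemma rV_norm_leP n (x : 'rV[R]_n) (e : R) : 0 <= e ->
  (`|x| <= e) <-> forall j, `|x ord0 j| <= e.
Proof.
move=> e0; rewrite {1}/Num.norm/= mx_normrE; split.
  by move/bigmax_leP => [_ H] j; exact: (H (ord0, j)).
by move=> H; apply/bigmax_leP; split => // -[i j] _; rewrite ord1.
Qed.

Lemma rV_norm_coord n (x : 'rV[R]_n) j : `|x ord0 j| <= `|x|.
Proof. by have /rV_norm_leP := lexx `|x|; exact. Qed.

Definition cbox n (a b : 'rV[R]_n) : set 'rV[R]_n :=
  [set x | forall j, a ord0 j <= x ord0 j <= b ord0 j].

(** Half-open, so that bisection tiles a box without overlap; the closed [cbox] serves for
    compactness and for limits of nested boxes. *)
Definition hbox n (a b : 'rV[R]_n) : set 'rV[R]_n :=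
  [set x | forall j, a ord0 j <= x ord0 j < b ord0 j].

Lemma hbox_cbox n (a b : 'rV[R]_n) : hbox a b `<=` cbox a b.
Proof. by move=> x Hx j; have /andP[-> /ltW ->] := Hx j. Qed.

Lemma cboxE n (a b : 'rV[R]_n) :
  cbox a b = [set x | forall j, `[a ord0 j, b ord0 j]%classic (x ord0 j)].
Proof. by apply/seteqP; split => x H j; have := H j; rewrite /= in_itv. Qed.

Lemma hboxE n (a b : 'rV[R]_n) :
  hbox a b = [set x | forall j, `[a ord0 j, b ord0 j[%classic (x ord0 j)].
Proof. by apply/seteqP; split => x H j; have := H j; rewrite /= in_itv. Qed.

Lemma cbox_compact n (a b : 'rV[R]_n) : compact (cbox a b).
Proof. rewrite cboxE; apply: (@rV_compact R n
  (fun j => `[a ord0 j, b ord0 j]%classic)) => j; exact: segment_compact. Qed.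

Lemma measurable_hbox n (a b : 'rV[R]_n) : measurable (hbox a b).
Proof.
rewrite hboxE.
by apply: (@measurable_rV_box _ (measurableTypeR R) n
  (fun j => `[a ord0 j, b ord0 j[%classic)).
Qed.

Lemma measurable_cbox n (a b : 'rV[R]_n) : measurable (cbox a b).
Proof.
rewrite cboxE.
by apply: (@measurable_rV_box _ (measurableTypeR R) n
  (fun j => `[a ord0 j, b ord0 j]%classic)).
Qed.

Lemma lebesgue_hbox n (a b : 'rV[R]_n) : (forall j, a ord0 j <= b ord0 j) ->
  lebesgue_rV n (hbox a b) = (\prod_(j < n) (b ord0 j - a ord0 j))%:E.
Proof.
move=> ab; rewrite hboxE.
rewrite (@lebesgue_rV_box R n (fun j => `[a ord0 j, b ord0 j[%classic))//.
rewrite -prodEFin; apply: eq_bigr => j _.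
rewrite lebesgue_measure_itv/= lte_fin; case: ifPn => [_|];
  first by rewrite EFinB.
by rewrite -leNgt => ba; rewrite (@le_anti _ _ (a ord0 j) (b ord0 j)) ?subrr
  ?ab.
Qed.

Lemma lebesgue_cbox n (a b : 'rV[R]_n) : (forall j, a ord0 j <= b ord0 j) ->
  lebesgue_rV n (cbox a b) = (\prod_(j < n) (b ord0 j - a ord0 j))%:E.
Proof.
move=> ab; rewrite cboxE.
rewrite (@lebesgue_rV_box R n (fun j => `[a ord0 j, b ord0 j]%classic))//.
rewrite -prodEFin; apply: eq_bigr => j _.
rewrite lebesgue_measure_itv/= lte_fin; case: ifPn => [_|];
  first by rewrite EFinB.
by rewrite -leNgt => ba; rewrite (@le_anti _ _ (a ord0 j) (b ord0 j)) ?subrr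
  ?ab.
Qed.

Lemma open_rV_ball n (O : set 'rV[R]_n) x : open O -> O x ->
  exists2 e : R, 0 < e & forall y, `|y - x| < e -> O y.
Proof.
move=> oO Ox; have /nbhs_ballP[e e0 He] := open_nbhs_nbhs (conj oO Ox).
by exists e => // y yx; apply: He; rewrite -ball_normE /ball_ /= distrC.
Qed.

(** The candidates are the cubes with rational centre and half-side [1 / (k + 1)], of which there
    are countably many. Requiring their closures to lie in [O] makes compactness arguments available
    on each of them. *)
Lemma open_hbox_cover n (O : set 'rV[R]_n) : open O ->
  exists (I : set nat) (a b : nat -> 'rV[R]_n),
    (forall i, I i -> (forall j, a i ord0 j < b i ord0 j) /\
      cbox (a i) (b i) `<=` O) /\
    O = \bigcup_(i in I) hbox (a i) (b i).
Proof.
move=> oO.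
pose V := ('rV[rat]_n * nat)%type.
pose lo (p : V) : 'rV[R]_n := \row_j (ratr (p.1 ord0 j) - p.2.+1%:R^-1).
pose hi (p : V) : 'rV[R]_n := \row_j (ratr (p.1 ord0 j) + p.2.+1%:R^-1).
pose v i : V := odflt (0, 0%N) (unpickle i).
exists [set i | cbox (lo (v i)) (hi (v i)) `<=` O], (lo \o v), (hi \o v); split.
  move=> i /= Hi; split => // j; rewrite !mxE ltrD2l.
  by apply: (@lt_trans _ _ 0); rewrite ?oppr_lt0 invr_gt0 ltr0n.
apply/seteqP; split => [x Ox|x [i /= Hi xi]]; last exact/Hi/hbox_cbox.
have [e e0 He] := open_rV_ball oO Ox.
(* The centre will be within [1 / (k + 1)] of [x] in each coordinate, so the points of the cube are
   within twice that: hence [e / 2]. *)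
have [k /andP[_]] : exists k : nat, true && (k.+1%:R^-1 < e / 2 :> R).
  have [k _ Hk] := near_infty_natSinv_lt (PosNum (divr_gt0 e0 (ltr0Sn R 1))).
  by exists k; apply: Hk => /=.
move=> ke.
have k0 : 0 < k.+1%:R^-1 :> R by rewrite invr_gt0 ltr0n.
have /choice[q Hq] : forall j, exists q : rat,
    x ord0 j - k.+1%:R^-1 < ratr q < x ord0 j + k.+1%:R^-1.
  move=> j; have [|q] := @rat_in_itvoo R (x ord0 j - k.+1%:R^-1)
    (x ord0 j + k.+1%:R^-1); last by rewrite in_itv/= => Hq; exists q.
  by rewrite ltrD2l (@lt_trans _ _ 0)// oppr_lt0.
pose p : V := (\row_j q j, k).
exists (pickle p); rewrite /= /v pickleK/=.
  move=> y Hy; apply: He; apply/rV_norm_ltP => // j.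
  have := Hy j; rewrite !mxE/= => /andP[y1 y2]; have /andP[q1 q2] := Hq j.
  move: (k.+1%:R^-1) ke y1 y2 q1 q2 => r; rewrite ltr_norml; lra.
move=> j; rewrite !mxE/=; have /andP[] := Hq j.
by move: (k.+1%:R^-1) => r; lra.
Qed.

Lemma open_rV_measurable n (O : set 'rV[R]_n) : open O -> measurable O.
Proof.
move=> /open_hbox_cover[I [a [b [_ ->]]]].
by apply: bigcup_measurable => i _; exact: measurable_hbox.
Qed.

Lemma closed_rV_measurable n (O : set 'rV[R]_n) : closed O -> measurable O.
Proof.
move=> cO; rewrite -(setCK O); apply: measurableC.
apply: open_rV_measurable; exact: closed_openC.
Qed.

Lemma compact_rV_measurable n (K : set 'rV[R]_n) : compact K -> measurable K.
Proof.
by move=> cK; apply: closed_rV_measurable; exact: compact_closed.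
Qed.

Lemma open_continuous_rV_measurable n (g : 'rV[R]_n -> R) (B : set 'rV[R]_n) :
  open B -> (forall x, B x -> {for x, continuous g}) ->
  measurable_fun B (g : 'rV[R]_n -> measurableTypeR R).
Proof.
move=> oB cg mB; apply: (measurability _ (RGenOInfty.measurableE R)) => //.
move=> /= _ [_ [r ->] <-]; apply: open_rV_measurable.
rewrite openE => x [Bx /=]; rewrite in_itv/= andbT => rx.
apply: filterI; first exact: open_nbhs_nbhs.
have := cg x Bx; apply; near=> y; rewrite /= in_itv/= andbT; near: y.
exact: lt_nbhsr.
Unshelve. all: end_near. Qed.

End rV_boxes.

Section bisection.
Context {R : realType} (n : nat).
Implicit Types (w c a : 'rV[R]_n) (s : {ffun 'I_n -> bool}).

(** [s j] selects the upper half in direction [j]. All sub-boxes keep the shape [w]; only corner and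
    size change. *)
Definition subcorner w s : 'rV[R]_n := \row_j (if s j then w ord0 j else 0).

(* Otherwise some sub-box of every bad box is bad, and the nested bad boxes
   shrink to a point [a] at which the local hypothesis fails. *)
Lemma bisection_ind w c t (P : 'rV[R]_n -> R -> Prop) :
  (forall j, 0 < w ord0 j) -> 0 < t ->
  (forall c t, 0 < t ->
    (forall s, P (c + (t / 2) *: subcorner w s) (t / 2)) -> P c t) ->
  (forall a, cbox c (c + t *: w) a -> exists2 d, 0 < d & forall c' t',
     0 < t' < d -> cbox c' (c' + t' *: w) a -> P c' t') ->
  P c t.
Proof.
move=> w0 t0 Pbis Ploc; apply: contrapT => nP.
(* The conditions are premises under the existential, so that [choice] yields a total selector; its
   value matters only on bad boxes. *)
have /choice[g Hg] : forall p : 'rV[R]_n * R, exists s,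
    0 < p.2 -> ~ P p.1 p.2 -> ~ P (p.1 + (p.2 / 2) *: subcorner w s) (p.2 / 2).
  move=> [c' t'] /=.
  have [t'0|] := pselect (0 < t'); last by exists [ffun=> true].
  have [Pc|nPc] := pselect (P c' t'); first by exists [ffun=> true].
  by have /existsNP[s Hs] := contra_not (Pbis c' t' t'0) nPc; exists s.
pose f := fix f k : 'rV[R]_n * R := if k is k'.+1 then
  ((f k').1 + ((f k').2 / 2) *: subcorner w (g (f k')), (f k').2 / 2) else
    (c, t).
have f2 k : (f k).2 = t / 2 ^+ k.
  by elim: k => [|k IH] /=; rewrite ?expr0 ?divr1// IH exprSr invfM mulrA.
have f20 k : 0 < (f k).2 by rewrite f2 divr_gt0// exprn_gt0.
have fP k : ~ P (f k).1 (f k).2 by elim: k => [//|k IH] /=; exact: Hg.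
pose u k j := (f k).1 ord0 j.
have uS k j : u k j <= u k.+1 j.
  rewrite /u /= !mxE lerDl; case: ifP => _; rewrite ?mulr0//.
  by rewrite mulr_ge0// ltW// divr_gt0.
have vS k j : u k.+1 j + (f k.+1).2 * w ord0 j <= u k j + (f k).2 * w ord0 j.
  rewrite /u /= !mxE -addrA lerD2l.
  rewrite [leRHS](_ : _ = (f k).2 / 2 * w ord0 j + (f k).2 / 2 * w ord0 j);
    last by field.
  rewrite lerD2r; case: ifP => _; rewrite ?mulr0//.
  by rewrite mulr_ge0 ?ltW// divr_gt0.
have u_le k m j : u k j <= u (k + m)%N j.
  by elim: m => [|m IH]; rewrite ?addn0// addnS (le_trans IH).
have v_le k m j :
    u (k + m)%N j + (f (k + m)%N).2 * w ord0 j <= u k j + (f k).2 * w ord0 j.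
  by elim: m => [|m IH]; rewrite ?addn0// addnS (le_trans _ IH).
have uv k m j : u k j <= u m j + (f m).2 * w ord0 j.
  apply: (@le_trans _ _ (u (k + m)%N j)) => //.
  apply: (@le_trans _ _ (u (k + m)%N j + (f (k + m)%N).2 * w ord0 j)).
    by rewrite lerDl mulr_ge0// ltW.
  by rewrite addnC.
(* Every lower corner is below every upper corner, so the coordinatewise supremum of the lower
   corners lies in all the closed boxes. It may miss the half-open ones, which is why the local
   hypothesis speaks of [cbox]. *)
pose a : 'rV[R]_n := \row_j sup (range (u^~ j)).
have ua k : cbox (f k).1 ((f k).1 + (f k).2 *: w) a.
  move=> j; rewrite !mxE; apply/andP; split.
    apply: ub_le_sup; last by exists k.
    by exists (u 0%N j + (f 0%N).2 * w ord0 j) => _ [m _ <-].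
  by apply: ge_sup; [exists (u 0%N j); exists 0%N|move=> _ [m _ <-]; exact: uv].
have [d d0 Hd] := Ploc a (ua 0%N).
have [k Hk] : exists k, (f k).2 < d.
  have [k _ Hk] := near_infty_natSinv_expn_lt (PosNum (divr_gt0 d0 t0)).
  exists k; rewrite f2 mulrC -ltr_pdivlMr//.
  by have := Hk k (leqnn k); rewrite /= mul1r.
by apply: (fP k); apply: Hd => //; rewrite f20 Hk.
Qed.

Lemma subcorner_bisect w c t : (forall j, 0 < w ord0 j) -> 0 < t ->
  hbox c (c + t *: w) = \bigcup_(s in [set: {ffun 'I_n -> bool}])
    hbox (c + (t / 2) *: subcorner w s)
         (c + (t / 2) *: subcorner w s + (t / 2) *: w).
Proof.
move=> w0 t0; apply/seteqP; split => [x Hx|x [s _ Hs] j].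
  exists [ffun j => c ord0 j + t / 2 * w ord0 j <= x ord0 j] => // j.
  have := Hx j; rewrite !mxE ffunE => /andP[].
  case: ifP => [H1 H2 H3|/negbT]; first by rewrite H1/=; lra.
  by rewrite -ltNge => H1 H2 H3; rewrite mulr0 addr0 H2 H1.
have := Hs j; rewrite !mxE => /andP[].
have : 0 < t * w ord0 j by rewrite mulr_gt0.
by case: ifP => _; lra.
Qed.

Lemma subcorner_triv w c t : (forall j, 0 < w ord0 j) -> 0 < t ->
  trivIset [set: {ffun 'I_n -> bool}] (fun s =>
    hbox (c + (t / 2) *: subcorner w s)
         (c + (t / 2) *: subcorner w s + (t / 2) *: w)).
Proof.
move=> w0 t0 s s' _ _ [x [Hs Hs']]; apply/ffunP => j.
have := Hs j; have := Hs' j; rewrite !mxE => /andP[+ +] /andP[].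
have : 0 < t * w ord0 j by rewrite mulr_gt0.
by case: (s j); case: (s' j) => //; lra.
Qed.

Lemma measure_bisect (mu : {measure set 'rV[R]_n -> \bar R}) w c t :
  (forall j, 0 < w ord0 j) -> 0 < t ->
  mu (hbox c (c + t *: w)) = (\sum_(s \in [set: {ffun 'I_n -> bool}])
    mu (hbox (c + (t / 2) *: subcorner w s)
             (c + (t / 2) *: subcorner w s + (t / 2) *: w)))%E.
Proof.
move=> w0 t0; rewrite (subcorner_bisect _ w0 t0) measure_fin_bigcup//.
- exact: finite_finset.
- exact: subcorner_triv.
- by move=> s _; exact: measurable_hbox.
Qed.

(** Both sides are additive over the sub-boxes, so an inequality valid on all of them passes to
    their union, as bisection demands. *)
Lemma hbox_measure_le (mu nu : {measure set 'rV[R]_n -> \bar R}) w c t :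
  (forall j, 0 < w ord0 j) -> 0 < t ->
  (forall a, cbox c (c + t *: w) a -> exists2 d, 0 < d & forall c' t',
     0 < t' < d -> cbox c' (c' + t' *: w) a ->
     (mu (hbox c' (c' + t' *: w)) <= nu (hbox c' (c' + t' *: w)))%E) ->
  (mu (hbox c (c + t *: w)) <= nu (hbox c (c + t *: w)))%E.
Proof.
move=> w0 t0; apply: (bisection_ind (P := fun c t =>
  (mu (hbox c (c + t *: w)) <= nu (hbox c (c + t *: w)))%E) w0 t0) =>
    c' t' t'0 H.
by rewrite !measure_bisect//; apply: lee_fsum => [|s _];
  [exact: finite_finset|exact: H].
Qed.

End bisection.

(** * Local volume distortion *)

Section strict_differentiability.
Context {R : realType}.

Lemma rV_mulmx_norm m n (v : 'rV[R]_m) (M : 'M[R]_(m, n)) :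
  `|v *m M| <= m%:R * `|v| * `|M|.
Proof.
apply/rV_norm_leP; first by rewrite !mulr_ge0.
move=> j; rewrite mxE; apply: (le_trans (ler_norm_sum _ _ _)).
apply: (@le_trans _ _ (\sum_(i < m) `|v| * `|M|)); last first.
  by rewrite sumr_const card_ord -mulrA mulr_natl.
apply: ler_sum => i _; rewrite normrM; apply: ler_pM => //.
  exact: rV_norm_coord.
rewrite [leRHS]/Num.norm/= mx_normrE.
by apply: (le_bigmax _ (fun ij : 'I_m * 'I_n => `|M ij.1 ij.2|) (i, j)).
Qed.

(** The mean value theorem fails for vector values, so it is applied to one coordinate along the
    segment; the intermediate point depends on [j]. *)
Lemma rV_segment_mvt m n (phi : 'rV[R]_m -> 'rV[R]_n) (x y : 'rV[R]_m)
  (j : 'I_n) :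
  (forall s : R, 0 <= s <= 1 -> differentiable phi (y + s *: (x - y))) ->
  exists2 s : R, 0 <= s <= 1 & (phi x - phi y) ord0 j =
    ((x - y) *m 'J phi (y + s *: (x - y))) ord0 j.
Proof.
move=> dphi; set v := x - y.
pose g (s : R) : 'rV[R]_m := y + s *: v.
have dg s : is_diff s g (fun h => h *: v).
  have -> : (fun h : R => h *: v) = 0 \+ (fun h : R => h *: v).
    by apply/funext => h /=; rewrite add0r.
  exact: is_diffD.
have df (s : R) : 0 <= s <= 1 -> is_derive s (1 : R)
  (fun s : R => phi (g s) ord0 j)
    ((v *m 'J phi (g s)) ord0 j).
  move=> s01.
  have dpg : differentiable (phi \o g) s by apply: differentiable_comp => //;
    exact: dphi.
  have Dpg : 'D_1 (phi \o g) s = v *m 'J phi (g s).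
    rewrite deriveE// diff_comp//; last exact: dphi.
    rewrite /= diff_val scale1r -deriveEjacobian; last exact: dphi.
    by rewrite deriveE//; exact: dphi.
  have dv : derivable (phi \o g) s 1 by exact: diff_derivable.
  have /derivable_mxP/(_ ord0 j) dj := dv.
  split => //; rewrite -Dpg derive_mx// mxE//.
have [] := @MVT_segment R (fun s => phi (g s) ord0 j)
  (fun s => (v *m 'J phi (g s)) ord0 j) 0 1 ler01.
- by move=> s; rewrite in_itv/= => /andP[s0 s1]; apply: df; rewrite !ltW.
- apply: derivable_within_continuous => s; rewrite in_itv/= => s01.
  by have := df s s01 => -[].
move=> s; rewrite in_itv/= => s01 H; exists s => //.
by move: H; rewrite subr0 mulr1 /g scale1r scale0r addr0 /v subrKC => <-;
  rewrite !mxE.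
Qed.

(** The error is controlled between any two points near [a], not just against [a] itself. This comes
    from the continuity of the Jacobian along segments and is what makes a contraction possible. *)
Lemma C1_strict_diff n (B : set 'rV[R]_n) (phi : 'rV[R]_n -> 'rV[R]_n)
  (a : 'rV[R]_n) (k : R) :
  open B -> C1_on B phi -> B a -> 0 < k ->
  exists2 d : R, 0 < d & (forall x, `|x - a| < d -> B x) /\
    forall x y, `|x - a| < d -> `|y - a| < d ->
      `|phi x - phi y - (x - y) *m 'J phi a| <= k * `|x - y|.
Proof.
move=> oB [dphi cJ] Ba k0.
have [d1 d10 Hd1] := open_rV_ball oB Ba.
have cJa : {for a, continuous (jacobian phi)}.
  by move: cJ; rewrite continuous_open_subspace// => /(_ a); apply; rewrite inE.
(* The division absorbs the factor [n] of [rV_mulmx_norm], with [n.+1] to remain legitimate for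
   [n = 0]. *)
pose k' := k / n.+1%:R.
have k'0 : 0 < k' by rewrite divr_gt0.
have /cvgrPdist_lt/(_ _ k'0) := cJa.
move=> /nbhs_ballP[d2 d20 Hd2].
exists (Num.min d1 d2); first by rewrite lt_min d10.
split=> [x|x y]; first by rewrite lt_min => /andP[/Hd1].
move=> xa ya.
have seg (s : R) : 0 <= s <= 1 -> `|y + s *: (x - y) - a| < Num.min d1 d2.
  move=> /andP[s0 s1].
  have -> : y + s *: (x - y) - a = s *: (x - a) + (1 - s) *: (y - a).
    by apply/rowP => j; rewrite !mxE; ring.
  rewrite (le_lt_trans (ler_normD _ _))// !normrZ ger0_norm//
    ger0_norm ?subr_ge0//.
  have [->|s0'] := eqVneq s 0; first by rewrite mul0r add0r subr0 mul1r.
  have sp : 0 < s by rewrite lt_def s0'.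
  have : s * `|x - a| < s * Num.min d1 d2 by rewrite ltr_pM2l.
  have : (1 - s) * `|y - a| <= (1 - s) * Num.min d1 d2.
    by rewrite ler_wpM2l ?subr_ge0// ltW.
  lra.
apply/rV_norm_leP; first by rewrite mulr_ge0// ltW.
move=> j; have [|s s01 Hs] := @rV_segment_mvt n n phi x y j.
  by move=> s s01; apply/dphi/Hd1; have := seg s s01; rewrite lt_min => /andP[].
have -> : (phi x - phi y - (x - y) *m 'J phi a) ord0 j =
    ((x - y) *m ('J phi (y + s *: (x - y)) - 'J phi a)) ord0 j.
  by rewrite mulmxBr mxE Hs [RHS]mxE.
apply: le_trans (rV_norm_coord _ _) _; apply: le_trans (rV_mulmx_norm _ _) _.
rewrite mulrAC ler_wpM2r//.
apply: (@le_trans _ _ (n.+1%:R * k')); last first.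
  by rewrite /k' mulrC divfK.
apply: ler_pM => //; first by rewrite ler_nat.
rewrite distrC ltW//; apply: Hd2; rewrite -ball_normE /ball_ /= distrC.
by have := seg s s01; rewrite lt_min => /andP[].
Qed.

End strict_differentiability.

Section local_volume.
Context {R : realType} (n : nat).
Notation mu := (lebesgue_rV n : set 'rV[R]_n -> \bar R).

Lemma affine_preimage_measure (S : 'M[R]_n) (b : 'rV[R]_n) (Y : set 'rV[R]_n) :
  S \in unitmx -> measurable Y ->
  (`|\det S|%:E * mu ((fun y => y *m S + b)%R @^-1` Y) = mu Y)%E.
Proof.
move=> uS mY; have mL := measurable_rV_affine S b.
have mLY : measurable ((fun y : 'rV[R]_n => y *m S + b) @^-1` Y).
  by rewrite -[X in measurable X]setTI; exact: mL.
have EY : (\int[lebesgue_rV n]_x (\1_Y x)%:E = mu Y)%E.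
  by rewrite integral_indic// setIT.
have ELY : (\int[lebesgue_rV n]_x (\1_Y (x *m S + b)%R)%:E =
    mu ((fun y => y *m S + b)%R @^-1` Y))%E.
  by rewrite -(setIT (_ @^-1` _)) -integral_indic.
rewrite -EY -ELY.
apply: (unitmx_affine_scaling uS (h := fun x => (\1_Y x)%:E)) => //.
exact/measurable_EFinP/measurable_indic.
Qed.

(** In [k] the product is a polynomial, hence continuous at 0. The values [e = 2] and [e = - 3] will
    correspond to the thickened and to the shrunken box. *)
Lemma prod_perturb (w : 'rV[R]_n) (e q : R) : 0 < q ->
  exists2 k0 : R, 0 < k0 & forall k, 0 < k < k0 ->
  `|\prod_j (w ord0 j + e * k) - \prod_j w ord0 j| < q.
Proof.
move=> q0; pose p : {poly R} := \prod_j ((w ord0 j)%:P + e *: 'X).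
have pE k : p.[k] = \prod_j (w ord0 j + e * k).
  by rewrite horner_prod; apply: eq_bigr => j _; rewrite !hornerE.
have /cvgrPdist_lt/(_ _ q0) := @continuous_horner R p 0.
move=> /nbhs_ballP[d d0 Hd]; exists d => // k /andP[k0 kd].
have := Hd k; rewrite -ball_normE /ball_ /= sub0r normrN gtr0_norm// => /(_ kd).
rewrite !pE distrC; congr (`|_ - _| < _); apply: eq_bigr => j _.
by rewrite mulr0 addr0.
Qed.

Lemma lebesgue_hbox_scale (w c : 'rV[R]_n) t : (forall j, 0 < w ord0 j) ->
  0 < t ->
  mu (hbox c (c + t *: w)) = (t ^+ n * \prod_j w ord0 j)%:E.
Proof.
move=> w0 t0; rewrite lebesgue_hbox.
  have -> : t ^+ n = \prod_(j < n) t by rewrite prodr_const card_ord.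
  congr EFin; rewrite -big_split/=.
  by apply: eq_bigr => j _; rewrite !mxE addrAC subrr add0r.
by move=> j; rewrite !mxE lerDl ltW// mulr_gt0.
Qed.

Lemma cbox_dist (w c x y : 'rV[R]_n) t : 0 <= t ->
  cbox c (c + t *: w) x -> cbox c (c + t *: w) y -> `|x - y| <= t * `|w|.
Proof.
move=> t0 Hx Hy; apply/rV_norm_leP; first by rewrite mulr_ge0.
move=> j; apply: (@le_trans _ _ (t * w ord0 j)); last first.
  by rewrite ler_wpM2l// (le_trans (ler_norm _))// rV_norm_coord.
have := Hx j; have := Hy j; rewrite !mxE ler_norml => /andP[? ?] /andP[? ?].
by apply/andP; split; lra.
Qed.

Variables (B : set 'rV[R]_n) (phi : 'rV[R]_n -> 'rV[R]_n) (a w : 'rV[R]_n).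
Hypothesis oB : open B.
Hypothesis phi1 : C1_on B phi.
Hypothesis Ba : B a.
Hypothesis w0 : forall j, 0 < w ord0 j.

(** The bound by the distance of [x] and [y] gives the contraction, the bound by [k * t] the
    displacement of the faces of a box. [S] will be a change of coordinates in which the
    differential is simple. *)
Let strict_diff_box (S : 'M[R]_n) k : 0 < k ->
  exists2 d : R, 0 < d & forall c t, 0 < t < d -> cbox c (c + t *: w) a ->
    cbox c (c + t *: w) `<=` B /\
    forall x y, cbox c (c + t *: w) x -> cbox c (c + t *: w) y ->
      `|(phi x - phi y - (x - y) *m 'J phi a) *m S| <= k * `|x - y| /\
      `|(phi x - phi y - (x - y) *m 'J phi a) *m S| <= k * t.
Proof.
move=> k0; pose m : R := n%:R * (`|w| + 1) * `|S| + 1.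
have m0 : 0 < m by rewrite ltr_wpDl// !mulr_ge0// addr_ge0.
have km0 : 0 < k / m by rewrite divr_gt0.
have [d d0 [Hd1 Hd2]] := C1_strict_diff oB phi1 Ba km0.
have w1 : 0 < `|w| + 1 by rewrite ltr_wpDl.
exists (d / (`|w| + 1)); first by rewrite divr_gt0.
move=> c t /andP[t0 td] ca.
have near_a x : cbox c (c + t *: w) x -> `|x - a| < d.
  move=> cx; apply: le_lt_trans (cbox_dist (ltW t0) cx ca) _.
  move: td; rewrite ltr_pdivlMr// => td.
  by apply: le_lt_trans _ td; rewrite ler_pM2l// lerDl.
split=> [x /near_a/Hd1//|x y cx cy].
have key : `|(phi x - phi y - (x - y) *m 'J phi a) *m S| <=
    k * (n%:R * `|x - y| * `|S| / m).
  apply: le_trans (rV_mulmx_norm _ _) _.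
  apply: (@le_trans _ _ (n%:R * (k / m * `|x - y|) * `|S|)).
    by rewrite ler_wpM2r// ler_wpM2l// Hd2//; exact: near_a.
  by rewrite le_eqVlt; apply/orP; left; apply/eqP; ring.
split; apply: (le_trans key); rewrite ler_pM2l// ler_pdivrMr//.
  rewrite mulrAC [leRHS]mulrC ler_wpM2r// /m.
  apply: (@le_trans _ _ (n%:R * (`|w| + 1) * `|S|)); last by rewrite lerDl.
  by rewrite ler_wpM2r// ler_peMr// lerDr.
apply: (@le_trans _ _ (n%:R * (t * (`|w| + 1)) * `|S|)).
  rewrite ler_wpM2r// ler_wpM2l//.
  apply: (le_trans (cbox_dist (ltW t0) cx cy)).
  by rewrite ler_pM2l// lerDl.
have -> : t * m = n%:R * (t * (`|w| + 1)) * `|S| + t by rewrite /m; ring.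
by rewrite lerDl ltW.
Qed.

Let T := 'J phi a.

(** With [L] inverting the linearisation of [phi] at [a], the map [L \o phi] moves points of the box
    by at most [k * t], so it sends the box into one of sides [t * (w_j + 2 k)]. A measurable
    superset [K] is used because measurability of the image is not yet available. *)
Lemma C1_box_upper_unit (q : R) : T \in unitmx -> 0 < q ->
  exists2 d : R, 0 < d & forall c t, 0 < t < d -> cbox c (c + t *: w) a ->
    exists2 K, measurable K /\ phi @` hbox c (c + t *: w) `<=` K &
    (mu K <= (`|\det T| + q)%:E * mu (hbox c (c + t *: w)))%E.
Proof.
move=> uT q0.
have w00 : 0 < \prod_j w ord0 j by exact: prodr_gt0.
have dT0 : 0 < `|\det T| by rewrite normr_gt0 -unitfE -unitmxE.
have [|k0 k00 Hk0] := prod_perturb w 2 (q := q * \prod_j w ord0 j / `|\det T|).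
  by rewrite divr_gt0// mulr_gt0.
pose k := k0 / 2; have kk : 0 < k < k0.
  by rewrite divr_gt0//= ltr_pdivrMr// ltr_pMr// ltr1n.
have /andP[k_gt0 _] := kk.
have [d d0 Hd] := strict_diff_box (invmx T) k_gt0.
exists d => // c t td ca; have /andP[t0 _] := td.
have [_ He] := Hd c t td ca.
pose kt : 'rV[R]_n := const_mx (k * t).
pose L (y : 'rV[R]_n) := y *m invmx T + (a - phi a *m invmx T).
exists (L @^-1` cbox (c - kt) (c + t *: w + kt)).
  split.
    rewrite -[X in measurable X]setTI; apply: measurable_rV_affine => //.
    exact: measurable_cbox.
  move=> _ [x xQ <-] j; have [_] := He x a (hbox_cbox xQ) ca.
  move=> /rV_norm_leP Hj; have {Hj} := Hj _ j.
  rewrite mulmxBl mulmxK// mulmxBl => Hj.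
  have := Hj (mulr_ge0 (ltW k_gt0) (ltW t0)).
  rewrite /L !mxE => /ler_normlP[]; have := hbox_cbox xQ j;
    rewrite !mxE => /andP[].
  by move=> *; apply/andP; split; lra.
have uS : invmx T \in unitmx by rewrite unitmx_inv.
have := affine_preimage_measure (a - phi a *m invmx T) uS
  (measurable_cbox (c - kt) (c + t *: w + kt)).
rewrite det_inv normfV lebesgue_cbox; last first.
  move=> j; rewrite !mxE; have := mulr_gt0 k_gt0 t0.
  by have := mulr_gt0 t0 (w0 j); lra.
rewrite -/L => HL.
have -> : mu (L @^-1` cbox (c - kt) (c + t *: w + kt)) =
    (`|\det T|%:E * (`|\det T|^-1%:E * mu
      (L @^-1` cbox (c - kt) (c + t *: w + kt))))%E.
  by rewrite muleA -EFinM divff ?mul1e// gt_eqF.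
rewrite HL lebesgue_hbox_scale// -!EFinM lee_fin.
rewrite (eq_bigr (fun j => t * (w ord0 j + 2 * k))); last first.
  by move=> j _; rewrite !mxE; ring.
rewrite big_split/= prodr_const card_ord mulrCA [leRHS]mulrCA ler_pM2l
  ?exprn_gt0//.
have := Hk0 k kk; rewrite ltr_pdivlMr// => /ltW; rewrite -{1}(gtr0_norm dT0).
rewrite -normrM => /(le_trans (ler_norm _)).
rewrite mulrBl mulrDl; lra.
Qed.

(** The half-open upper faces cost an extra margin: the fixed point is sought in a closed box [U],
    cut by [k * t] at the top, and the target stays a further [k * t] inside [U] on both sides. Its
    sides are [t * (w_j - 3 k)], hence [- 3]. *)
Lemma C1_box_lower_unit (q : R) : T \in unitmx -> 0 < q ->
  exists2 d : R, 0 < d & forall c t, 0 < t < d -> cbox c (c + t *: w) a ->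
    exists2 K, measurable K /\ K `<=` phi @` hbox c (c + t *: w) &
    ((`|\det T| - q)%:E * mu (hbox c (c + t *: w)) <= mu K)%E.
Proof.
move=> uT q0.
have w00 : 0 < \prod_j w ord0 j by exact: prodr_gt0.
have dT0 : 0 < `|\det T| by rewrite normr_gt0 -unitfE -unitmxE.
have [|k0 k00 Hk0] := prod_perturb w (- 3)
  (q := q * \prod_j w ord0 j / `|\det T|).
  by rewrite divr_gt0// mulr_gt0.
have [wm wm0 Hwm] : exists2 m : R, 0 < m & forall j, m <= w ord0 j.
  exists (\big[Num.min/1]_j w ord0 j); first by apply: lt_bigmin => //.
  by move=> j; exact: bigmin_le.
(* The three bounds serve, in order, the volume estimate, the nonemptiness of the shrunken boxes and
   the contraction ratio. *)
pose k := Num.min (k0 / 2) (Num.min (wm / 4) (1 / 2)).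
have k_gt0 : 0 < k by rewrite !lt_min !divr_gt0.
have kk : 0 < k < k0.
  by rewrite k_gt0 (@le_lt_trans _ _ (k0 / 2))// ?ge_min ?lexx// ltr_pdivrMr//
    ltr_pMr// ltr1n.
have k1 : k <= 1 / 2 by rewrite !ge_min lexx !orbT.
have kw j : k * 4 <= w ord0 j.
  by apply: le_trans (Hwm j); rewrite -ler_pdivlMr// !ge_min lexx !orbT.
have [d d0 Hd] := strict_diff_box (invmx T) k_gt0.
exists d => // c t td ca; have /andP[t0 _] := td.
have [_ He] := Hd c t td ca.
pose kt : 'rV[R]_n := const_mx (k * t).
pose L (y : 'rV[R]_n) := y *m invmx T + (a - phi a *m invmx T).
exists (L @^-1` cbox (c + kt) (c + t *: w - kt - kt)).
  split.
    rewrite -[X in measurable X]setTI; apply: measurable_rV_affine => //.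
    exact: measurable_cbox.
  move=> y Ly.
  pose U := cbox c (c + t *: w - kt).
  have UQ : U `<=` hbox c (c + t *: w).
    move=> x Ux j; have := Ux j; rewrite !mxE => /andP[-> Hx]/=.
    by apply: le_lt_trans Hx _; rewrite ltrBlDr ltrDl mulr_gt0.
  (* Fixed points of [h] are the solutions of [phi x = y]; [h] is a contraction
     of [U], because [L \o phi] is close to the identity. *)
  pose h (x : 'rV[R]_n) : 'rV[R]_n := x - L (phi x) + L y.
  have hE x : h x - L y = - ((phi x - phi a - (x - a) *m T) *m invmx T).
    rewrite /h /L addrK mulmxBl mulmxK// mulmxBl.
    by apply/rowP => j; rewrite !mxE; ring.
  have hU : {homo h : x / U x >-> U x}.
    move=> x /UQ/hbox_cbox cx j; have [_] := He x a cx ca.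
    move=> /rV_norm_leP Hj; have {Hj} := Hj (mulr_ge0 (ltW k_gt0) (ltW t0)) j.
    have := hE x; set e := (_ *m invmx T); rewrite -/e => /eqP;
      rewrite subr_eq => /eqP ->.
    move=> /ler_normlP[e1 e2]; move: (Ly j); rewrite /=.
    move: (L y) e e1 e2 => z e e1 e2; rewrite !mxE => /andP[y1 y2].
    by apply/andP; split; lra.
  have isf : isFun _ _ U U h by split.
  pose hf : {fun U >-> U} := HB.pack h isf.
  have k_ge0 : 0 <= k by exact: ltW.
  have [|||x Ux xE] := @banach_fixed_point R 'rV[R]_n U hf.
  - exists (NngNum k_ge0); split => /=;
    first by rewrite (le_lt_trans k1)// ltr_pdivrMr// mul1r ltr1n.
    move=> [x x'] /= [/UQ/hbox_cbox cx /UQ/hbox_cbox cx'].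
    have [+ _] := He x x' cx cx'.
    rewrite mulmxBl mulmxK// => /(le_trans _); apply.
    rewrite -normrN le_eqVlt; apply/orP; left; apply/eqP; congr (`|_|).
    rewrite /h /L mulmxBl; apply/rowP => j; rewrite !mxE; ring.
  - by apply: compact_closed; [exact: norm_hausdorff|exact: cbox_compact].
  - exists c => j; rewrite !mxE lexx/=.
    have := ler_wpM2l (ltW t0) (kw j); have := mulr_gt0 k_gt0 t0; lra.
  exists x; first exact: UQ.
  have : L (phi x) = L y.
    have : x = x - L (phi x) + L y by exact: xE.
    by rewrite -addrA -[LHS]addr0 => /addrI/esym/eqP;
      rewrite addrC subr_eq0 => /eqP ->.
  rewrite /L => /addIr/(congr1 (mulmx^~ T)); rewrite !mulmxKV//.
have uS : invmx T \in unitmx by rewrite unitmx_inv.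
have := affine_preimage_measure (a - phi a *m invmx T) uS
  (measurable_cbox (c + kt) (c + t *: w - kt - kt)).
rewrite det_inv normfV lebesgue_cbox; last first.
  move=> j; rewrite !mxE; have := mulr_gt0 k_gt0 t0.
  by have := ler_wpM2l (ltW t0) (kw j); lra.
rewrite -/L => HL.
have -> : mu (L @^-1` cbox (c + kt) (c + t *: w - kt - kt)) =
    (`|\det T|%:E * (`|\det T|^-1%:E * mu
      (L @^-1` cbox (c + kt) (c + t *: w - kt - kt))))%E.
  by rewrite muleA -EFinM divff ?mul1e// gt_eqF.
rewrite HL lebesgue_hbox_scale// -!EFinM lee_fin.
rewrite [X in _ <= _ * X](eq_bigr (fun j => t * (w ord0 j + - 3 * k)));
  last first.
  by move=> j _; rewrite !mxE; ring.
rewrite big_split/= prodr_const card_ord mulrCA [leRHS]mulrCA ler_pM2l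
  ?exprn_gt0//.
have := Hk0 k kk; rewrite ltr_pdivlMr// => /ltW; rewrite -{1}(gtr0_norm dT0).
rewrite -normrM -normrN => /(le_trans (ler_norm _)).
rewrite mulrBl -mulNr mulrBl; lra.
Qed.

(* In suitable coordinates the singular differential kills the coordinate [i], so
   the image of a box of size [t] has thickness [k * t] in that direction. *)
Lemma C1_box_upper_singular (q : R) : T \notin unitmx -> 0 < q ->
  exists2 d : R, 0 < d & forall c t, 0 < t < d -> cbox c (c + t *: w) a ->
    exists2 K, measurable K /\ phi @` hbox c (c + t *: w) `<=` K &
    (mu K <= q%:E * mu (hbox c (c + t *: w)))%E.
Proof.
move=> nuT q0.
have w00 : 0 < \prod_j w ord0 j by exact: prodr_gt0.
have rT : (\rank T < n)%N.
  by rewrite ltn_neqAle rank_leq_row andbT; move: nuT; rewrite -row_free_unit.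
(* [T] is an invertible matrix times a partial identity of rank [\rank T] times [row_ebase T].
   Removing the last factor leaves zero columns from index [\rank T] on; [i] is the first of
   them. *)
pose i := Ordinal rT; pose S := invmx (row_ebase T).
have uS : S \in unitmx by rewrite unitmx_inv row_ebase_unit.
have dS0 : 0 < `|\det S| by rewrite normr_gt0 -unitfE -unitmxE.
have TSi (v : 'rV[R]_n) : (v *m T *m S) ord0 i = 0.
  rewrite -mulmxA -[X in X *m S](mulmx_ebase T) mulmxK ?row_ebase_unit//.
  rewrite mulmxA mxE big1// => l _; rewrite [X in _ * X]mxE.
  by case: eqP => [/= ->|_]; rewrite ?ltnn/= mulr0.
pose M := n%:R * `|w| * `|T *m S|.
have M0 : 0 <= M by rewrite !mulr_ge0.
pose P := \prod_(j < n | j != i) (2 * (M + 1)).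
have P0 : 0 < P by apply: prodr_gt0 => j _; rewrite mulr_gt0// ltr_wpDl.
(* The second argument makes the thin slab meet the final volume bound; [k <= 1] lets the error fit
   into the [M + 1] of the other directions. *)
pose k := Num.min 1 (q * `|\det S| * \prod_j w ord0 j / (2 * P)).
have k_gt0 : 0 < k by rewrite lt_min ltr01/= divr_gt0// !mulr_gt0.
have k1 : k <= 1 by rewrite ge_min lexx.
have [d d0 Hd] := strict_diff_box S k_gt0.
exists d => // c t td ca; have /andP[t0 _] := td.
have [_ He] := Hd c t td ca.
pose r : 'rV[R]_n := \row_j (t * (if j == i then k else M + 1)).
have r0 j : 0 < r ord0 j.
  by rewrite mxE mulr_gt0//; case: ifP => // _; rewrite ltr_wpDl.
pose L (y : 'rV[R]_n) := y *m S + - (phi a *m S).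
exists (L @^-1` cbox (- r) r).
  split.
    rewrite -[X in measurable X]setTI; apply: measurable_rV_affine => //.
    exact: measurable_cbox.
  move=> _ [x xQ <-] j; have [_] := He x a (hbox_cbox xQ) ca.
  move=> /rV_norm_leP Hj; have {Hj} := Hj (mulr_ge0 (ltW k_gt0) (ltW t0)) j.
  have -> : L (phi x) = (x - a) *m T *m S + (phi x - phi a - (x - a) *m T) *m S.
    by rewrite /L !mulmxBl; apply/rowP => l; rewrite !mxE; ring.
  move: (_ *m S) => e Hj.
  have HM : `|((x - a) *m T *m S) ord0 j| <= if j == i then 0 else M * t.
    case: eqP => [->|_]; first by rewrite TSi normr0.
    apply: le_trans (rV_norm_coord _ _) _; rewrite -mulmxA.
    apply: le_trans (rV_mulmx_norm _ _) _.
    have -> : M * t = n%:R * (t * `|w|) * `|T *m S| by rewrite /M; ring.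
    rewrite ler_wpM2r// ler_wpM2l//.
    exact: (cbox_dist (ltW t0) (hbox_cbox xQ) ca).
  have : `|((x - a) *m T *m S + e) ord0 j| <= r ord0 j.
    rewrite mxE; apply: le_trans (ler_normD _ _) _.
    apply: le_trans (lerD HM Hj) _; rewrite mxE; case: ifP => _.
      by rewrite add0r mulrC.
    have : k * t <= 1 * t by rewrite ler_wpM2r// ltW.
    lra.
  by rewrite ler_norml [X in _ -> X <= _ <= _]mxE.
have := affine_preimage_measure (- (phi a *m S)) uS (measurable_cbox (- r) r).
rewrite -/L lebesgue_cbox; last first.
  by move=> j; rewrite mxE; have := r0 j; lra.
move=> HL; have dSE : (0 < `|\det S|%:E)%E by rewrite lte_fin.
rewrite -(lee_pmul2l _ dSE)// HL lebesgue_hbox_scale// -!EFinM lee_fin.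
rewrite (eq_bigr (fun j => t * (2 * (if j == i then k else M + 1))));
  last first.
  by move=> j _; rewrite !mxE; ring.
rewrite big_split/= prodr_const card_ord.
rewrite [leRHS](_ : _ = t ^+ n * (q * `|\det S| * \prod_j w ord0 j));
  last by ring.
rewrite ler_pM2l ?exprn_gt0//.
rewrite (bigD1 i)//= eqxx (eq_bigr (fun=> 2 * (M + 1))); last first.
  by move=> j /negbTE ->.
rewrite -/P [leLHS](_ : _ = k * (2 * P)); last by ring.
by rewrite -ler_pdivlMr ?mulr_gt0// ge_min lexx orbT.
Qed.

End local_volume.

(** * Change of variables *)

Section density_measure.
Local Open Scope ereal_scope.
Context d (T : measurableType d) (R : realType)
  (mu : {measure set T -> \bar R}).
Variable f : T -> \bar R.
Hypothesis mf : measurable_fun setT f.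
Hypothesis f0 : forall x, 0 <= f x.

(** The two proofs are arguments so that the measure structure can be attached to the function
    itself. *)
Definition density_measure of measurable_fun setT f & (forall x, 0 <= f x) :
  set T -> \bar R := fun A => \int[mu]_(x in A) f x.
Notation nu := (density_measure mf f0).

Let nu0 : nu set0 = 0.
Proof. exact: integral_set0. Qed.

Let nu_ge0 A : 0 <= nu A.
Proof. by apply: integral_ge0. Qed.

Let nu_sigma_additive : semi_sigma_additive nu.
Proof.
move=> F mF tF mUF; rewrite /density_measure ge0_integral_bigcup//=; last first.
  exact: measurable_funTS.
by apply: is_cvg_ereal_nneg_natsum_cond => n _ _; exact: nu_ge0.
Qed.

HB.instance Definition _ := isMeasure.Build _ _ _ nu nu0 nu_ge0
  nu_sigma_additive.

End density_measure.

Section eq_integral_preimage.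
Local Open Scope ereal_scope.
Context d1 d2 d (T1 : measurableType d1) (T2 : measurableType d2)
  (T : measurableType d) (R : realType).
Variables (m1 : {measure set T1 -> \bar R}) (m2 : {measure set T2 -> \bar R}).
Variables (k1 : T1 -> R) (k2 : T2 -> R) (g1 : T1 -> T) (g2 : T2 -> T).
Hypothesis (mk1 : measurable_fun setT k1) (mk2 : measurable_fun setT k2).
Hypothesis (k10 : forall x, (0 <= k1 x)%R) (k20 : forall x, (0 <= k2 x)%R).
Hypothesis (mg1 : measurable_fun setT g1) (mg2 : measurable_fun setT g2).

Import HBNNSimple.

Lemma integral_preimage_fimfun d' (T' : measurableType d')
  (m : {measure set T' -> \bar R}) (k : T' -> R) (g : T' -> T)
  (s : {nnsfun T >-> R}) :
  measurable_fun setT k -> (forall x, (0 <= k x)%R) -> measurable_fun setT g ->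
  \int[m]_x ((k x)%:E * (s (g x))%:E) =
  \sum_(y \in range s) (y%:E *
    \int[m]_x ((k x)%:E * (\1_(s @^-1` [set y]) (g x))%:E)).
Proof.
move=> mk k0 mg.
have mi y : measurable_fun setT (fun x => (\1_(s @^-1` [set y]) (g x) : R)).
  by apply: measurableT_comp mg; exact: measurable_indic.
under eq_integral => x _.
  rewrite fimfunE -fsumEFin// ge0_mule_fsumr; last first.
    move=> y; rewrite lee_fin; exact: nnfun_muleindic_ge0.
  over.
rewrite ge0_integral_fsum//; last 2 first.
- move=> y; apply: emeasurable_funM; first exact/measurable_EFinP.
  by apply/measurable_EFinP; apply: measurable_funM.
- by move=> y x _; rewrite mule_ge0// lee_fin//; exact: nnfun_muleindic_ge0.
apply: eq_fsbigr => y; rewrite inE => -[x _ <-].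
rewrite -ge0_integralZl//.
- by apply: eq_integral => z _; rewrite EFinM muleCA.
- by apply: emeasurable_funM; apply/measurable_EFinP.
- by move=> z _; rewrite mule_ge0// lee_fin.
- by rewrite lee_fin.
Qed.

(** Approximation from indicators through simple functions to monotone limits. The weights [k1],
    [k2] and the maps [g1], [g2] stay explicit, so that both sides of a change of variables fit one
    pattern. *)
Lemma ge0_eq_integral_preimage (h : T -> \bar R) :
  (forall Y, measurable Y -> \int[m1]_x ((k1 x)%:E * (\1_Y (g1 x))%:E) =
                            \int[m2]_x ((k2 x)%:E * (\1_Y (g2 x))%:E)) ->
  measurable_fun setT h -> (forall y, 0 <= h y) ->
  \int[m1]_x ((k1 x)%:E * h (g1 x)) = \int[m2]_x ((k2 x)%:E * h (g2 x)).
Proof.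
move=> H mh h0.
pose s := nnsfun_approx measurableT mh.
have lim d' (T' : measurableType d') (m : {measure set T' -> \bar R})
  (k : T' -> R) (g : T' -> T) :
  measurable_fun setT k -> (forall x, (0 <= k x)%R) -> measurable_fun setT g ->
  \int[m]_x ((k x)%:E * h (g x)) =
    limn (fun n => \int[m]_x ((k x)%:E * (s n (g x))%:E)).
  move=> mk k0 mg; rewrite -monotone_convergence//.
  - apply: eq_integral => x _; apply/esym/cvg_lim => //.
    by apply: cvgeZl => //; exact: cvg_nnsfun_approx.
  - move=> n; apply: emeasurable_funM; first exact/measurable_EFinP.
    by apply/measurable_EFinP; exact: measurableT_comp.
  - by move=> n x _; rewrite mule_ge0// lee_fin.
  - move=> x _ a b ab; rewrite lee_wpmul2l// lee_fin//.
    by have /lefP := nd_nnsfun_approx measurableT mh ab; exact.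
rewrite !lim//; congr (limn _); apply/funext => n.
rewrite !integral_preimage_fimfun//; apply: eq_fsbigr => y _.
by rewrite H.
Qed.

End eq_integral_preimage.

(** * Extended Jacobian and measurable inverse *)

Section C1_bijection.
Context {R : realType} (n : nat).
Notation mu := (lebesgue_rV n : set 'rV[R]_n -> \bar R).

Lemma cvg_det {T : Type} (F : set_system T) (f : T -> 'M[R]_n) (M : 'M[R]_n) :
  Filter F -> (forall i j, f x i j @[x --> F] --> M i j) ->
  \det (f x) @[x --> F] --> \det M.
Proof.
move=> FF fM; rewrite /determinant.
apply: cvg_big => [|s _]; first exact: add_continuous.
apply: cvgM; first exact: cvg_cst.
by apply: cvg_big => [|i _]; [exact: mul_continuous|exact: fM].
Qed.

Variables (A B : set 'rV[R]_n) (phi : 'rV[R]_n -> 'rV[R]_n).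
Hypotheses (oA : open A) (oB : open B) (bij : set_bij B A phi).
Hypothesis phi1 : C1_on B phi.

Lemma C1_continuous x : B x -> {for x, continuous phi}.
Proof. by move=> Bx; apply: differentiable_continuous; apply: phi1.1. Qed.

Definition absdet (x : 'rV[R]_n) : R := `|\det ('J phi x)|.

Lemma absdet_continuous x : B x -> {for x, continuous absdet}.
Proof.
move=> Bx; suff H : \det ('J phi y) @[y --> x] --> \det ('J phi x).
  exact: (cvg_norm H).
apply: (@cvg_det _ (nbhs x) (jacobian phi)) => i j.
have cJ : {for x, continuous (jacobian phi)}.
  by case: phi1 => _; rewrite continuous_open_subspace// => /(_ x); apply;
    rewrite inE.
exact: (cvg_comp _ _ cJ (@coord_continuous R n n i j ('J phi x))).
Qed.

(** The extension by zero is measurable on the whole space and switches off the arbitrary value that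
    [ext_map] takes outside [B]. *)
Definition density : 'rV[R]_n -> R := absdet \_ B.

Lemma density_ge0 x : 0 <= density x.
Proof. by rewrite /density patchE; case: ifP => _ //; exact: normr_ge0. Qed.

Lemma measurable_density : measurable_fun setT density.
Proof.
apply: (measurable_restrictT _ (open_rV_measurable oB)).1.
apply: open_continuous_rV_measurable => // x Bx; exact: absdet_continuous.
Qed.

Definition ext_map : 'rV[R]_n -> 'rV[R]_n := phi \_ B.

Lemma measurable_ext_map : measurable_fun setT ext_map.
Proof.
apply/measurable_fun_rVP => j.
have -> : (fun x => ext_map x ord0 j) = (fun x => phi x ord0 j) \_ B.
  by apply/funext => x; rewrite /ext_map !patchE; case: ifP; rewrite ?mxE.
apply: (measurable_restrictT _ (open_rV_measurable oB)).1.
apply: open_continuous_rV_measurable => // x Bx.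
exact: (cvg_comp _ _ (C1_continuous Bx)
  (@coord_continuous R 1 n ord0 j (phi x))).
Qed.

(** The inverse function theorem is silent at critical points, so the argument is topological: [B]
    is a countable union of boxes with compact closure in [B], hence the preimage of a closed
    half-space under the inverse is a countable union of continuous images of compact sets. *)
Lemma measurable_inverse : exists psi : 'rV[R]_n -> 'rV[R]_n,
  [/\ measurable_fun setT psi, forall y, A y -> B (psi y) /\ phi (psi y) = y &
      forall x, B x -> psi (phi x) = x].
Proof.
case: bij => phiA phi_inj phi_surj.
have /choice[g Hg] : forall y, exists x, A y -> B x /\ phi x = y.
  move=> y; have [Ay|nAy] := pselect (A y); last by exists 0.
  by have [x Bx <-] := phi_surj y Ay; exists x.
have Kg x : B x -> g (phi x) = x.
  move=> Bx; have [Bg gE] := Hg _ (phiA x Bx).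
  by apply: phi_inj; rewrite ?inE.
exists (g \_ A); split.
- apply/measurable_fun_rVP => j.
  have -> : (fun x => (g \_ A) x ord0 j) = (fun x => g x ord0 j) \_ A.
    by apply/funext => x; rewrite !patchE; case: ifP; rewrite ?mxE.
  apply: (measurable_restrictT _ (open_rV_measurable oA)).1.
  move=> mA; apply: (measurability _ (RGenCInfty.measurableE R)) => //.
  move=> /= _ [_ [r ->] <-].
  have [I [a [b [Hab BE]]]] := open_hbox_cover oB.
  have -> : A `&` (fun y => g y ord0 j) @^-1` `[r, +oo[%classic =
      \bigcup_(i in I) phi @` (cbox (a i) (b i) `&` [set x | r <= x ord0 j]).
    apply/seteqP; split => [y [Ay /=]|y [i Ii [x [cx /= rx] <-]]].
      rewrite in_itv/= andbT => rg; have [Bg gE] := Hg y Ay.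
      have : B (g y) by []. rewrite {1}BE => -[i Ii gi]; exists i => //.
      by exists (g y) => //; split => //; exact: hbox_cbox.
    have Bx : B x by apply: (Hab i Ii).2.
    by split; [exact: phiA|rewrite /= in_itv/= andbT Kg].
  apply: bigcup_measurable => i Ii; apply: compact_rV_measurable.
  apply: continuous_compact.
    apply: continuous_in_subspaceT => x; rewrite inE => -[cx _].
    by apply: C1_continuous; exact: (Hab i Ii).2.
  apply: (subclosed_compact _ (@cbox_compact R n (a i) (b i))) => [|x []//].
  apply: closedI; first by apply: compact_closed;
    [exact: norm_hausdorff|exact: cbox_compact].
  apply: (closed_comp (f := fun x : 'rV[R]_n => x ord0 j)) (@closed_ge R r) =>
    x _.
  exact: coord_continuous.
- by move=> y Ay; rewrite patchE mem_set//; exact: Hg.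
- by move=> x Bx; rewrite patchE mem_set; [exact: Kg|exact: phiA].
Qed.

End C1_bijection.

(** * Boxes as a generating family *)

Section hbox_sigma_algebra.
Context {R : realType} (n : nat).

Definition hboxes : set (set 'rV[R]_n) := [set Q | exists a b, Q = hbox a b].

Lemma hboxI (a b a' b' : 'rV[R]_n) : hbox a b `&` hbox a' b' =
  hbox (\row_j Num.max (a ord0 j) (a' ord0 j))
    (\row_j Num.min (b ord0 j) (b' ord0 j)).
Proof.
apply/seteqP; split => [x [xa xb] j|x Hx].
  have /andP[x1 x2] := xa j; have /andP[x3 x4] := xb j.
  by rewrite !mxE ge_max lt_min x1 x2 x3 x4.
by split => j; have := Hx j; rewrite !mxE ge_max lt_min
  => /andP[/andP[H1 H2] /andP[H3 H4]]; rewrite ?H1 ?H2 ?H3 ?H4.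
Qed.

Lemma hboxes_setI : setI_closed hboxes.
Proof. by move=> _ _ [a [b ->]] [a' [b' ->]]; rewrite hboxI; do 2!eexists. Qed.

(** A coordinate half-space is open, hence a countable union of boxes, so the coordinates are
    measurable for the sigma-algebra generated by boxes. *)
Lemma measurable_rVE : (@measurable _ 'rV[R]_n : set (set 'rV[R]_n)) =
  <<s hboxes >>.
Proof.
have sG : sigma_algebra setT <<s hboxes >> by exact: smallest_sigma_algebra.
apply/seteqP; split; last first.
  apply: smallest_sub; last by move=> _ [a [b ->]]; exact: measurable_hbox.
  split; first exact: measurable0.
  - by move=> S mS; rewrite setTD; exact: measurableC.
  - by move=> F mF; exact: bigcupT_measurable.
apply: smallest_sub => // Y; rewrite -bigcup_seq/= => -[j _ [Z mZ <-]].
suff mc : measurable_fun (setT : set (g_sigma_algebraType hboxes))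
    (fun x : g_sigma_algebraType hboxes => (x : 'rV[R]_n) ord0 j :
      measurableTypeR R).
  exact: mc.
apply: (measurability _ (RGenOInfty.measurableE R)) => //.
move=> /= _ [_ [r ->] <-]; rewrite setTI.
have oS : open [set x : 'rV[R]_n | r < x ord0 j].
  apply: (open_comp (f := fun x : 'rV[R]_n => x ord0 j)) (@open_gt R r) => x _.
  exact: coord_continuous.
have [I [a [b [_ SE]]]] := open_hbox_cover oS.
have -> : (fun x : 'rV[R]_n => x ord0 j) @^-1` `]r, +oo[%classic =
    \bigcup_(i in I) hbox (a i) (b i).
  by rewrite -SE; apply/seteqP; split => x /=; rewrite in_itv/= andbT.
apply: (@bigcup_measurable _ (g_sigma_algebraType hboxes)) => i _.
by apply: sub_sigma_algebra; exists (a i), (b i).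
Qed.

Lemma hboxes_cover :
  \bigcup_k hbox (const_mx (- k%:R) : 'rV[R]_n) (const_mx k%:R) = setT.
Proof.
apply/seteqP; split => // x _.
exists (Num.truncn `|x|).+1 => // j; rewrite !mxE.
have H : `|x ord0 j| < (Num.truncn `|x|).+1%:R.
  by rewrite (le_lt_trans (rV_norm_coord _ _))// truncnS_gt.
by move: H; rewrite ltr_norml => /andP[/ltW -> ->].
Qed.

Lemma hbox_measure_unique (m1 m2 : {measure set 'rV[R]_n -> \bar R}) :
  (forall a b, m1 (hbox a b) = m2 (hbox a b)) ->
  (forall a b, (m1 (hbox a b) < +oo)%E) ->
  forall S, measurable S -> m1 S = m2 S.
Proof.
move=> m12 m1oo S mS.
have gG (k : nat) : hboxes (hbox (const_mx (- k%:R)) (const_mx k%:R)).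
  by exists (const_mx (- k%:R)), (const_mx k%:R).
by apply: (@measure_unique _ R (matrix R 1 n) hboxes _ measurable_rVE
  hboxes_setI gG hboxes_cover m1 m2) => // _ [a [b ->]].
Qed.

End hbox_sigma_algebra.

(** * The volume of images under a C1 bijection *)

Section change_of_variables.
Context {R : realType} (n : nat).
Notation mu := (lebesgue_rV n : {measure set 'rV[R]_n -> \bar R}).
Variables (A B : set 'rV[R]_n) (phi psi : 'rV[R]_n -> 'rV[R]_n).
Hypotheses (oA : open A) (oB : open B) (phiA : forall x, B x -> A (phi x)).
Hypothesis phi1 : C1_on B phi.
Hypothesis mpsi : measurable_fun setT psi.
Hypothesis psiK : forall y, A y -> B (psi y) /\ phi (psi y) = y.
Hypothesis phiK : forall x, B x -> psi (phi x) = x.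

Let mA : measurable A. Proof. exact: open_rV_measurable. Qed.
Let mB : measurable B. Proof. exact: open_rV_measurable. Qed.
Let J : 'rV[R]_n -> \bar R := fun x => (density B phi x)%:E.
Let mJ : measurable_fun setT J.
Proof. by apply/measurable_EFinP; exact: measurable_density. Qed.
Let J0 x : (0 <= J x)%E. Proof. by rewrite lee_fin density_ge0. Qed.

Let nuI : {measure set 'rV[R]_n -> \bar R} := density_measure mu mJ J0.
(** Volume of the image, turned into a measure through the measurable inverse: on measurable subsets
    of [B] its value is the volume of the image under [phi]. *)
Let nuP : {measure set 'rV[R]_n -> \bar R} :=
  measure_function_pushforward__canonical__measure_function_Measure
    (mrestr mu mA) mpsi.

Let nuIE S : nuI S = (\int[mu]_(x in S) J x)%E. Proof. by []. Qed.
Let nuPE S : nuP S = mu (psi @^-1` S `&` A). Proof. by []. Qed.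

Let nuP_image S : S `<=` B -> psi @^-1` S `&` A = phi @` S.
Proof.
move=> SB; apply/seteqP; split => [y [Sy Ay]|_ [x Sx <-]].
  by exists (psi y) => //; exact: (psiK Ay).2.
by split; rewrite /= ?phiK//; [exact: SB|exact/phiA/SB].
Qed.

(** Half of [q] pays for the distortion of the image, half for the oscillation of the Jacobian
    around its value at [a]. The additive form avoids subtracting extended reals. *)
Let local_comparison (w a : 'rV[R]_n) (q : R) : (forall j, 0 < w ord0 j) ->
  B a -> 0 < q ->
  exists2 d : R, 0 < d & forall c t, 0 < t < d -> cbox c (c + t *: w) a ->
    let Q := hbox c (c + t *: w) in
    (nuP Q <= nuI Q + q%:E * mu Q)%E /\ (nuI Q <= nuP Q + q%:E * mu Q)%E.
Proof.
move=> w0 Ba q0; have q20 : 0 < q / 2 by rewrite divr_gt0.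
pose D := absdet phi a; have D0 : 0 <= D by exact: normr_ge0.
have [d1 d10 Hup] : exists2 d : R, 0 < d & forall c t, 0 < t < d ->
    cbox c (c + t *: w) a ->
    exists2 K, measurable K /\ phi @` hbox c (c + t *: w) `<=` K &
    (mu K <= (D + q / 2)%:E * mu (hbox c (c + t *: w)))%E.
  have [uT|nuT] := boolP ('J phi a \in unitmx).
    exact: (C1_box_upper_unit oB phi1 Ba w0 uT q20).
  have -> : D = 0.
    by apply/normr0P; move: nuT; rewrite unitmxE unitfE negbK.
  by rewrite add0r; exact: (C1_box_upper_singular oB phi1 Ba w0 nuT q20).
have [d2 d20 Hlow] : exists2 d : R, 0 < d & forall c t, 0 < t < d ->
    cbox c (c + t *: w) a ->
    exists2 K, measurable K /\ K `<=` phi @` hbox c (c + t *: w) &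
    ((D - q / 2)%:E * mu (hbox c (c + t *: w)) <= mu K)%E.
  have [uT|nuT] := boolP ('J phi a \in unitmx).
    exact: (C1_box_lower_unit oB phi1 Ba w0 uT q20).
  have -> : D = 0.
    by apply/normr0P; move: nuT; rewrite unitmxE unitfE negbK.
  (* At a critical point the factor is [- (q / 2)], so the empty set serves as inner set. *)
  exists 1 => // c t _ _; exists set0; first by split; [exact: measurable0|].
  by rewrite measure0 mule_le0_ge0// ?measure_ge0// lee_fin sub0r oppr_le0 ltW.
have [d3 d30 HB] := open_rV_ball oB Ba.
have /cvgrPdist_lt/(_ _ q20) := absdet_continuous oB phi1 Ba.
move=> /nbhs_ballP[d4 d40 HJ].
have w1 : 0 < `|w| + 1 by rewrite ltr_wpDl.
pose d := Num.min (Num.min d1 d2) (Num.min d3 d4 / (`|w| + 1)).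
exists d; first by rewrite !lt_min d10 d20/= divr_gt0// lt_min d30.
move=> c t /andP[t0]; rewrite !lt_min => /andP[/andP[td1 td2] td] ca Q.
have Qa x : Q x -> B x /\ `|absdet phi x - D| < q / 2.
  move=> /hbox_cbox Qx; have : `|x - a| < Num.min d3 d4.
    apply: le_lt_trans (cbox_dist (ltW t0) Qx ca) _.
    move: td; rewrite ltr_pdivlMr//; apply: le_lt_trans.
    by rewrite ler_pM2l// lerDl.
  rewrite lt_min => /andP[xd3 xd4]; split; first exact: HB.
  by rewrite distrC; apply: HJ; rewrite -ball_normE /ball_ /= distrC.
have QB : Q `<=` B by move=> x /Qa[].
have mQ : measurable Q by exact: measurable_hbox.
have mphiQ : measurable (phi @` Q).
  rewrite -nuP_image//; apply: measurableI => //.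
  by rewrite -[X in measurable X]setTI; exact: mpsi.
have QE : mu Q = (t ^+ n * \prod_j w ord0 j)%:E by exact: lebesgue_hbox_scale.
set m := t ^+ n * _ in QE.
have m0 : 0 <= m by rewrite mulr_ge0 ?exprn_ge0// ?ltW// prodr_gt0.
have PE : nuP Q = mu (phi @` Q) by rewrite nuPE nuP_image.
have Pup : (nuP Q <= ((D + q / 2) * m)%:E)%E.
  have [|K [mK QK]] := Hup c t _ ca; first by rewrite t0.
  by rewrite -/Q QE -EFinM PE; apply: le_trans; apply: le_measure; rewrite ?inE.
have Plow : (((D - q / 2) * m)%:E <= nuP Q)%E.
  have [|K [mK KQ]] := Hlow c t _ ca; first by rewrite t0.
  rewrite -/Q QE -EFinM PE => /le_trans; apply.
  by apply: le_measure; rewrite ?inE.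
have cstQ (k : R) : (\int[mu]_(x in Q) (k%:E) = (k * m)%:E)%E.
  by rewrite integral_cst// QE -EFinM.
have JE x : Q x -> J x = (absdet phi x)%:E.
  by move=> Qx; rewrite /J /density patchE mem_set//; exact: QB.
have mJQ : measurable_fun Q J by exact: measurable_funTS.
have Iup : (nuI Q <= ((D + q / 2) * m)%:E)%E.
  rewrite -cstQ nuIE; apply: ge0_le_integral => // x Qx.
  rewrite JE// lee_fin; have [_] := Qa x Qx.
  by rewrite ltr_norml => /andP[_]; lra.
have Ilow : ((D * m)%:E <= nuI Q + (q / 2 * m)%:E)%E.
  rewrite -!cstQ nuIE -ge0_integralD//; last by move=> x _; rewrite lee_fin ltW.
  apply: ge0_le_integral => //.
  - by apply: emeasurable_funD.
  - move=> x Qx; rewrite JE// -EFinD lee_fin; have [_] := Qa x Qx.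
    by rewrite ltr_norml => /andP[]; lra.
rewrite QE -EFinM; split.
  apply: (le_trans Pup).
  rewrite (_ : (D + q / 2) * m = D * m + q / 2 * m); last by ring.
  rewrite EFinD; apply: (le_trans (leeD2r _ Ilow)).
  by rewrite -addeA -EFinD leeD2l// lee_fin; lra.
apply: (le_trans Iup).
rewrite (_ : (D + q / 2) * m = (D - q / 2) * m + q * m); last by field.
by rewrite EFinD leeD2r.
Qed.

Let inner_box (a b : 'rV[R]_n) :=
  (forall j, a ord0 j < b ord0 j) /\ cbox a b `<=` B.

(** The error term is itself a multiple of a measure, so each right-hand side is a measure and the
    bisection principle applies to it directly. *)
Let hbox_approx a b (q : R) : inner_box a b -> 0 < q ->
  (nuP (hbox a b) <= nuI (hbox a b) + q%:E * mu (hbox a b))%E /\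
  (nuI (hbox a b) <= nuP (hbox a b) + q%:E * mu (hbox a b))%E.
Proof.
move=> [ab abB] q0; pose w := b - a.
have w0 j : 0 < w ord0 j by rewrite !mxE subr_gt0.
have -> : b = a + 1 *: w by rewrite scale1r /w subrKC.
have wB : cbox a (a + 1 *: w) `<=` B by rewrite scale1r /w subrKC.
pose q' := NngNum (ltW q0).
have addE (nu : {measure set 'rV[R]_n -> \bar R}) S :
    (measure_add nu (mscale q' mu) : {measure set _ -> \bar R}) S =
    (nu S + q%:E * mu S)%E by exact: measure_addE.
split; rewrite -addE; apply: hbox_measure_le => // x /wB Bx;
  have [d d0 Hd] := local_comparison w0 Bx q0;
  exists d => // c t td cx; rewrite addE; first exact: (Hd c t td cx).1.
exact: (Hd c t td cx).2.
Qed.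

Let hbox_eq a b : inner_box a b -> nuP (hbox a b) = nuI (hbox a b).
Proof.
move=> iab; have [ab _] := iab.
have mE : mu (hbox a b) = (\prod_j (b ord0 j - a ord0 j))%:E.
  by apply: lebesgue_hbox => j; exact: ltW.
set m := \prod_j _ in mE.
have m0 : 0 < m by apply: prodr_gt0 => j _; rewrite subr_gt0.
apply/eqP; rewrite eq_le; apply/andP; split; apply/lee_addgt0Pr => e e0;
  have [] := hbox_approx iab (divr_gt0 e0 m0);
    rewrite mE -EFinM divfK// gt_eqF//.
Qed.

(** The Jacobian is bounded on the compact closed box. Finiteness on boxes is what the uniqueness of
    measures asks for. *)
Let hbox_fin a b : inner_box a b -> (nuI (hbox a b) < +oo)%E.
Proof.
move=> [ab abB].
have cM : {within cbox a b, continuous (absdet phi)}.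
  apply: continuous_in_subspaceT => x; rewrite inE => /abB Bx.
  exact: (absdet_continuous oB phi1 Bx).
have [M [Mreal HM]] := compact_bounded
  (continuous_compact cM (@cbox_compact R n a b)).
apply: (@le_lt_trans _ _ (\int[mu]_(x in hbox a b) (M + 1)%:E)%E).
  have mQ : measurable (hbox a b) by exact: measurable_hbox.
  rewrite nuIE; apply: ge0_le_integral => //.
  - exact: measurable_funTS.
  - move=> x Qx; rewrite lee_fin.
    have Bx : B x by apply/abB/hbox_cbox.
    rewrite /density patchE mem_set//.
    have M1 : M < M + 1 by rewrite ltrDl.
    apply: le_trans (ler_norm _) _; apply: (HM _ M1); exists x => //.
    exact: hbox_cbox.
rewrite integral_cst; last exact: measurable_hbox.
have -> : mu (hbox a b) = (\prod_j (b ord0 j - a ord0 j))%:E.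
  by apply: lebesgue_hbox => j; exact: ltW.
by rewrite -EFinM ltry.
Qed.

(** Both measures are restricted to one inner box; its intersection with any box is either empty or
    again an inner box, so they agree on the generating family. *)
Let inner_eq a b S : inner_box a b -> measurable S ->
  nuP (S `&` hbox a b) = nuI (S `&` hbox a b).
Proof.
move=> iab mS; have mQ : measurable (hbox a b) by exact: measurable_hbox.
apply: (hbox_measure_unique (m1 := mrestr nuP mQ) (m2 := mrestr nuI mQ)) => //.
- move=> a' b'.
  change (nuP (hbox a' b' `&` hbox a b) = nuI (hbox a' b' `&` hbox a b)).
  rewrite hboxI; set c := \row_j Num.max _ _; set d := \row_j Num.min _ _.
  have [cd|] := pselect (forall j, c ord0 j < d ord0 j); last first.
    move=> /existsNP[j /negP]; rewrite -leNgt => dc.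
    have -> : hbox c d = set0.
      apply/seteqP; split => // x /(_ j)/andP[cx xd].
      by have := le_lt_trans cx xd; rewrite ltNge dc.
    by rewrite !measure0.
  apply: hbox_eq; split => //; apply: subset_trans iab.2 => x cx j.
  by have := cx j; rewrite !mxE ge_max le_min => /andP[/andP[_ ->] /andP[_ ->]].
- move=> a' b'; change (nuP (hbox a' b' `&` hbox a b) < +oo)%E.
  apply: (@le_lt_trans _ _ (nuP (hbox a b)));
    last by rewrite hbox_eq// hbox_fin.
  by apply: le_measure; rewrite ?inE//; apply: measurableI => //;
    exact: measurable_hbox.
Qed.

Lemma C1_image_measure S : measurable S ->
  mu (psi @^-1` S `&` A) = (\int[mu]_(x in S) (density B phi x)%:E)%E.
Proof.
move=> mS; rewrite -nuPE -nuIE.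
have [I [a [b [Hab BE]]]] := open_hbox_cover oB.
(* Indices outside [I] get the empty set, so that the cover is indexed by all of [nat] and [seqDU]
   can make it disjoint. *)
pose F i := if i \in I then hbox (a i) (b i) else set0.
have BF : B = \bigcup_i F i.
  rewrite BE; apply/seteqP; split => [x [i Ii xi]|x [i _]].
    by exists i => //; rewrite /F mem_set.
  by rewrite /F; case: ifPn => // /set_mem Ii xi; exists i.
have mF i : measurable (F i).
  by rewrite /F; case: ifP => _; [exact: measurable_hbox|exact: measurable0].
pose D := seqDU F.
have mD i : measurable (D i) by apply: measurableD => //;
  exact: bigsetU_measurable.
have SB : S `&` B = \bigcup_i (S `&` D i).
  by rewrite -setI_bigcupr -seqDU_bigcup_eq BF.
have split_nu (nu : {measure set 'rV[R]_n -> \bar R}) :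
    nu (S `&` B) = (\sum_(i <oo) nu (S `&` D i))%E.
  rewrite SB measure_bigcup//; first by apply: eq_eseriesl => i;
    rewrite in_setT.
  - by move=> i _; exact: measurableI.
  - by apply: trivIset_setIl; exact: trivIset_seqDU.
transitivity (nuP (S `&` B)).
  rewrite !nuPE; congr (mu _); apply/seteqP; split => y [Sy Ay] //=.
    by split => //; split => //; exact: (psiK Ay).1.
  by case: Sy.
transitivity (nuI (S `&` B)); last first.
  rewrite !nuIE integral_mkcond [RHS]integral_mkcond.
  apply: eq_integral => x _; rewrite !patchE in_setI.
  case: (x \in S) => //=; rewrite /J /density patchE.
  by case: ifP => // ->.
rewrite (split_nu nuP) (split_nu nuI); apply: eq_eseriesr => i _.
have -> : S `&` D i = S `&` D i `&` F i.
  by rewrite -setIA; congr (_ `&` _); apply/esym/setIidPl; exact: subDsetl.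
rewrite /F; case: ifPn => [/set_mem Ii|_]; last by rewrite setI0 !measure0.
by apply: inner_eq; [exact: (Hab i Ii)|exact: measurableI].
Qed.

End change_of_variables.

(** On indicators the claim is the volume formula for images. The weights are the indicator of [A]
    on one side and the extended Jacobian on the other. *)
Theorem C1_change_of_variables (R : realType) (n : nat) (A B : set 'rV[R]_n)
    (phi : 'rV[R]_n -> 'rV[R]_n) (h : 'rV[R]_n -> \bar R) :
  open A -> open B -> set_bij B A phi -> C1_on B phi ->
  measurable_fun setT h -> (forall y, 0 <= h y)%E ->
  (\int[lebesgue_rV n]_(y in A) h y =
   \int[lebesgue_rV n]_(x in B) (h (phi x) * `|\det ('J phi x)|%:E))%E.
Proof.
move=> oA oB bij phi1 mh h0.
have [psi [mpsi psiK phiK]] := measurable_inverse oA oB bij phi1.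
have phiA x : B x -> A (phi x) by case: bij => + _ _; apply.
have mA := open_rV_measurable oA; have mB := open_rV_measurable oB.
transitivity (\int[lebesgue_rV n]_y ((\1_A y : R)%:E * h (id y)))%E.
  rewrite integral_mkcond; apply: eq_integral => y _; rewrite patchE indicE.
  by case: (y \in A); rewrite ?mul1e ?mul0e.
transitivity (\int[lebesgue_rV n]_x
  ((density B phi x)%:E * h (ext_map B phi x)))%E.
  apply: ge0_eq_integral_preimage => //.
  - exact: measurable_density.
  - by move=> x; exact: density_ge0.
  - exact: measurable_ext_map.
  move=> Y mY.
  have mY' : measurable (ext_map B phi @^-1` Y).
    by rewrite -[X in measurable X]setTI; exact: measurable_ext_map.
  transitivity (lebesgue_rV n (A `&` Y)).
    rewrite -[A `&` Y]setIT -integral_indic//; last exact: measurableI.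
    by apply: eq_integral => y _; rewrite indicI/= EFinM.
  transitivity (\int[lebesgue_rV n]_(x in ext_map B phi @^-1` Y)
    (density B phi x)%:E)%E.
    rewrite -(C1_image_measure oA oB phiA phi1 mpsi psiK phiK)//.
    congr (lebesgue_rV n _); apply/seteqP; split => [y [Ay Yy]|y [/= + Ay]].
      by split => //=; rewrite /ext_map patchE mem_set ?(psiK _ Ay).2//;
        exact: (psiK _ Ay).1.
    by rewrite /ext_map patchE mem_set ?(psiK _ Ay).2//; exact: (psiK _ Ay).1.
  rewrite [LHS]integral_mkcond; apply: eq_integral => x _;
    rewrite patchE indicE.
  rewrite -[x \in _]/(ext_map B phi x \in Y).
  by case: (_ \in Y); rewrite ?mule1 ?mule0.
rewrite [RHS]integral_mkcond; apply: eq_integral => x _.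
rewrite /density /ext_map !patchE; case: ifP => _; last by rewrite mul0e.
by rewrite muleC.
Qed.

(** * Orthogonal projections *)

Section orthogonal_fubini.
Context {R : realType}.

Lemma measurable_row_mx d m :
  measurable_fun setT (fun p : 'rV[R]_d * 'rV[R]_m => row_mx p.1 p.2).
Proof.
apply/measurable_fun_rVP => j; case: (splitP j) => k jk.
  have -> : j = lshift m k by exact/val_inj.
  under eq_fun do rewrite row_mxEl.
  exact: (measurableT_comp (measurable_coord k) measurable_fst).
have -> : j = rshift d k by exact/val_inj.
under eq_fun do rewrite row_mxEr.
exact: (measurableT_comp (measurable_coord k) measurable_snd).
Qed.

Lemma integral_row_mx d m (h : 'rV[R]_(d + m) -> \bar R) :
  measurable_fun setT h -> (forall x, 0 <= h x)%E ->
  (\int[lebesgue_rV (d + m)]_z h z =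
   \int[lebesgue_rV d]_x \int[lebesgue_rV m]_y h (row_mx x y))%E.
Proof.
elim: d h => [|d IH] h mh h0.
  rewrite integral_rV0; last first.
    apply: (@measurable_fun_fubini_tonelli_F _ _ _ _ _ (lebesgue_rV m)
      (fun z : 'rV[R]_0 * 'rV[R]_m => h (row_mx z.1 z.2))) => //.
    by apply: measurableT_comp => //; exact: measurable_row_mx.
  apply: eq_integral => y _; congr h; apply/rowP => j.
  rewrite [in RHS](_ : j = rshift 0 j) ?row_mxEr//; exact/val_inj.
rewrite (integral_rV_cons (h := h))// (integral_rV_cons (h := fun x =>
  \int[lebesgue_rV m]_y h (row_mx x y))%E); last 2 first.
- apply: (@measurable_fun_fubini_tonelli_F _ _ _ _ _ (lebesgue_rV m)
    (fun z : 'rV[R]_d.+1 * 'rV[R]_m => h (row_mx z.1 z.2))) => //.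
  by apply: measurableT_comp => //; exact: measurable_row_mx.
- by move=> x; exact: integral_ge0.
apply: eq_integral => a _.
have mha : measurable_fun setT (fun z : 'rV[R]_(d + m) => h (rV_cons (a, z))).
  by apply: measurableT_comp => //; exact: measurable_rV_cons_snd.
rewrite (IH _ mha (fun z => h0 _)).
apply: eq_integral => x _; apply: eq_integral => y _; congr h.
exact: (etrans (@row_mxA R 1 1 d m _ _ _) (castmx_id _ _)).
Qed.

Context (d m : nat) (E : 'M[R]_(d, d + m)) (F : 'M[R]_(m, d + m)).
Hypotheses (EE : E *m E^T = 1%:M) (FF : F *m F^T = 1%:M) (EF : E *m F^T = 0).

Let O : 'M[R]_(d + m) := col_mx E F.

Let OO : O *m O^T = 1%:M.
Proof.
rewrite tr_col_mx mul_col_row EE FF EF -[F *m E^T]trmxK trmx_mul trmxK EF trmx0.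
by rewrite -scalar_mx_block.
Qed.

Let detO : `|\det O| = 1.
Proof.
have : \det O * \det O = 1 by rewrite -[X in _ * X]det_tr -det_mulmx OO det1.
by move/(congr1 Num.norm); rewrite normrM normr1 -expr2 => /eqP;
  rewrite sqrp_eq1// => /eqP.
Qed.

Definition orth_map (p : 'rV[R]_d * 'rV[R]_m) : 'rV[R]_(d + m) :=
  p.1 *m E + p.2 *m F.

Lemma measurable_orth_map : measurable_fun setT orth_map.
Proof.
have -> : orth_map = (fun x => x *m O + 0) \o (fun p => row_mx p.1 p.2).
  by apply/funext => p; rewrite /orth_map /= addr0 /O mul_row_col.
by apply: measurableT_comp; [exact: measurable_rV_affine|exact:
  measurable_row_mx].
Qed.

Notation prod := (lebesgue_rV d \x lebesgue_rV m)%E.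

(** The rows of [E] and [F] together form an orthogonal matrix, whose determinant has absolute value
    one. *)
Lemma ge0_integral_orth_map (h : 'rV[R]_(d + m) -> \bar R) :
  measurable_fun setT h -> (forall x, 0 <= h x)%E ->
  (\int[lebesgue_rV (d + m)]_z h z = \int[prod]_p h (orth_map p))%E.
Proof.
move=> mh h0; have uO : O \in unitmx by case/mulmx1_unit : OO.
have mhO : measurable_fun setT (fun x : 'rV[R]_(d + m) => h (x *m O + 0)).
  by apply: measurableT_comp => //; exact: measurable_rV_affine.
have mhp : measurable_fun setT (fun p => h (orth_map p)).
  exact: (measurableT_comp mh measurable_orth_map).
rewrite -(unitmx_affine_scaling uO 0 mh h0) detO mul1e.
rewrite (integral_row_mx mhO (fun x => h0 _)).
rewrite (fubini_tonelli1 (fun p => h (orth_map p)) mhp (fun p => h0 _)).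
apply: eq_integral => x _; apply: eq_integral => y _.
by rewrite /orth_map /= /O mul_row_col addr0.
Qed.

Lemma integrable_orth_map (f : 'rV[R]_(d + m) -> R) :
  (lebesgue_rV (d + m)).-integrable setT (EFin \o f) ->
  prod.-integrable setT (EFin \o (f \o orth_map)).
Proof.
move=> /integrableP[/measurable_EFinP mf fint]; apply/integrableP; split.
  apply/measurable_EFinP/measurableT_comp => //; exact: measurable_orth_map.
rewrite -(ge0_integral_orth_map (h := fun z => `|(f z)%:E|%E))//.
exact/measurableT_comp/measurable_EFinP.
Qed.

Lemma integral_orth_map (f : 'rV[R]_(d + m) -> R) : measurable_fun setT f ->
  (\int[lebesgue_rV (d + m)]_z (f z)%:E = \int[prod]_p (f (orth_map p))%:E)%E.
Proof.
move=> mf; have mEf : measurable_fun setT (EFin \o f) by exact/measurable_EFinP.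
rewrite integralE [RHS]integralE; congr (_ - _)%E.
  rewrite ge0_integral_orth_map//; last exact: measurable_funepos.
  by apply: eq_integral => p _; rewrite !funeposE.
rewrite ge0_integral_orth_map//; last exact: measurable_funeneg.
by apply: eq_integral => p _; rewrite !funenegE.
Qed.

Lemma orth_map_proj x y : orth_map (x, y) *m E^T = x.
Proof.
rewrite /orth_map /= mulmxDl -!mulmxA EE mulmx1.
by rewrite -[F *m E^T]trmxK trmx_mul trmxK EF trmx0 mulmx0 addr0.
Qed.

Lemma measurable_subspace_proj (f : 'rV[R]_(d + m) -> R) :
  (lebesgue_rV (d + m)).-integrable setT (EFin \o f) ->
  measurable_fun setT (subspace_proj E F f).
Proof.
move=> fint; apply: measurableT_comp => //.
have := measurable_fubini_F (integrable_orth_map fint).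
exact.
Qed.

Lemma integrable_mul_proj (k : 'rV[R]_d -> R) (M : R) (f : 'rV[R]_(d + m) -> R)
  :
  measurable_fun setT k -> (forall x, `|k x| <= M) ->
  (lebesgue_rV (d + m)).-integrable setT (EFin \o f) ->
  (lebesgue_rV (d + m)).-integrable setT (fun z => (k (z *m E^T) * f z)%:E).
Proof.
move=> mk kM fint.
have -> : (fun z => (k (z *m E^T) * f z)%:E) =
    ((EFin \o (fun z => k (z *m E^T))) \* (EFin \o f))%E.
  by apply/funext => z; rewrite /= EFinM.
apply: integrableMr => //.
  apply: measurableT_comp => //.
  have := measurable_rV_affine E^T 0; by under eq_fun do rewrite addr0.
by exists M; split; [exact: num_real|move=> y My z _;
  apply: le_trans (kM _) (ltW My)].
Qed.

(** Slices of an integrable function are integrable only almost everywhere, and on the other slices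
    the value of [subspace_proj] carries no information; the identity therefore passes through an
    almost-everywhere equality. The kernel leaves the inner integral because projecting
    [orth_map (y, _)] returns [y]. *)
Lemma integral_mul_proj (k : 'rV[R]_d -> R) (M : R) (f : 'rV[R]_(d + m) -> R) :
  measurable_fun setT k -> (forall x, `|k x| <= M) ->
  (lebesgue_rV (d + m)).-integrable setT (EFin \o f) ->
  (lebesgue_rV d).-integrable setT (fun y => (k y * subspace_proj E F f y)%:E)
    /\
  (\int[lebesgue_rV d]_y (k y * subspace_proj E F f y)%:E =
   \int[lebesgue_rV (d + m)]_z (k (z *m E^T) * f z)%:E)%E.
Proof.
move=> mk kM fint.
have kfint := integrable_mul_proj mk kM fint.
have mkf : measurable_fun setT (fun z : 'rV[R]_(d + m) => k (z *m E^T) * f z).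
  by apply/measurable_EFinP; exact: measurable_int kfint.
have pint := integrable_orth_map fint.
have pkint := integrable_orth_map kfint.
pose g := fubini_F (lebesgue_rV m) (EFin \o
  ((fun z : 'rV[R]_(d + m) => k (z *m E^T) * f z) \o orth_map)).
have gint : (lebesgue_rV d).-integrable setT g by exact: integrable_fubini_F.
have mkP : measurable_fun setT (fun y => (k y * subspace_proj E F f y)%:E).
  apply/measurable_EFinP; apply: measurable_funM => //.
  exact: measurable_subspace_proj.
have ae_g : ae_eq (lebesgue_rV d) setT g
  (fun y => (k y * subspace_proj E F f y)%:E).
  have := ae_integrable1 pint; apply: filterS => y Hy _.
  rewrite /g /fubini_F /=.
  under eq_integral do rewrite -/(orth_map (y, _)) orth_map_proj EFinM.
  rewrite integralZl//; rewrite EFinM; congr (_ * _)%E.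
  rewrite /subspace_proj /Rintegral fineK//.
  exact: integrable_fin_num Hy.
split.
  apply/integrableP; split => //; have /integrableP[mg glty] := gint.
  apply: le_lt_trans glty; rewrite le_eqVlt; apply/orP; left; apply/eqP.
  apply: ae_eq_integral => //; try exact: measurableT_comp.
  by apply: ae_eq_abse; exact: ae_eq_sym.
rewrite integral_orth_map// -(integral12_prod_meas1 pkint).
by apply: ae_eq_integral => //; [exact: measurable_int gint|exact: ae_eq_sym].
Qed.

End orthogonal_fubini.

(** * Young's convolution inequality *)

Section power_mean.
Context {R : realType}.
Implicit Types (s t q r c v : R).

(* With [s = exp u], combine the tangent bounds of [exp] at [(1 - t) u] and
   [- t u] with weights [t] and [1 - t]. *)
Lemma powR_le_mean s t : 0 <= s -> 0 <= t <= 1 -> s `^ t <= t * s + (1 - t).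
Proof.
move=> s0 /andP[t0 t1]; have [->|sn0] := eqVneq s 0.
  rewrite mulr0 add0r; have [->|tn0] := eqVneq t 0.
    by rewrite powRr0 subr0.
  by rewrite powR0// subr_ge0.
have sp : 0 < s by rewrite lt_def sn0.
rewrite /powR (negbTE sn0); set u := ln s.
have -> : s = expR u by rewrite /u lnK.
have H1 : expR (t * u) * (1 + (1 - t) * u) <= expR u.
  rewrite [leRHS](_ : _ = expR (t * u) * expR ((1 - t) * u)); last first.
    by rewrite -expRD; congr expR; ring.
  by rewrite ler_pM2l ?expR_gt0// expR_ge1Dx.
have H2 : expR (t * u) * (1 - t * u) <= 1.
  rewrite [leRHS](_ : _ = expR (t * u) * expR (- (t * u))); last first.
    by rewrite -expRD subrr expR0.
  by rewrite ler_pM2l ?expR_gt0// expR_ge1Dx.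
have := lerD (ler_wpM2l t0 H1) (ler_wpM2l (_ : 0 <= 1 - t) H2).
rewrite subr_ge0 => /(_ t1) H.
apply: le_trans (le_trans H _); last by rewrite mulr1.
by rewrite le_eqVlt; apply/orP; left; apply/eqP; ring.
Qed.

(* The right-hand side is the tangent-line bound of [v |-> v `^ r] at [v = c]. *)
Lemma young_powR v c r : 0 <= v -> 0 < c -> 1 <= r ->
  v <= r^-1 * c `^ (1 - r) * v `^ r + (1 - r^-1) * c.
Proof.
move=> v0 c0 r1; have r0 : 0 < r by exact: lt_le_trans r1.
have vc : 0 <= v / c by rewrite divr_ge0// ltW.
have := @powR_le_mean ((v / c) `^ r) r^-1 (powR_ge0 _ _).
rewrite invr_ge0 ltW//= invf_le1// r1 => /(_ isT).
rewrite -powRrM mulfV ?gt_eqF// powRr1// ler_pdivrMr// => /le_trans; apply.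
rewrite mulrDl lerD2r powRM ?invr_ge0 ?(ltW c0)//.
rewrite le_eqVlt; apply/orP; left; apply/eqP.
have -> : c `^ (1 - r) = c * (c `^ r)^-1.
  rewrite (@powRD _ c 1 (- r)); last by rewrite lt0r_neq0 ?implybT.
  by rewrite powRN powRr1// ltW.
have -> : c^-1 `^ r = (c `^ r)^-1.
  by rewrite -powR_inv1 ?ltW// -powRrM mulN1r powRN.
ring.
Qed.

End power_mean.

Section jensen_young.
Context d (T : measurableType d) (R : realType)
  (mu : {measure set T -> \bar R}).
Local Open Scope ereal_scope.

(** Integrate the tangent-line bound [young_powR] at a level [c]: as [k] has mass one, the result is
    at most [c] once the [r]-th power of [c] dominates the right-hand side. Then let [c] decrease to
    its [r]-th root. *)
Lemma jensen_poweR (k : T -> R) (V : T -> \bar R) (r : R) : (1 <= r)%R ->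
  measurable_fun setT k -> (forall x, (0 <= k x)%R) -> \int[mu]_x (k x)%:E =
    1 ->
  measurable_fun setT V -> (forall x, 0 <= V x) ->
  (\int[mu]_x ((k x)%:E * V x)) `^ r <= \int[mu]_x ((k x)%:E * V x `^ r).
Proof.
move=> r1 mk k0 k1 mV V0; have r0 : (0 < r)%R by exact: lt_le_trans r1.
have mEk : measurable_fun setT (EFin \o k) by exact/measurable_EFinP.
have kV0 x : 0 <= (k x)%:E * V x by rewrite mule_ge0// lee_fin.
have kVr0 x : 0 <= (k x)%:E * V x `^ r.
  by rewrite mule_ge0 ?poweR_ge0// lee_fin.
have mVr : measurable_fun setT (fun x => V x `^ r).
  exact: (measurableT_comp (measurable_poweR r)).
set W := \int[mu]_x ((k x)%:E * V x `^ r).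
have W0 : 0 <= W by exact: integral_ge0.
have [Woo|] := eqVneq W +oo; first by rewrite Woo leey.
rewrite -ltey => Wfin.
have [W' W'0 EW] : exists2 w : R, (0 <= w)%R & W = w%:E.
  exists (fine W); first exact: fine_ge0.
  by rewrite fineK// ge0_fin_numE.
have key (c : R) : (0 < c)%R -> (W' <= c `^ r)%R ->
  \int[mu]_x ((k x)%:E * V x) <= c%:E.
  move=> c0 Wc.
  pose a := (r^-1 * c `^ (1 - r))%R; pose b := ((1 - r^-1) * c)%R.
  have a0 : (0 < a)%R by rewrite mulr_gt0 ?invr_gt0 ?powR_gt0.
  have b0 : (0 <= b)%R by rewrite mulr_ge0 ?subr_ge0 ?invf_le1// ltW.
  apply: (@le_trans _ _ (\int[mu]_x (a%:E * ((k x)%:E * V x `^ r) + b%:E *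
    (k x)%:E))).
    apply: ge0_le_integral => //.
    - exact: emeasurable_funM.
    - apply: emeasurable_funD; apply: emeasurable_funM => //.
      exact: emeasurable_funM.
    move=> x _; have := V0 x; case: (V x) => [v| |]//=; last first.
      (* Infinite [V x]: a zero weight makes both sides vanish, a positive one makes the right-hand
         side infinite. *)
      move=> _; rewrite gt_eqF//.
      have [->|kn0] := eqVneq (k x) 0%R; first by rewrite !mul0e !mule0 add0e.
      have kp : (0 < k x)%R by rewrite lt_def kn0 k0.
      by rewrite gt0_muley ?lte_fin// gt0_muley ?lte_fin// addye// leey.
    rewrite lee_fin => v0; rewrite -!EFinM -EFinD lee_fin.
    have := ler_wpM2l (k0 x) (young_powR v0 c0 r1).
    by rewrite -/a -/b => /le_trans; apply; rewrite le_eqVlt; apply/orP; left;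
      apply/eqP; ring.
  rewrite ge0_integralD//; last 4 first.
  - by move=> x _; rewrite mule_ge0// lee_fin ltW.
  - by apply: emeasurable_funM => //; exact: emeasurable_funM.
  - by move=> x _; rewrite -EFinM lee_fin mulr_ge0.
  - exact: emeasurable_funM.
  rewrite ge0_integralZl_EFin//; last 2 first.
  - exact: emeasurable_funM.
  - exact: ltW.
  rewrite -/W EW ge0_integralZl_EFin//; last by move=> x _; rewrite lee_fin.
  rewrite k1 mule1 -EFinM -EFinD lee_fin /a /b.
  have cc : (c `^ (1 - r) * c `^ r = c)%R.
    rewrite -powRD; last by rewrite lt0r_neq0 ?implybT.
    by rewrite subrK powRr1 ?ltW.
  apply: (@le_trans _ _ (r^-1 * c `^ (1 - r) * c `^ r + (1 - r^-1) * c)%R).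
    by rewrite lerD2r ler_wpM2l// ltW.
  by rewrite -mulrA cc; lra.
have H : \int[mu]_x ((k x)%:E * V x) <= (W' `^ r^-1)%:E.
  (* The margin [e] keeps the level positive even when [W'] is zero. *)
  apply/lee_addgt0Pr => e e0; rewrite -EFinD; apply: key.
    by rewrite ltr_wpDl ?powR_ge0.
  rewrite [leLHS](_ : _ = ((W' `^ r^-1) `^ r)%R);
    last by rewrite -powRrM mulVf ?gt_eqF// powRr1.
  apply: ge0_ler_powR; first exact: ltW.
  - by rewrite nnegrE powR_ge0.
  - by rewrite nnegrE addr_ge0 ?powR_ge0// ltW.
  - by rewrite /= lerDl ltW.
have I0 : 0 <= \int[mu]_x ((k x)%:E * V x) by exact: integral_ge0.
apply: (@le_trans _ _ ((W' `^ r^-1)%:E `^ r)).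
  apply: gt0_ler_poweR => //; first exact: ltW.
  - by rewrite in_itv/= I0 leey.
  - by rewrite in_itv/= lee_fin powR_ge0 leey.
by rewrite poweR_EFin -powRrM mulVf ?gt_eqF// powRr1// EW.
Qed.

End jensen_young.

Section convolution_young.
Context {R : realType} (d : nat).
Notation leb := (lebesgue_rV d : {sigma_finite_measure set 'rV[R]_d -> \bar R}).

Lemma le_poweR (r : R) (x y : \bar R) : 0 < r -> (0 <= x)%E -> (x <= y)%E ->
  (x `^ r <= y `^ r)%E.
Proof.
move=> r0 x0 xy; apply: gt0_ler_poweR => //; first exact: ltW.
  by rewrite in_itv/= x0 leey.
by rewrite in_itv/= (le_trans x0 xy) leey.
Qed.

Lemma LnormE (r : R) (f : 'rV[R]_d -> \bar R) : r != 0 ->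
  ('N[lebesgue_rV d]_(r%:E)[f] = (\int[lebesgue_rV d]_x (`|f x| `^ r)) `^
    r^-1)%E.
Proof. by move=> r0; rewrite unlock. Qed.

Lemma le_Lnorm (r : R) (f g : 'rV[R]_d -> \bar R) : 0 < r ->
  measurable_fun setT f -> measurable_fun setT g ->
  (forall x, (`|f x| <= `|g x|)%E) ->
  ('N[lebesgue_rV d]_(r%:E)[f] <= 'N[lebesgue_rV d]_(r%:E)[g])%E.
Proof.
move=> r0 mf mg fg; rewrite !LnormE ?gt_eqF//.
have I0 (h : 'rV[R]_d -> \bar R) : (0 <= \int[lebesgue_rV d]_x (`|h x| `^ r))%E.
  by apply: integral_ge0 => x _; exact: poweR_ge0.
apply: le_poweR; rewrite ?invr_gt0//.
apply: ge0_le_integral => //.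
- by move=> x _; exact: poweR_ge0.
- by apply: (measurableT_comp (measurable_poweR r)); exact: measurableT_comp.
- by apply: (measurableT_comp (measurable_poweR r)); exact: measurableT_comp.
- by move=> x _; apply: le_poweR.
Qed.

Lemma measurable_rV_sub :
  measurable_fun setT (fun p : 'rV[R]_d * 'rV[R]_d => p.1 - p.2).
Proof.
apply/measurable_fun_rVP => j; under eq_fun do rewrite !mxE.
apply: measurable_funB.
- exact: (measurableT_comp (measurable_coord j) measurable_fst).
- exact: (measurableT_comp (measurable_coord j) measurable_snd).
Qed.

Lemma measurable_rV_subl (x : 'rV[R]_d) :
  measurable_fun setT (fun y : 'rV[R]_d => x - y).
Proof. exact: (measurableT_comp measurable_rV_sub (pair1_measurable x)). Qed.

Lemma integral_rV_shift (h : 'rV[R]_d -> \bar R) (y : 'rV[R]_d) :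
  measurable_fun setT h -> (forall x, 0 <= h x)%E ->
  (\int[lebesgue_rV d]_x h (x - y)%R = \int[lebesgue_rV d]_x h x)%E.
Proof.
move=> mh h0.
rewrite -(unitmx_affine_scaling (unitmx1 _ _) (- y) mh h0) det1 normr1 mul1e.
by apply: eq_integral => x _; rewrite mulmx1.
Qed.

Lemma integral_rV_reflect (h : 'rV[R]_d -> \bar R) (x : 'rV[R]_d) :
  measurable_fun setT h -> (forall x, 0 <= h x)%E ->
  (\int[lebesgue_rV d]_y h (x - y)%R = \int[lebesgue_rV d]_y h y)%E.
Proof.
move=> mh h0.
have uN : (-1)%:M \in @unitmx R d by rewrite unitmxE det_scalar unitrX//
  unitrN1.
rewrite -(unitmx_affine_scaling uN x mh h0) det_scalar normrX normrN1 expr1n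
  mul1e.
by apply: eq_integral => y _; rewrite mul_mx_scalar scaleN1r addrC.
Qed.

Variables (H : 'rV[R]_d -> R).
Hypotheses (mH : measurable_fun setT H) (H0 : forall x, 0 <= H x).

Lemma measurable_conv (V : 'rV[R]_d -> \bar R) :
  measurable_fun setT V -> (forall x, 0 <= V x)%E ->
  measurable_fun setT (fun x : 'rV[R]_d =>
    \int[lebesgue_rV d]_y ((H (x - y))%:E * V y))%E.
Proof.
move=> mV V0.
apply: (@measurable_fun_fubini_tonelli_F _ _ _ _ _ (lebesgue_rV d)
   (fun p : 'rV[R]_d * 'rV[R]_d => (H (p.1 - p.2))%:E * V p.2)%E).
  apply: emeasurable_funM.
    by apply/measurable_EFinP; apply: measurableT_comp => //;
      exact: measurable_rV_sub.
  exact: (measurableT_comp mV measurable_snd).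
by move=> p; rewrite mule_ge0// lee_fin.
Qed.

(** The integrand is signed, so measurability in [x] is obtained from its positive and negative
    parts. *)
Lemma measurable_convolution (u : 'rV[R]_d -> R) : measurable_fun setT u ->
  measurable_fun setT (convolution H u).
Proof.
move=> mu; pose k (p : 'rV[R]_d * 'rV[R]_d) := (H (p.1 - p.2) * u p.2)%:E.
have mk : measurable_fun setT k.
  apply/measurable_EFinP; apply: measurable_funM.
    by apply: measurableT_comp => //; exact: measurable_rV_sub.
  exact: (measurableT_comp mu measurable_snd).
apply: (measurableT_comp (f := fine)) => //.
under eq_fun do rewrite integralE.
apply: emeasurable_funB.
- have := @measurable_fun_fubini_tonelli_F _ _ _ _ _ (lebesgue_rV d) (k^\+)%E
    (measurable_funepos mk) (funepos_ge0 _).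
  apply: eq_measurable_fun => x _; apply: eq_integral => y _.
  by rewrite !funeposE.
- have := @measurable_fun_fubini_tonelli_F _ _ _ _ _ (lebesgue_rV d) (k^\-)%E
    (measurable_funeneg mk) (funeneg_ge0 _).
  apply: eq_measurable_fun => x _; apply: eq_integral => y _.
  by rewrite !funenegE.
Qed.

Hypothesis H1 : (\int[lebesgue_rV d]_x (H x)%:E = 1)%E.

(** For fixed [x], [H (x - y)] is a probability density in [y], so Jensen moves the power inside;
    Tonelli and translation invariance then integrate the kernel out. *)
Lemma young_convolution (r : R) (V : 'rV[R]_d -> \bar R) : 1 <= r ->
  measurable_fun setT V -> (forall x, 0 <= V x)%E ->
  ('N[lebesgue_rV d]_(r%:E)[(fun x : 'rV[R]_d =>
    \int[lebesgue_rV d]_y ((H (x - y))%:E * V y))]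
   <= 'N[lebesgue_rV d]_(r%:E)[V])%E.
Proof.
move=> r1 mV V0; have r0 : 0 < r by exact: lt_le_trans r1.
have mEH : measurable_fun setT (fun x => (H x)%:E) by exact/measurable_EFinP.
have HV0 x : (0 <= \int[lebesgue_rV d]_y ((H (x - y))%:E * V y))%E.
  by apply: integral_ge0 => y _; rewrite mule_ge0// lee_fin.
have Vr0 y : (0 <= V y `^ r)%E by exact: poweR_ge0.
have mVr : measurable_fun setT (fun y => V y `^ r)%E.
  exact: (measurableT_comp (measurable_poweR r)).
rewrite !LnormE ?gt_eqF//.
have I0 (h : 'rV[R]_d -> \bar R) : (0 <= \int[lebesgue_rV d]_x (`|h x| `^ r))%E.
  by apply: integral_ge0 => x _; exact: poweR_ge0.
apply: le_poweR; rewrite ?invr_gt0//.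
apply: (@le_trans _ _ (\int[lebesgue_rV d]_x
    \int[lebesgue_rV d]_y ((H (x - y))%:E * V y `^ r))%E).
  apply: ge0_le_integral => //.
  - by move=> x _; exact: poweR_ge0.
  - apply: (measurableT_comp (measurable_poweR r));
    apply: measurableT_comp => //.
    exact: measurable_conv.
  - exact: measurable_conv.
  move=> x _; rewrite gee0_abs//.
  apply: jensen_poweR => //.
    apply: measurableT_comp => //; exact: measurable_rV_subl.
  by rewrite (integral_rV_reflect (h := fun x => (H x)%:E)).
rewrite (fubini_tonelli (fun p : 'rV[R]_d * 'rV[R]_d =>
   (H (p.1 - p.2))%:E * V p.2 `^ r))%E//=; last 2 first.
- apply: emeasurable_funM.
    by apply/measurable_EFinP; apply: measurableT_comp => //;
      exact: measurable_rV_sub.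
  exact: (measurableT_comp mVr measurable_snd).
- by move=> p; rewrite mule_ge0// lee_fin.
rewrite le_eqVlt; apply/orP; left; apply/eqP.
apply: eq_integral => y _; rewrite gee0_abs//.
rewrite ge0_integralZr//; last 2 first.
- apply/measurable_EFinP; apply: measurableT_comp => //.
  have := measurable_rV_affine (1%:M : 'M[R]_d) (- y).
  by under eq_fun do rewrite mulmx1.
- by move=> x _; rewrite lee_fin.
by rewrite (integral_rV_shift (h := fun x => (H x)%:E))// H1 mul1e.
Qed.

End convolution_young.

(** * Gaussian kernels *)

Section gaussian.
Context {R : realType}.
Implicit Types tau : R.

Lemma enorm_sqr n (x : 'rV[R]_n) : enorm x ^+ 2 = \sum_(i < n) x ord0 i ^+ 2.
Proof. by rewrite sqr_sqrtr// sumr_ge0// => i _; exact: sqr_ge0. Qed.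

Lemma enorm_ge0 n (x : 'rV[R]_n) : 0 <= enorm x.
Proof. exact: sqrtr_ge0. Qed.

Lemma measurable_gauss_kernel n tau :
  measurable_fun setT (@gauss_kernel R n tau).
Proof.
apply: measurable_funM => //; apply: measurableT_comp => //.
apply: measurable_funN; apply: measurable_funM => //.
under eq_fun do rewrite enorm_sqr.
by apply: measurable_sum => i; apply: measurable_funX; exact: measurable_coord.
Qed.

Lemma gauss_kernel_ge0 n tau (x : 'rV[R]_n) : 0 <= gauss_kernel tau x.
Proof. by rewrite mulr_ge0 ?powR_ge0 ?expR_ge0. Qed.

Lemma gauss_kernel_bound n tau (x : 'rV[R]_n) : 0 < tau ->
  `|gauss_kernel tau x| <= (pi * tau) `^ (- (n%:R / 2)).
Proof.
move=> t0; rewrite ger0_norm ?gauss_kernel_ge0// /gauss_kernel.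
rewrite ler_piMr ?powR_ge0// -expR0 ler_expR oppr_le0 divr_ge0 ?sqr_ge0//.
exact: ltW.
Qed.

Lemma integral_gauss1 tau : 0 < tau ->
  (\int[@lebesgue_measure R]_x (expR (- (x ^+ 2 / tau)))%:E =
    (Num.sqrt (pi * tau))%:E)%E.
Proof.
move=> t0; have st : 0 < Num.sqrt tau by rewrite sqrtr_gt0.
have a0 : (Num.sqrt tau)^-1 != 0 by rewrite invr_eq0 gt_eqF.
have := @ge0_integral_affine R _ 0 (fun x => (gauss_fun x)%:E) a0.
rewrite integralT_gauss => H.
rewrite sqrtrM ?pi_ge0// mulrC EFinM -H; last 2 first.
- by apply/measurable_EFinP; exact: measurable_gauss_fun.
- by move=> x; rewrite lee_fin gauss_fun_ge0.
rewrite muleA -EFinM gtr0_norm ?invr_gt0// divff ?gt_eqF// mul1e.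
apply: eq_integral => x _; rewrite /gauss_fun addr0 exprMn exprVn sqr_sqrtr
  ?ltW//.
by rewrite mulrC.
Qed.

Lemma integral_gauss_kernel n tau : 0 < tau ->
  (\int[lebesgue_rV n]_x (gauss_kernel tau x)%:E = 1)%E.
Proof.
move=> t0; have pt0 : 0 < pi * tau by rewrite mulr_gt0 ?pi_gt0.
have mg m : measurable_fun setT (fun x : 'rV[R]_m =>
  (expR (- (enorm x ^+ 2 / tau)))%:E).
  apply/measurable_EFinP/measurableT_comp => //.
  apply: measurable_funN; apply: measurable_funM => //.
  under eq_fun do rewrite enorm_sqr.
  by apply: measurable_sum => i; apply: measurable_funX;
    exact: measurable_coord.
have key : (\int[lebesgue_rV n]_x (expR (- (enorm x ^+ 2 / tau)))%:E =
    (Num.sqrt (pi * tau) ^+ n)%:E)%E.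
  elim: n => [|n IH].
    rewrite integral_rV0; last exact: mg.
    by rewrite enorm_sqr big_ord0 mul0r oppr0 expR0 expr0.
  rewrite integral_rV_cons; [|exact: mg|by move=> x; rewrite lee_fin expR_ge0].
  transitivity (\int[lebesgue_measure]_a ((expR (- (a ^+ 2 / tau)))%:E *
      (Num.sqrt (pi * tau) ^+ n)%:E))%E.
    apply: eq_integral => a _; rewrite -IH -ge0_integralZl_EFin ?expR_ge0//;
      last exact: mg.
    apply: eq_integral => y _; rewrite -EFinM -expRD; congr (expR _)%:E.
    rewrite !enorm_sqr big_ord_recl rV_consE0/=.
    under eq_bigr do rewrite rV_consES.
    by rewrite mulrDl opprD.
  rewrite ge0_integralZr//; last first.
    apply/measurable_EFinP/measurableT_comp => //.
    by apply: measurable_funN; apply: measurable_funM => //;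
      exact: measurable_funX.
  by rewrite integral_gauss1// -EFinM -exprS.
under eq_integral do rewrite /gauss_kernel EFinM.
rewrite ge0_integralZl_EFin ?powR_ge0//; last exact: mg.
rewrite key -EFinM; congr EFin.
rewrite -powR12_sqrt ?ltW// -powR_mulrn ?powR_ge0// -powRrM mulrC.
rewrite [2^-1 * _]mulrC -powRD; first by rewrite subrr powRr0.
by rewrite subrr eqxx gt_eqF.
Qed.

End gaussian.

(** * Euclidean norm and orthogonal projection *)

Section euclidean_norm.
Context {R : realType}.

Lemma enorm_dot n (x : 'rV[R]_n) : enorm x ^+ 2 = (x *m x^T) ord0 ord0.
Proof. by rewrite enorm_sqr mxE; apply: eq_bigr => i _; rewrite mxE expr2. Qed.

Lemma enorm_cauchy_schwarz n (x y : 'rV[R]_n) :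
  \sum_(i < n) x ord0 i * y ord0 i <= enorm x * enorm y.
Proof.
have enorm0 (z z' : 'rV[R]_n) : enorm z = 0 ->
  \sum_(i < n) z ord0 i * z' ord0 i = 0.
  move=> z0; have /eqP := enorm_sqr z; rewrite z0 expr0n/= eq_sym psumr_eq0;
    last first.
    by move=> i _; exact: sqr_ge0.
  move=> /allP H; apply: big1 => i _.
  by have := H i (mem_index_enum _); rewrite implyTb sqrf_eq0 => /eqP ->;
    rewrite mul0r.
have [x0|xn0] := eqVneq (enorm x) 0; first by rewrite x0 mul0r enorm0.
have [y0|yn0] := eqVneq (enorm y) 0.
  by rewrite y0 mulr0; under eq_bigr do rewrite mulrC; rewrite enorm0.
have st : 0 < enorm x * enorm y by rewrite mulr_gt0 ?lt_def ?xn0 ?yn0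
  ?enorm_ge0.
have : 0 <= \sum_(i < n) (x ord0 i * enorm y - y ord0 i * enorm x) ^+ 2.
  by apply: sumr_ge0 => i _; exact: sqr_ge0.
rewrite (eq_bigr (fun i => enorm y ^+ 2 * x ord0 i ^+ 2 + enorm x ^+ 2 * y
  ord0 i ^+ 2 +
  (- (2 * (enorm x * enorm y))) * (x ord0 i * y ord0 i))); last by move=> i _;
    ring.
rewrite !big_split/= -!mulr_sumr -!enorm_sqr => H.
rewrite -(ler_pM2l st) -subr_ge0.
have -> : enorm x * enorm y * (enorm x * enorm y) =
  enorm x ^+ 2 * enorm y ^+ 2 by ring.
lra.
Qed.

Lemma enorm_triangle n (x y : 'rV[R]_n) : enorm (x + y) <= enorm x + enorm y.
Proof.
rewrite -(ler_pXn2r (ltn0Sn 1)) ?nnegrE ?addr_ge0 ?enorm_ge0//.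
rewrite enorm_sqr (eq_bigr (fun i => x ord0 i ^+ 2 + y ord0 i ^+ 2 +
  2 * (x ord0 i * y ord0 i))); last by move=> i _; rewrite mxE; ring.
rewrite !big_split/= -mulr_sumr -!enorm_sqr.
have := enorm_cauchy_schwarz x y; lra.
Qed.

Lemma enormN n (x : 'rV[R]_n) : enorm (- x) = enorm x.
Proof. by rewrite /enorm; congr Num.sqrt; apply: eq_bigr => i _;
  rewrite mxE sqrrN. Qed.

Lemma enorm_dist n (x y : 'rV[R]_n) : `|enorm x - enorm y| <= enorm (x - y).
Proof.
have H (u v : 'rV[R]_n) : enorm u - enorm v <= enorm (u - v).
  by rewrite lerBlDr; have := enorm_triangle (u - v) v; rewrite subrK.
by rewrite ler_norml H andbT lerNl opprB -[leRHS]enormN opprB H.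
Qed.

(** Pythagoras: the difference of the two squared norms is the squared norm of the component
    orthogonal to the rows of [E]. Hence displacements in the ambient space control those in the
    subspace, whatever the codimension. *)
Lemma enorm_proj d n (E : 'M[R]_(d, n)) (v : 'rV[R]_n) :
  E *m E^T = 1%:M -> enorm (v *m E^T) <= enorm v.
Proof.
move=> EE; rewrite -(ler_pXn2r (ltn0Sn 1)) ?nnegrE ?enorm_ge0//.
rewrite -subr_ge0; have : 0 <= enorm (v - v *m E^T *m E) ^+ 2 by exact: sqr_ge0.
rewrite !enorm_dot; set w := v *m E^T.
have -> : (v - w *m E) *m (v - w *m E)^T = v *m v^T - w *m w^T.
  rewrite linearB/= trmx_mul mulmxBr !mulmxBl.
  have -> : v *m (E^T *m w^T) = w *m w^T by rewrite mulmxA.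
  have -> : w *m E *m (E^T *m w^T) = w *m w^T.
    by rewrite mulmxA -(mulmxA w) EE mulmx1.
  have -> : w *m E *m v^T = w *m w^T.
    by rewrite -mulmxA /w trmx_mul trmxK.
  by rewrite subrr subr0.
by rewrite !mxE.
Qed.

End euclidean_norm.

(** * Variation of the Gaussian under small shifts *)

Section gauss_lipschitz.
Context {R : realType}.

Lemma expR_neg_dist (x y : R) :
  `|expR (- x) - expR (- y)| <= `|x - y| * expR (- Num.min x y).
Proof.
wlog xy : x y / x <= y.
  move=> H; case/orP: (le_total x y) => [/H//|yx].
  by rewrite distrC (distrC x) minC; exact: H yx.
rewrite min_l// ger0_norm ?subr_ge0 ?ler_expR ?lerN2//.
rewrite ler0_norm ?subr_le0// opprB.
have -> : expR (- y) = expR (- x) * expR (x - y) by rewrite -expRD; congr expR;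
  ring.
have := expR_ge1Dx (x - y); have := expR_gt0 (- x).
move: (expR (- x)) (expR (x - y)) => a b a0 H.
have : a * (1 + (x - y)) <= a * b by rewrite ler_pM2l.
lra.
Qed.

(** The difference is at most that of the squares, bounded by [e * (2 * a + 1)], times the larger
    exponential. As [b >= a - 1], the latter is at most [expR 1 * expR (- (a ^+ 2 / 2))]: half of
    this exponent absorbs the linear factor, the other half is the wider Gaussian. *)
Lemma gauss_profile_lipschitz (a b e : R) : 0 <= a -> 0 <= b -> e <= 1 ->
  `|a - b| <= e ->
  `|expR (- a ^+ 2) - expR (- b ^+ 2)| <=
    3 * expR 1 * e * expR (- (a ^+ 2 / 4)).
Proof.
move=> a0 b0 e1 abe; have e0 : 0 <= e by exact: le_trans abe.
apply: le_trans (expR_neg_dist _ _) _.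
have /andP[ab1 ab2] : - e <= a - b <= e by rewrite -ler_norml.
have Hmin : expR (- Num.min (a ^+ 2) (b ^+ 2)) <=
  expR 1 * expR (- (a ^+ 2 / 4)) * expR (- (a ^+ 2 / 4)).
  rewrite -!expRD ler_expR lerNl le_min; apply/andP; split;
    first by have := sqr_ge0 a; lra.
  suff : a ^+ 2 <= 2 * b ^+ 2 + 2 by lra.
  have : a ^+ 2 <= (b + 1) ^+ 2 by rewrite ler_pXn2r ?nnegrE ?addr_ge0//; lra.
  by have := sqr_ge0 (b - 1); rewrite sqrrD1 sqrrB1; lra.
have Hdist : `|a ^+ 2 - b ^+ 2| <= e * (2 * a + 1).
  rewrite subr_sqr normrM ler_pM// ger0_norm ?addr_ge0//; lra.
have Hpoly : 2 * a + 1 <= 3 * expR (a ^+ 2 / 4).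
  (* At [4 / 3] the parabola [3 * (1 + a ^+ 2 / 4)] has slope 2, that of the linear factor. *)
  have := expR_ge1Dx (a ^+ 2 / 4); have := sqr_ge0 (a - 4 / 3).
  have -> : (a - 4 / 3) ^+ 2 = a ^+ 2 - 8 / 3 * a + 16 / 9 by field.
  lra.
apply: (@le_trans _ _ (e * (3 * expR (a ^+ 2 / 4)) *
    (expR 1 * expR (- (a ^+ 2 / 4)) * expR (- (a ^+ 2 / 4))))).
  apply: ler_pM; [exact: normr_ge0|exact: expR_ge0| |exact: Hmin].
  by apply: le_trans Hdist _; rewrite ler_wpM2l.
have H1 : expR (a ^+ 2 / 4) * expR (- (a ^+ 2 / 4)) =
  1 by rewrite -expRD subrr expR0.
move: (expR (a ^+ 2 / 4)) (expR (- (a ^+ 2 / 4))) (expR 1) H1 => A B C H1.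
rewrite (_ : e * (3 * A) * (C * B * B) = 3 * C * e * B * (A * B)); last by ring.
by rewrite H1 mulr1.
Qed.

(** Rescaling by the square root of [tau] reduces this to the one-dimensional profile; [2 ^+ n] is
    the quotient of the normalising factors at [tau] and [4 * tau]. *)
Lemma gauss_kernel_lipschitz n (tau e : R) (u v : 'rV[R]_n) : 0 < tau ->
  e <= Num.sqrt tau -> enorm (u - v) <= e ->
  `|gauss_kernel tau u - gauss_kernel tau v| <=
  3 * expR 1 * 2 ^+ n * (e / Num.sqrt tau) * gauss_kernel (4 * tau) u.
Proof.
move=> t0 et uve; have s0 : 0 < Num.sqrt tau by rewrite sqrtr_gt0.
have sE : Num.sqrt tau ^+ 2 = tau by rewrite sqr_sqrtr// ltW.
rewrite /gauss_kernel -mulrBr normrM ger0_norm ?powR_ge0//.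
have Ez (z : 'rV[R]_n) : enorm z ^+ 2 / tau = (enorm z / Num.sqrt tau) ^+ 2.
  by rewrite exprMn exprVn sE.
rewrite !Ez.
have -> : enorm u ^+ 2 / (4 * tau) = (enorm u / Num.sqrt tau) ^+ 2 / 4.
  by rewrite exprMn exprVn sE invfM; ring.
have pt : 0 < pi * tau by rewrite mulr_gt0// pi_gt0.
have -> : (pi * (4 * tau)) `^ (- (n%:R / 2)) =
  (pi * tau) `^ (- (n%:R / 2)) / 2 ^+ n.
  rewrite (_ : pi * (4 * tau) = (pi * tau) * 4); last by ring.
  rewrite powRM ?(ltW pt)//; congr (_ * _).
  rewrite (_ : 4 = 2 `^ 2 :> R); last by rewrite powR_mulrn// expr2 -natrM.
  by rewrite -powRrM mulrN mulrC divfK ?pnatr_eq0// powRN powR_mulrn.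
have := @gauss_profile_lipschitz (enorm u / Num.sqrt tau)
  (enorm v / Num.sqrt tau)
  (e / Num.sqrt tau).
rewrite !divr_ge0 ?enorm_ge0 ?sqrtr_ge0// ler_pdivrMr// mul1r et =>
  /(_ isT isT isT).
rewrite -mulrBl normrM (gtr0_norm (_ : 0 < (Num.sqrt tau)^-1)) ?invr_gt0//.
rewrite ler_pM2r ?invr_gt0// (le_trans (enorm_dist u v) uve) => /(_ isT) H.
have := ler_wpM2l (powR_ge0 (pi * tau) (- (n%:R / 2))) H.
move=> /le_trans; apply; rewrite le_eqVlt; apply/orP; left; apply/eqP.
have n0 : 2 ^+ n != 0 :> R by rewrite expf_neq0.
field.
by rewrite n0 gt_eqF.
Qed.

End gauss_lipschitz.

(** * Summation over scales *)

Section scale_sum.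
Context {R : realType}.
Implicit Types (q x y s c t : R).

Lemma powR_exprn x s k : 0 <= x -> (x ^+ k) `^ s = (x `^ s) ^+ k.
Proof.
by move=> x0; rewrite -(powR_mulrn k x0) -(powR_mulrn k (powR_ge0 x s)) -!powRrM
  mulrC.
Qed.

Lemma powR_invl x s : 0 <= x -> x^-1 `^ s = (x `^ s)^-1.
Proof. by move=> x0; rewrite -powR_inv1// -powRrM mulN1r powRN. Qed.

(** Bernoulli's inequality for an exponent in the unit interval. It replaces denominators of
    geometric series, whose ratios are powers of [q] involving [p], by multiples of [1 - q] free of
    [p]. *)
Lemma one_sub_powR q s c : 0 < q < 1 -> 0 <= c <= 1 -> c <= s ->
  c * (1 - q) <= 1 - q `^ s.
Proof.
move=> /andP[q0 q1] c01 cs.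
have H1 : q `^ s <= q `^ c by rewrite ger_powR// q0 ltW.
have := powR_le_mean (ltW q0) c01; lra.
Qed.

Lemma geometric_le x n : 0 <= x < 1 -> (\sum_(0 <= k < n) x ^+ k) * (1 - x) <=
  1.
Proof.
move=> /andP[x0 x1]; elim: n => [|n IH]; first by rewrite big_nil mul0r.
suff -> : (\sum_(0 <= k < n.+1) x ^+ k) * (1 - x) = 1 - x ^+ n.+1.
  by rewrite gerBl exprn_ge0.
elim: n {IH} => [|n IH]; first by rewrite big_nat1 expr0 expr1 mul1r.
by rewrite big_nat_recr//= mulrDl IH !exprS; ring.
Qed.

(** A geometric sum with ratio above one is controlled by its last term, reading it backwards with
    the inverse ratio [y]. *)
Lemma geometric_reverse_le x y n : x * y = 1 -> 0 <= y <= 1 ->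
  (\sum_(0 <= k < n) x ^+ k) * (1 - y) <= x ^+ n * y.
Proof.
move=> xy /andP[y0 y1]; elim: n => [|n IH];
  first by rewrite big_nil mul0r mul1r.
rewrite big_nat_recr//= mulrDl exprSr -mulrA xy; move: IH; lra.
Qed.

Variables (q delta alpha p : R).
Hypotheses (q01 : 0 < q < 1) (delta01 : 0 <= delta < 1) (p1 : 1 <= p).
Hypothesis alpha0 : 0 < alpha.

Let term k := (q ^+ k) `^ alpha * Num.min 1 (delta / q ^+ k).

Let q0 : 0 < q. Proof. by case/andP: q01. Qed.
Let q1 : q < 1. Proof. by case/andP: q01. Qed.
Let p0 : 0 < p. Proof. exact: lt_le_trans p1. Qed.
Let d0 : 0 <= delta. Proof. by case/andP: delta01. Qed.
Let qk0 k : 0 < q ^+ k. Proof. exact: exprn_gt0. Qed.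

Let term_ge0 k : 0 <= term k.
Proof. by rewrite mulr_ge0 ?powR_ge0// le_min ler01 divr_ge0// ltW. Qed.

(* [term_tail] and [term_head] use the two arguments of the minimum; they are
   applied above and below the index where [q ^+ k] passes [delta]. *)
Let term_tail k : term k `^ p <= (q `^ (alpha * p)) ^+ k.
Proof.
rewrite powRrM -!powR_exprn ?powR_ge0 ?(ltW q0)//.
apply: ge0_ler_powR; rewrite ?nnegrE ?powR_ge0 ?term_ge0 ?(ltW p0)//=.
by rewrite ler_piMr ?powR_ge0// ge_min lexx.
Qed.

Let term_head k : term k `^ p <= delta `^ p * (q `^ ((alpha - 1) * p)) ^+ k.
Proof.
rewrite powRrM -!powR_exprn ?powR_ge0 ?(ltW q0)// -powRM ?powR_ge0//.
apply: ge0_ler_powR; first exact: ltW.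
- by rewrite nnegrE.
- by rewrite nnegrE mulr_ge0 ?powR_ge0.
apply: (@le_trans _ _ ((q ^+ k) `^ alpha * (delta / q ^+ k))).
  by rewrite /term ler_wpM2l ?powR_ge0// ge_min lexx orbT.
rewrite powRB; last by apply/implyP => _; rewrite gt_eqF.
by rewrite powRr1 ?(ltW (qk0 k))// le_eqVlt; apply/orP; left; apply/eqP; ring.
Qed.

(** The second argument of the minimum can be used at every scale, as it gives a geometric ratio
    below one; [c] is the denominator of [Delta] raised to the power [p]. *)
Let sum_gt1 n : 1 < alpha ->
  \sum_(0 <= k < n) term k `^ p <= (1 - q)^-1 * Delta alpha p delta `^ p.
Proof.
move=> a1; have a10 : 0 < alpha - 1 by rewrite subr_gt0.
pose x := q `^ ((alpha - 1) * p); pose c := Num.min (alpha - 1) 1.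
have c0 : 0 < c by rewrite lt_min a10 ltr01.
have cx : c * (1 - q) <= 1 - x.
  apply: one_sub_powR => //; first by rewrite ltW//= ge_min lexx orbT.
  apply: (@le_trans _ _ (alpha - 1)); first by rewrite ge_min lexx.
  by rewrite ler_peMr// ltW.
have cq0 : 0 < c * (1 - q) by rewrite mulr_gt0// subr_gt0.
have x1 : 0 < 1 - x by exact: lt_le_trans cx.
have x01 : 0 <= x < 1 by rewrite powR_ge0/= -subr_gt0.
have -> : Delta alpha p delta `^ p = delta `^ p / c.
  rewrite /Delta; have [->|dn0] := eqVneq delta 0.
    by rewrite powR0 ?gt_eqF// mul0r.
  rewrite ltNge ltW//= gt_eqF// powRM ?invr_ge0 ?le_min ?powR_ge0 ?ler01//.
  congr (_ * _); rewrite powR_invl ?le_min ?powR_ge0 ?ler01//.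
  congr (_^-1); rewrite /c; have [a2|a2] := leP (alpha - 1) 1.
    rewrite min_l; first by rewrite -powRrM mulVf ?gt_eqF// powRr1// ltW.
    rewrite [leRHS](_ : _ = 1 `^ p^-1 :> R); last by rewrite powR1.
  apply: ge0_ler_powR; rewrite ?nnegrE ?invr_ge0 ?(ltW p0) ?(ltW a10) ?ler01//.
  rewrite min_r ?powR1//.
  rewrite [leLHS](_ : _ = 1 `^ p^-1 :> R); last by rewrite powR1.
  apply: ge0_ler_powR; rewrite ?nnegrE ?invr_ge0 ?(ltW p0) ?(ltW a10) ?(ltW a2)
    ?ler01//.
apply: (@le_trans _ _ (delta `^ p * \sum_(0 <= k < n) x ^+ k)).
  by rewrite mulr_sumr; apply: ler_sum => k _; exact: term_head.
rewrite mulrCA ler_wpM2l ?powR_ge0// -invfM mulrC.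
rewrite -[leRHS]mul1r ler_pdivlMr//.
apply: le_trans (geometric_le n x01); rewrite ler_wpM2l//.
by apply: sumr_ge0 => k _; rewrite exprn_ge0// powR_ge0.
Qed.

Let split_scale : 0 < delta -> exists K : nat, q ^+ K <= delta /\
  forall k, (k < K)%N -> delta < q ^+ k.
Proof.
move=> dp; have exK : exists K, q ^+ K <= delta.
  have qn : `|q| < 1 by rewrite gtr0_norm.
  have /cvgrPdist_lt/(_ _ dp)[N _ HN] := cvg_expr qn.
  exists N; have := HN N (leqnn N); rewrite sub0r normrN ger0_norm
    ?(ltW (qk0 N))//.
  by move/ltW.
exists (ex_minn exK); case: ex_minnP => K HK Kmin; split => // k kK.
by rewrite ltNge; apply/negP => /Kmin; rewrite leqNgt kK.
Qed.

Let sum_split K n : \sum_(0 <= k < n) term k `^ p <=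
  \sum_(0 <= k < K) term k `^ p + \sum_(0 <= k < n) (q `^ (alpha * p)) ^+
    (K + k).
Proof.
(* Extending the range to [K + n] spares a comparison of [K] with [n]. *)
apply: (@le_trans _ _ (\sum_(0 <= k < K + n) term k `^ p)).
  rewrite addnC [leRHS](@big_cat_nat _ _ _ n)//= ?leq_addr// lerDl.
  by apply: sumr_ge0 => k _; exact: powR_ge0.
rewrite (@big_cat_nat _ _ _ K)//= ?leq_addr// lerD2l.
rewrite -{1}[K]add0n big_addn addKn.
by apply: ler_sum => k _; rewrite addnC; exact: term_tail.
Qed.

Let tail_le K n c : q ^+ K <= delta -> 0 < c <= 1 -> c <= alpha * p ->
  \sum_(0 <= k < n) (q `^ (alpha * p)) ^+ (K + k) <=
  delta `^ (alpha * p) * (c * (1 - q))^-1.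
Proof.
move=> Kd /andP[c0 c1] ca; set x := q `^ (alpha * p).
have cx : c * (1 - q) <= 1 - x by apply: one_sub_powR => //; rewrite ltW.
have cq0 : 0 < c * (1 - q) by rewrite mulr_gt0// subr_gt0.
have x01 : 0 <= x < 1 by rewrite powR_ge0/= -subr_gt0 (lt_le_trans cq0).
under eq_bigr do rewrite exprD.
rewrite -mulr_sumr; apply: ler_pM.
- by rewrite exprn_ge0// powR_ge0.
- by apply: sumr_ge0 => k _; rewrite exprn_ge0// powR_ge0.
- rewrite /x -powR_exprn ?(ltW q0)//; apply: ge0_ler_powR;
  rewrite ?nnegrE ?(ltW (qk0 K))//.
  by rewrite mulr_ge0// ltW.
rewrite -[leRHS]mul1r ler_pdivlMr//.
apply: le_trans (geometric_le n x01); rewrite ler_wpM2l//.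
by apply: sumr_ge0 => k _; rewrite exprn_ge0// powR_ge0.
Qed.

(** At the critical exponent each of the [K] head terms has the same bound, and counting them
    produces the logarithm in [Delta]. *)
Let sum_eq1 n : alpha = 1 -> 0 < delta ->
  \sum_(0 <= k < n) term k `^ p <= 2 / (1 - q) * Delta alpha p delta `^ p.
Proof.
move=> a1 dp; have [K [Kd Kmin]] := split_scale dp.
have L0 : 0 <= ln (1 / delta).
  by rewrite ln_ge0// ler_pdivlMr// mul1r ltW//; case/andP: delta01.
have -> : Delta alpha p delta `^ p = delta `^ p * (ln (1 / delta) + 1).
  rewrite /Delta gt_eqF// a1 ltxx eqxx powRM ?powR_ge0//
    -powRrM mulVf ?gt_eqF//.
  by rewrite powRr1// addr_ge0.
apply: (le_trans (sum_split K n)).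
have T := @tail_le K n 1 Kd; rewrite ltr01 lexx a1 mul1r in T.
have {}T := T isT p1; rewrite mul1r in T.
have Hhead : \sum_(0 <= k < K) term k `^ p <= delta `^ p * K%:R.
  apply: (@le_trans _ _ (\sum_(0 <= k < K) delta `^ p)).
    apply: ler_sum => k _; apply: le_trans (term_head k) _.
    by rewrite a1 subrr mul0r powRr0 expr1n mulr1.
  by rewrite sumr_const_nat subn0 mulr_natr.
have q10 : 0 < 1 - q by rewrite subr_gt0.
(* For positive [K], minimality gives [delta < q ^+ (K - 1)]; take logarithms and use
   [1 - q <= - ln q]. *)
have HK : K%:R <= ln (1 / delta) / (1 - q) + 1.
  case: K Kd Kmin {Hhead T} => [|K] Kd Kmin.
    by rewrite addr_ge0// divr_ge0// ltW.
  rewrite -natr1 lerD2r ler_pdivlMr//.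
  apply: (@le_trans _ _ (K%:R * - ln q)).
    rewrite ler_wpM2l// lerNr; have := @le_ln1Dx R (q - 1).
    by rewrite subrKC ltrBrDr addNr q0 => /(_ isT); lra.
  rewrite mulrN mulr_natl -lnXn// div1r lnV ?posrE// lerN2 ler_ln ?posrE//
    ltW//.
  exact: Kmin.
rewrite a1 mul1r.
apply: (le_trans (lerD Hhead T)).
rewrite -mulrDr [leRHS]mulrCA ler_wpM2l ?powR_ge0//.
have H1 : ln (1 / delta) / (1 - q) + 1 + (1 - q)^-1 <=
    2 / (1 - q) * (ln (1 / delta) + 1).
  have qi : 1 <= (1 - q)^-1 by rewrite invf_ge1// gerBl ltW.
  have := mulr_ge0 L0 (le_trans ler01 qi).
  move: ((1 - q)^-1) qi => z zi; lra.
by apply: le_trans H1; rewrite lerD2r.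
Qed.

(** The head is controlled by its last term and the tail by its first, both of size [delta] to the
    power [alpha * p]. The identity [1 / (1 - alpha) + 1 / alpha = 1 / (alpha - alpha ^+ 2)] yields
    the denominator in [Delta]. *)
Let sum_lt1 n : alpha < 1 -> 0 < delta ->
  \sum_(0 <= k < n) term k `^ p <= 2 / (1 - q) * Delta alpha p delta `^ p.
Proof.
move=> a1 dp; have [K [Kd Kmin]] := split_scale dp.
have aa0 : 0 < alpha - alpha ^+ 2.
  by rewrite (_ : _ - _ = alpha * (1 - alpha));
    [rewrite mulr_gt0// subr_gt0|ring].
have -> : Delta alpha p delta `^ p =
  delta `^ (alpha * p) / (alpha - alpha ^+ 2).
  rewrite /Delta gt_eqF// a1 powRM ?powR_ge0 ?invr_ge0 ?powR_ge0// -powRrM.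
  congr (_ * _); rewrite powR_invl ?powR_ge0//.
  by rewrite -powRrM mulVf ?gt_eqF// powRr1// ltW.
apply: (le_trans (sum_split K n)).
have T : \sum_(0 <= k < n) (q `^ (alpha * p)) ^+ (K + k) <=
    delta `^ (alpha * p) * (alpha * (1 - q))^-1.
  by apply: tail_le => //; rewrite ?alpha0 ?(ltW a1)// ler_peMr// ltW.
have Hhead : \sum_(0 <= k < K) term k `^ p <=
    delta `^ (alpha * p) * ((1 - alpha) * (1 - q))^-1.
  pose x := q `^ ((alpha - 1) * p); pose y := q `^ ((1 - alpha) * p).
  have xy : x * y = 1.
    rewrite /x /y -powRD; last by apply/implyP => _; rewrite gt_eqF.
    by rewrite -mulrDl subrKA subrr mul0r powRr0.
  have b0 : 0 < 1 - alpha by rewrite subr_gt0.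
  have cy : (1 - alpha) * (1 - q) <= 1 - y.
    apply: one_sub_powR => //; first by rewrite ltW//= gerBl ltW.
    by rewrite ler_peMr// ltW.
  have cq0 : 0 < (1 - alpha) * (1 - q) by rewrite mulr_gt0// subr_gt0.
  have y01 : 0 <= y <= 1 by rewrite powR_ge0/= -subr_ge0 (le_trans (ltW cq0)).
  apply: (@le_trans _ _ (delta `^ p * \sum_(0 <= k < K) x ^+ k)).
    by rewrite mulr_sumr; apply: ler_sum => k _; exact: term_head.
  have [K0|K0] := posnP K.
    by rewrite K0 big_nil mulr0 mulr_ge0 ?powR_ge0// invr_ge0 ltW.
  have xs0 : 0 <= \sum_(0 <= k < K) x ^+ k.
    by apply: sumr_ge0 => k _; rewrite exprn_ge0// powR_ge0.
  have Hx : (\sum_(0 <= k < K) x ^+ k) * ((1 - alpha) * (1 - q)) <=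
    delta `^ ((alpha - 1) * p).
    apply: (@le_trans _ _ ((\sum_(0 <= k < K) x ^+ k) * (1 - y))).
      by rewrite ler_wpM2l.
    apply: le_trans (geometric_reverse_le K xy y01) _.
    (* The last term has index [K - 1], where the scale still exceeds [delta]; the negative exponent
       reverses the comparison. *)
    rewrite -(prednK K0) exprSr -mulrA xy mulr1 /x -powR_exprn ?(ltW q0)//.
    have -> : (alpha - 1) * p = - ((1 - alpha) * p) by ring.
    rewrite !powRN lef_pV2 ?posrE ?powR_gt0//.
    apply: ge0_ler_powR; rewrite ?nnegrE ?(ltW (qk0 _)) ?(ltW dp)//.
      by rewrite mulr_ge0// ltW.
    by apply: ltW; apply: Kmin; rewrite prednK.
  rewrite -ler_pdivlMr// in Hx.
  apply: (le_trans (ler_wpM2l (powR_ge0 _ _) Hx)).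
  rewrite mulrA -powRD; last by apply/implyP => _; rewrite gt_eqF.
  by rewrite (_ : p + (alpha - 1) * p = alpha * p); last by ring.
apply: (le_trans (lerD Hhead T)).
have q10 : 0 < 1 - q by rewrite subr_gt0.
have -> : delta `^ (alpha * p) / ((1 - alpha) * (1 - q)) +
    delta `^ (alpha * p) / (alpha * (1 - q)) =
    1 / (1 - q) * (delta `^ (alpha * p) / (alpha - alpha ^+ 2)).
  rewrite (_ : alpha - alpha ^+ 2 = alpha * (1 - alpha)); last by ring.
  by field; rewrite !gt_eqF// subr_gt0.
rewrite ler_wpM2r//; first by rewrite divr_ge0 ?powR_ge0// ltW.
by rewrite ler_wpM2r ?invr_ge0 ?(ltW q10)//; lra.
Qed.

Lemma scale_sum_le n :
  \sum_(0 <= k < n) ((q ^+ k) `^ alpha * Num.min 1 (delta / q ^+ k)) `^ p <=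
  2 / (1 - q) * Delta alpha p delta `^ p.
Proof.
have q10 : 0 < 1 - q by rewrite subr_gt0.
have [dE|dn0] := eqVneq delta 0.
  rewrite big1 ?mulr_ge0 ?powR_ge0 ?invr_ge0 ?(ltW q10)// => k _.
  by rewrite dE mul0r min_r// mulr0 powR0// gt_eqF.
have dp : 0 < delta by rewrite lt_def dn0.
have [a1|a1|a1] := ltgtP alpha 1; [exact: sum_lt1| |exact: sum_eq1].
apply: (le_trans (sum_gt1 n a1)); rewrite ler_wpM2r ?powR_ge0//.
by rewrite ler_peMl ?invr_ge0 ?(ltW q10)//; lra.
Qed.

End scale_sum.

(** * Projections of deformations *)

Section deformation.
Context {R : realType} (n : nat).
Variables (A B : set 'rV[R]_n) (phi psi : 'rV[R]_n -> 'rV[R]_n).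
Hypotheses (oA : open A) (oB : open B) (bij : set_bij B A phi).
Hypothesis phi1 : C1_on B phi.
Hypothesis mpsi : measurable_fun setT psi.
Hypothesis phiK : forall x, B x -> psi (phi x) = x.

Lemma deformE (f : 'rV[R]_n -> R) x :
  deform phi B f x = f (ext_map B phi x) * density B phi x.
Proof.
rewrite /deform /ext_map /density /absdet !patchE; case: ifP => // _.
by rewrite mulr0.
Qed.

Lemma measurable_deform (f : 'rV[R]_n -> R) :
  measurable_fun setT f -> measurable_fun setT (deform phi B f).
Proof.
move=> mf; rewrite (_ : deform phi B f =
  (f \o ext_map B phi) \* density B phi); last by apply/funext => x;
    exact: deformE.
apply: measurable_funM; last exact: measurable_density.
by apply: measurableT_comp => //; exact: measurable_ext_map.
Qed.

Let ge0_transfer (h : 'rV[R]_n -> \bar R) (k : 'rV[R]_n -> \bar R) :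
  measurable_fun setT h -> (forall y, 0 <= h y)%E ->
  (forall y, ~ A y -> h y = 0%E) -> (forall x, ~ B x -> k x = 0%E) ->
  (forall x, B x -> (h (phi x) * `|\det ('J phi x)|%:E)%E = k x) ->
  (\int[lebesgue_rV n]_y h y = \int[lebesgue_rV n]_x k x)%E.
Proof.
move=> mh h0 hA kB hk.
transitivity (\int[lebesgue_rV n]_(y in A) h y)%E.
  rewrite [RHS]integral_mkcond; apply: eq_integral => y _; rewrite patchE.
  by case: ifPn => // /negP; rewrite inE => /hA.
rewrite (C1_change_of_variables oA oB bij phi1 mh h0).
rewrite [LHS]integral_mkcond; apply: eq_integral => x _; rewrite patchE.
case: ifPn => [/set_mem/hk//|/negP]; rewrite inE => /kB ->//.
Qed.

Lemma integrable_deform (f : 'rV[R]_n -> R) : (forall x, ~ A x -> f x = 0) ->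
  (lebesgue_rV n).-integrable setT (EFin \o f) ->
  (lebesgue_rV n).-integrable setT (EFin \o deform phi B f).
Proof.
move=> fA /integrableP[/measurable_EFinP mf fint]; apply/integrableP; split.
  by apply/measurable_EFinP; exact: measurable_deform.
rewrite -(ge0_transfer (h := fun y => `|(f y)%:E|%E))//.
- by apply: measurableT_comp => //; exact/measurable_EFinP.
- by move=> y /fA /= ->; rewrite normr0.
- by move=> x nBx /=; rewrite /deform memNset// normr0.
- by move=> x Bx /=; rewrite /deform mem_set// -EFinM normrM normr_id.
Qed.

(** Positive and negative parts are transferred separately, the change of variables being for
    nonnegative functions; a nonnegative Jacobian factor commutes with taking these parts. *)
Lemma integral_mul_deform (f g : 'rV[R]_n -> R) :
  measurable_fun setT f -> measurable_fun setT g ->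
    (forall x, ~ A x -> f x = 0) ->
  (\int[lebesgue_rV n]_x (g x * deform phi B f x)%:E =
   \int[lebesgue_rV n]_y (g (psi y) * f y)%:E)%E.
Proof.
move=> mf mg fA; apply/esym.
have mh : measurable_fun setT (fun y => (g (psi y) * f y)%:E).
  by apply/measurable_EFinP; apply: measurable_funM => //;
    exact: measurableT_comp.
rewrite integralE [RHS]integralE; congr (_ - _)%E; apply: ge0_transfer => //.
- exact: measurable_funepos.
- by move=> y /fA fy; rewrite funeposE fy mulr0 maxxx.
- by move=> x nBx; rewrite funeposE /deform memNset// mulr0 maxxx.
- move=> x Bx; rewrite !funeposE phiK// /deform mem_set// mulrA.
  by rewrite maxe_pMl// mul0e.
- exact: measurable_funeneg.
- by move=> y /fA fy; rewrite funenegE fy mulr0 oppe0 maxxx.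
- by move=> x nBx; rewrite funenegE /deform memNset// mulr0 oppe0 maxxx.
- move=> x Bx; rewrite !funenegE phiK// /deform mem_set// mulrA.
  by rewrite maxe_pMl// mul0e mulNe.
Qed.

End deformation.

(** * Gaussian smoothing of projections *)

Section smoothed_projection.
Context {R : realType} (d m : nat).
Variables (E : 'M[R]_(d, d + m)) (F : 'M[R]_(m, d + m)).
Hypotheses (EE : E *m E^T = 1%:M) (FF : F *m F^T = 1%:M) (EF : E *m F^T = 0).

Definition abs_proj (f : 'rV[R]_(d + m) -> R) (x : 'rV[R]_d) : \bar R :=
  (\int[lebesgue_rV m]_y `|f (x *m E + y *m F)|%:E)%E.

Lemma abs_proj_ge0 f x : (0 <= abs_proj f x)%E.
Proof. by apply: integral_ge0 => y _; rewrite lee_fin. Qed.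

Lemma measurable_abs_proj f : measurable_fun setT f ->
  measurable_fun setT (abs_proj f).
Proof.
move=> mf; apply: (@measurable_fun_fubini_tonelli_F _ _ _ _ _ (lebesgue_rV m)
  (fun p : 'rV[R]_d * 'rV[R]_m => `|f (orth_map E F p)|%:E)) => //.
apply/measurable_EFinP; apply: measurableT_comp => //.
by apply: measurableT_comp => //; exact: measurable_orth_map.
Qed.

Lemma ge0_integral_mul_proj (k : 'rV[R]_d -> R) (f : 'rV[R]_(d + m) -> R) :
  measurable_fun setT k -> (forall x, 0 <= k x) -> measurable_fun setT f ->
  (\int[lebesgue_rV (d + m)]_z (k (z *m E^T) * `|f z|)%:E =
   \int[lebesgue_rV d]_y ((k y)%:E * abs_proj f y))%E.
Proof.
move=> mk k0 mf.
have mE : measurable_fun setT (fun z : 'rV[R]_(d + m) => z *m E^T).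
  by have := measurable_rV_affine E^T 0; under eq_fun do rewrite addr0.
have mkf : measurable_fun setT (fun z : 'rV[R]_(d + m) =>
  (k (z *m E^T) * `|f z|)%:E).
  by apply/measurable_EFinP; apply: measurable_funM; exact: measurableT_comp.
have mnf : measurable_fun setT (fun p => `|f (orth_map E F p)|).
  apply: measurableT_comp => //; apply: measurableT_comp => //.
  exact: measurable_orth_map.
pose h (z : 'rV[R]_(d + m)) := (k (z *m E^T) * `|f z|)%:E.
have h0 z : (0 <= h z)%E by rewrite lee_fin mulr_ge0.
have mhp : measurable_fun setT (fun p => h (orth_map E F p)).
  exact: (measurableT_comp mkf (measurable_orth_map E F)).
rewrite (ge0_integral_orth_map EE FF EF mkf h0).
rewrite (fubini_tonelli1 (fun p => h (orth_map E F p)) mhp (fun p => h0 _)).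
apply: eq_integral => y _; rewrite /fubini_F /h.
under eq_integral do rewrite (orth_map_proj EE EF) EFinM.
rewrite ge0_integralZl_EFin//.
apply/measurable_EFinP; exact: (measurableT_comp mnf (pair1_measurable y)).
Qed.

Variables (tau : R).
Hypothesis tau0 : 0 < tau.
Notation G t := (@gauss_kernel R d t).

Let mG t (x : 'rV[R]_d) : measurable_fun setT (fun y : 'rV[R]_d => G t (x - y)).
Proof.
by apply: measurableT_comp; [exact: measurable_gauss_kernel|exact:
  measurable_rV_subl].
Qed.

Let boundG x y : `|G tau (x - y)| <= (pi * tau) `^ (- (d%:R / 2)).
Proof. exact: gauss_kernel_bound. Qed.

Lemma convolution_projE (f : 'rV[R]_(d + m) -> R) x :
  (lebesgue_rV (d + m)).-integrable setT (EFin \o f) ->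
  convolution (G tau) (subspace_proj E F f) x =
  fine (\int[lebesgue_rV (d + m)]_z (G tau (x - z *m E^T) * f z)%:E)%E.
Proof.
move=> fint; rewrite /convolution /Rintegral; congr fine.
exact: (integral_mul_proj EE FF EF (mG tau x) (boundG x) fint).2.
Qed.

Lemma convolution_projB (f g : 'rV[R]_(d + m) -> R) x :
  (lebesgue_rV (d + m)).-integrable setT (EFin \o f) ->
  (lebesgue_rV (d + m)).-integrable setT (EFin \o g) ->
  convolution (G tau) (subspace_proj E F f \- subspace_proj E F g) x =
  convolution (G tau) (subspace_proj E F f) x -
  convolution (G tau) (subspace_proj E F g) x.
Proof.
move=> fint gint; rewrite /convolution -RintegralB//.
- by apply: eq_Rintegral => y _; rewrite mulrBr.
- exact: (integral_mul_proj EE FF EF (mG tau x) (boundG x) fint).1.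
- exact: (integral_mul_proj EE FF EF (mG tau x) (boundG x) gint).1.
Qed.

Lemma convolution_proj_le (f : 'rV[R]_(d + m) -> R) x :
  (lebesgue_rV (d + m)).-integrable setT (EFin \o f) ->
  (`|(convolution (G tau) (subspace_proj E F f) x)%:E| <=
   \int[lebesgue_rV d]_y ((G tau (x - y))%:E * abs_proj f y))%E.
Proof.
move=> fint; have mf : measurable_fun setT f.
  by apply/measurable_EFinP; exact: measurable_int fint.
have kint := integrable_mul_proj E (mG tau x) (boundG x) fint.
rewrite convolution_projE// fineK; last exact: integrable_fin_num kint.
apply: le_trans (le_abse_integral _ _ (measurable_int _ kint)) _ => //.
rewrite -ge0_integral_mul_proj//; last by move=> y; exact: gauss_kernel_ge0.
rewrite le_eqVlt; apply/orP; left; apply/eqP; apply: eq_integral => z _.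
by rewrite /= normrM ger0_norm// gauss_kernel_ge0.
Qed.

(** Pointwise the smoothed projection is dominated by the smoothed [abs_proj f], and [mixed_norm] is
    the norm of [abs_proj f] before smoothing. *)
Lemma Lnorm_convolution_proj (r : R) (f : 'rV[R]_(d + m) -> R) : 1 <= r ->
  (lebesgue_rV (d + m)).-integrable setT (EFin \o f) ->
  ('N[lebesgue_rV d]_(r%:E)[EFin \o convolution (G tau) (subspace_proj E F f)]
    <=
   mixed_norm E F r f)%E.
Proof.
move=> r1 fint; have r0 : 0 < r by exact: lt_le_trans r1.
have mf : measurable_fun setT f.
  by apply/measurable_EFinP; exact: measurable_int fint.
have mV := measurable_abs_proj mf.
have mG' := @measurable_gauss_kernel R d tau.
have G0 := @gauss_kernel_ge0 R d tau.
apply: le_trans (young_convolution mG' G0 (integral_gauss_kernel d tau0) r1 mV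
  (abs_proj_ge0 f)).
apply: le_Lnorm => //.
- apply/measurable_EFinP; apply: measurable_convolution => //.
  exact: (measurable_subspace_proj EE FF EF fint).
- by apply: measurable_conv => // y; exact: abs_proj_ge0.
- move=> x; apply: le_trans (convolution_proj_le x fint) _.
  exact: lee_abs.
Qed.

Lemma Lnorm_convolution_projB (r : R) (f g : 'rV[R]_(d + m) -> R) : 1 <= r ->
  (lebesgue_rV (d + m)).-integrable setT (EFin \o f) ->
  (lebesgue_rV (d + m)).-integrable setT (EFin \o g) ->
  ('N[lebesgue_rV d]_(r%:E)[EFin \o convolution (G tau)
      (subspace_proj E F f \- subspace_proj E F g)%R] <=
   mixed_norm E F r f + mixed_norm E F r g)%E.
Proof.
move=> r1 fint gint.
pose I1 := convolution (G tau) (subspace_proj E F f).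
pose I2 := convolution (G tau) (subspace_proj E F g).
have -> : convolution (G tau) (subspace_proj E F f \- subspace_proj E F g) =
    I1 \+ (fun x => - I2 x).
  by apply/funext => x; rewrite convolution_projB.
have mG' := @measurable_gauss_kernel R d tau.
have mI (u : 'rV[R]_(d + m) -> R) :
  (lebesgue_rV (d + m)).-integrable setT (EFin \o u) ->
    measurable_fun setT (convolution (G tau) (subspace_proj E F u)).
  move=> uint; apply: measurable_convolution => //.
  exact: (measurable_subspace_proj EE FF EF uint).
apply: le_trans (minkowski_EFin _ (mI f fint) (measurable_funN (mI g gint)) r1)
  _.
apply: leeD; first exact: Lnorm_convolution_proj.
have -> : 'N[lebesgue_rV d]_(r%:E)[EFin \o (fun x => - I2 x)%R]%E =
    'N[lebesgue_rV d]_(r%:E)[EFin \o I2]%E.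
  exact: (oppe_Lnorm _ (EFin \o I2)).
exact: Lnorm_convolution_proj.
Qed.

End smoothed_projection.

Section smoothed_deformation.
Context {R : realType} (d m : nat).

Lemma LnormZ_ge0 (r c : R) (V : 'rV[R]_d -> \bar R) : 0 < r -> 0 <= c ->
  measurable_fun setT V -> (forall x, 0 <= V x)%E ->
  ('N[lebesgue_rV d]_(r%:E)[(fun x => c%:E * V x)] =
   c%:E * 'N[lebesgue_rV d]_(r%:E)[V])%E.
Proof.
move=> r0 c0 mV V0; rewrite !LnormE ?gt_eqF//.
transitivity ((\int[lebesgue_rV d]_x ((c `^ r)%:E * `|V x| `^ r)) `^ r^-1)%E.
  congr (_ `^ _)%E; apply: eq_integral => x _.
  by rewrite abseM poweRM ?abse_ge0// abse_EFin ger0_norm// poweR_EFin.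
rewrite ge0_integralZl_EFin ?powR_ge0//; last 2 first.
- by move=> x _; exact: poweR_ge0.
- by apply: (measurableT_comp (measurable_poweR r)); exact: measurableT_comp.
rewrite poweRM ?lee_fin ?powR_ge0//; last first.
  by apply: integral_ge0 => x _; exact: poweR_ge0.
by rewrite poweR_EFin -powRrM mulfV ?gt_eqF// powRr1.
Qed.

Variables (E : 'M[R]_(d, d + m)) (F : 'M[R]_(m, d + m)).
Hypotheses (EE : E *m E^T = 1%:M) (FF : F *m F^T = 1%:M) (EF : E *m F^T = 0).
Variables (A B : set 'rV[R]_(d + m)) (phi : 'rV[R]_(d + m) -> 'rV[R]_(d + m)).
Hypotheses (oA : open A) (oB : open B) (bij : set_bij B A phi).
Hypothesis phi1 : C1_on B phi.
Variables (r e tau : R) (f : 'rV[R]_(d + m) -> R).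
Hypotheses (r1 : 1 <= r) (tau0 : 0 < tau) (e0 : 0 <= e).
Hypothesis phi_e : forall x, B x -> enorm (x - phi x) <= e.
Hypothesis fint : (lebesgue_rV (d + m)).-integrable setT (EFin \o f).
Hypothesis fA : forall x, ~ A x -> f x = 0.

Notation G t := (@gauss_kernel R d t).
Notation dist := (convolution (G tau)
  (subspace_proj E F f \- subspace_proj E F (deform phi B f))).
Let c : R := 3 * expR 1 * 2 ^+ d.

Let fdint : (lebesgue_rV (d + m)).-integrable setT (EFin \o deform phi B f).
Proof. exact: (integrable_deform oA oB bij phi1 fA fint). Qed.

Let mf : measurable_fun setT f.
Proof. by apply/measurable_EFinP; exact: measurable_int fint. Qed.

Let mG t (x : 'rV[R]_d) : measurable_fun setT (fun y : 'rV[R]_d => G t (x - y)).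
Proof.
by apply: measurableT_comp; [exact: measurable_gauss_kernel|exact:
  measurable_rV_subl].
Qed.

Lemma convolution_proj_deform_le x : e <= Num.sqrt tau ->
  (`|(dist x)%:E| <= (c * (e / Num.sqrt tau))%:E *
   \int[lebesgue_rV d]_y ((G (4 * tau) (x - y))%:E * abs_proj E F f y))%E.
Proof.
move=> et; have [psi [mpsi psiK phiK]] := measurable_inverse oA oB bij phi1.
have boundG (y : 'rV[R]_d) : `|G tau (x - y)| <= (pi * tau) `^ (- (d%:R / 2)).
  exact: gauss_kernel_bound.
pose k (z : 'rV[R]_(d + m)) := G tau (x - z *m E^T).
have mET : measurable_fun setT (fun z : 'rV[R]_(d + m) => z *m E^T).
  by have := measurable_rV_affine E^T 0; under eq_fun do rewrite addr0.
have mk : measurable_fun setT k by apply: (measurableT_comp (mG tau x)).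
have kint : (lebesgue_rV (d + m)).-integrable setT (fun z => (k z * f z)%:E).
  exact: integrable_mul_proj (mG tau x) boundG fint.
have kpint : (lebesgue_rV (d + m)).-integrable setT
  (fun z => (k (psi z) * f z)%:E).
  have -> : (fun z => (k (psi z) * f z)%:E) =
    ((EFin \o (k \o psi)) \* (EFin \o f))%E.
    by apply/funext => z; rewrite /= EFinM.
  have mkp : measurable_fun setT (k \o psi)
    by exact: (measurableT_comp mk mpsi).
  have bkp : [bounded (k \o psi) z | z in setT].
    exists ((pi * tau) `^ (- (d%:R / 2))); split; first exact: num_real.
    by move=> y My z _; apply: le_trans (boundG _) (ltW My).
  exact: (integrableMr measurableT mkp bkp fint).
(* Both integrals are finite, so the difference can be taken under one integral sign before absolute
   values; this captures the cancellation between the two projections. *)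
have distE : (dist x)%:E =
    (\int[lebesgue_rV (d + m)]_z ((k z - k (psi z)) * f z)%:E)%E.
  have I1 := integrable_fin_num measurableT kint.
  have I2 := integrable_fin_num measurableT kpint.
  have IB : (\int[lebesgue_rV (d + m)]_z ((k z - k (psi z)) * f z)%:E =
      \int[lebesgue_rV (d + m)]_z (k z * f z)%:E -
      \int[lebesgue_rV (d + m)]_z (k (psi z) * f z)%:E)%E.
    rewrite -(integralB measurableT kint kpint).
    by apply: eq_integral => z _; rewrite mulrBl EFinB.
  have HB (a b : \bar R) : a \is a fin_num -> b \is a fin_num ->
      (fine a - fine b)%:E = (a - b)%E by move=> ? ?; rewrite EFinB !fineK.
  rewrite IB -(HB _ _ I1 I2); congr EFin.
  rewrite (convolution_projB EE FF EF tau0 x fint fdint).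
  rewrite (convolution_projE EE FF EF tau0 x fint).
  rewrite (convolution_projE EE FF EF tau0 x fdint).
  congr (_ - fine _).
  exact: (integral_mul_deform oA oB bij phi1 mpsi phiK mf mk fA).
have dint : (lebesgue_rV (d + m)).-integrable setT
    (fun z => ((k z - k (psi z)) * f z)%:E).
  have := integrableB measurableT kint kpint.
  by apply: eq_integrable => // z _; rewrite /= mulrBl EFinB.
rewrite distE; apply: le_trans (le_abse_integral _ _ (measurable_int _ dint)) _
  => //.
have s0 : 0 < Num.sqrt tau by rewrite sqrtr_gt0.
have c0 : 0 <= c by rewrite !mulr_ge0 ?expR_ge0// exprn_ge0.
have ce0 : 0 <= c * (e / Num.sqrt tau) by rewrite mulr_ge0// divr_ge0// ltW.
rewrite -(ge0_integral_mul_proj EE FF EF (mG (4 * tau) x))//; last first.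
  by move=> y; exact: gauss_kernel_ge0.
have m4 : measurable_fun setT (fun z : 'rV[R]_(d + m) =>
    (G (4 * tau) (x - z *m E^T) * `|f z|)%:E).
  apply/measurable_EFinP; apply: measurable_funM; last exact: measurableT_comp.
  exact: (measurableT_comp (mG (4 * tau) x)).
rewrite -ge0_integralZl_EFin//; last first.
  by move=> z _; rewrite lee_fin mulr_ge0// gauss_kernel_ge0.
apply: ge0_le_integral => //.
- by apply: measurableT_comp => //; exact: measurable_int dint.
- exact: emeasurable_funM.
move=> z _; rewrite /= -EFinM lee_fin normrM [leRHS]mulrA.
have [Az|nAz] := pselect (A z); last by rewrite fA// normr0 !mulr0.
rewrite ler_wpM2r//; have [Bz zE] := psiK z Az.
apply: gauss_kernel_lipschitz => //.
rewrite (_ : _ - _ = (psi z - z) *m E^T); last first.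
  by rewrite mulmxBl; apply/rowP => i; rewrite !mxE; ring.
apply: le_trans (enorm_proj _ EE) _.
by have := phi_e Bz; rewrite zE.
Qed.

Lemma Lnorm_proj_deform_lipschitz : e <= Num.sqrt tau ->
  ('N[lebesgue_rV d]_(r%:E)[EFin \o dist] <=
   (c * (e / Num.sqrt tau))%:E * mixed_norm E F r f)%E.
Proof.
move=> et; have r0 : 0 < r by exact: lt_le_trans r1.
have s0 : 0 < Num.sqrt tau by rewrite sqrtr_gt0.
have c0 : 0 <= c by rewrite !mulr_ge0 ?expR_ge0// exprn_ge0.
have ce0 : 0 <= c * (e / Num.sqrt tau) by rewrite mulr_ge0// divr_ge0// ltW.
have t4 : 0 < 4 * tau by rewrite mulr_gt0.
have mV : measurable_fun setT (abs_proj E F f) by exact: measurable_abs_proj.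
have V0 := abs_proj_ge0 E F f.
have mG4 := @measurable_gauss_kernel R d (4 * tau).
have G40 := @gauss_kernel_ge0 R d (4 * tau).
have mC := measurable_conv mG4 G40 mV V0.
have C0 x : (0 <= \int[lebesgue_rV d]_y
  ((G (4 * tau) (x - y))%:E * abs_proj E F f y))%E.
  by apply: integral_ge0 => y _; rewrite mule_ge0// lee_fin.
apply: (@le_trans _ _ ((c * (e / Num.sqrt tau))%:E *
  'N[lebesgue_rV d]_(r%:E)[(fun x =>
   \int[lebesgue_rV d]_y ((G (4 * tau) (x - y)%R)%:E * abs_proj E F f y))])%E);
     last first.
  rewrite lee_wpmul2l// ?lee_fin//.
  exact: (young_convolution mG4 G40 (integral_gauss_kernel d t4) r1 mV V0).
rewrite -LnormZ_ge0//; apply: le_Lnorm => //.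
- apply/measurable_EFinP; apply: measurable_convolution => //.
    exact: measurable_gauss_kernel.
  by apply: measurable_funB; exact: (measurable_subspace_proj EE FF EF).
- exact: emeasurable_funM.
move=> x; apply: le_trans (convolution_proj_deform_le x et) _.
exact: lee_abs.
Qed.

Hypothesis fd_le : (mixed_norm E F r (deform phi B f) <= mixed_norm E F r f)%E.

(** The two regimes merge because [c >= 3], which covers the constant 2 of the triangle
    inequality. *)
Lemma Lnorm_proj_deform_le :
  ('N[lebesgue_rV d]_(r%:E)[EFin \o dist] <=
   (c * Num.min 1 (e / Num.sqrt tau))%:E * mixed_norm E F r f)%E.
Proof.
have s0 : 0 < Num.sqrt tau by rewrite sqrtr_gt0.
have [et|et] := leP e (Num.sqrt tau).
  rewrite min_r; first exact: Lnorm_proj_deform_lipschitz.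
  by rewrite ler_pdivrMr// mul1r.
rewrite min_l ?mulr1; last by rewrite ler_pdivlMr// mul1r ltW.
apply: le_trans (Lnorm_convolution_projB EE FF EF tau0 r1 fint fdint) _.
have M0 : (0 <= mixed_norm E F r f)%E by exact: Lnorm_ge0.
apply: (@le_trans _ _ (2%:E * mixed_norm E F r f)%E).
  have -> : (2%:E * mixed_norm E F r f =
    mixed_norm E F r f + mixed_norm E F r f)%E.
    by rewrite mule_natl mule2n.
  exact: leeD2l.
rewrite lee_wpmul2r// lee_fin /c.
have e1 : 1 <= expR 1 :> R by rewrite -expR0 ler_expR.
have d1 : 1 <= 2 ^+ d :> R by rewrite exprn_ege1// ler1n.
apply: (@le_trans _ _ (3 * expR 1 * 1)); first by lra.
by rewrite ler_wpM2l// mulr_ge0// expR_ge0.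
Qed.

End smoothed_deformation.

(** * From single scales to the scale-space metric *)

Section scale_metric_bound.
Context {R : realType}.

Lemma orthonormal_coordinates_orthogonal d m n (E : 'M[R]_(d, n))
  (F : 'M[R]_(m, n))
    (U : {vspace 'rV[R]_n}) : orthonormal_coordinates E [set` U] ->
  orthonormal_coordinates F (orthogonal_compl U) -> E *m F^T = 0.
Proof.
move=> [_ EU] [_ FU]; apply/matrixP => i j.
have rE : row i E \in U.
  suff : [set` U] (row i E) by [].
  by rewrite -EU; exists (delta_mx ord0 i) => //; rewrite -rowE.
have : orthogonal_compl U (row j F).
  by rewrite -FU; exists (delta_mx ord0 j) => //; rewrite -rowE.
move=> /(_ _ rE)/matrixP/(_ ord0 ord0) H.
transitivity ((row i E *m (row j F)^T) ord0 ord0).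
  by rewrite !mxE; apply: eq_bigr => k _; rewrite !mxE.
by rewrite H !mxE.
Qed.

Lemma fine_displacement n (phi : 'rV[R]_n -> 'rV[R]_n) (B : set 'rV[R]_n)
  (s : R) :
  0 < s -> (displacement phi B < s%:E)%E ->
  [/\ 0 <= fine (displacement phi B), fine (displacement phi B) < s &
      forall x, B x -> enorm (x - phi x) <= fine (displacement phi B)].
Proof.
move=> s0 ds; have ub x : B x -> ((enorm (x - phi x))%:E <=
  displacement phi B)%E.
  by move=> Bx; apply: ereal_sup_ubound; exists x.
(* For empty [B] the supremum is [-oo], with [fine] equal to 0; otherwise it lies between a norm and
   [s], hence is finite. *)
have [[x Bx]|/set0P/negP/negPn/eqP B0] := pselect (B !=set0); last first.
  by rewrite /displacement B0 image_set0 ereal_sup0; split.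
case: (displacement phi B) ds ub => [e| |]//= ds ub; last first.
  by have := ub x Bx; rewrite leeNy_eq.
split=> [|//|y /ub]; last by rewrite lee_fin.
by have := ub x Bx; rewrite lee_fin; apply: le_trans; exact: enorm_ge0.
Qed.

Lemma nneseries_le (u : nat -> \bar R) (S : \bar R) : (forall k, 0 <= u k)%E ->
  (forall n, \sum_(0 <= k < n) u k <= S)%E -> (\sum_(0 <= k <oo) u k <= S)%E.
Proof.
move=> u0 uS; apply: lime_le; first exact: is_cvg_nneseries.
exact: nearW.
Qed.

Lemma Delta_ge0 (alpha p e : R) : 0 <= e < 1 -> 0 <= Delta alpha p e.
Proof.
move=> /andP[e0 e1]; rewrite /Delta; case: eqP => // /eqP en0.
have ep : 0 < e by rewrite lt_def en0.
case: ifP => _; first by rewrite divr_ge0 ?powR_ge0.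
case: ifP => _; first by rewrite mulr_ge0 ?powR_ge0.
by rewrite divr_ge0 // le_min powR_ge0 ler01.
Qed.

(** With [q] the square root of [omega], the root of the [k]-th scale is that of [tau0] times
    [q ^+ k], so the weighted norms are dominated by the terms of [scale_sum_le] for [delta] equal
    to [e / Num.sqrt tau0]. *)
Lemma scale_metric_le d (tau0 omega alpha p r e c M : R) (u v : 'rV[R]_d -> R) :
  1 <= p -> 0 < alpha -> 0 < tau0 -> 0 < omega -> omega < 1 ->
  0 <= e -> e < Num.sqrt tau0 -> 0 <= c -> 0 <= M ->
  (forall tau : R, (0 < tau)%R ->
    'N[lebesgue_rV d]_(r%:E)[EFin \o convolution (gauss_kernel tau) (u \- v)%R]
      <=
    (c * Num.min 1 (e / Num.sqrt tau) * M)%R%:E)%E ->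
  (scale_metric tau0 omega alpha p r u v <=
   (2 * c * M * (tau0 `^ (alpha / 2) / (1 - omega `^ 2^-1) *
      Delta alpha p (e / Num.sqrt tau0)))%:E)%E.
Proof.
move=> p1 alpha0 tau00 omega0 omega1 e0 et c0 M0 HN.
have p0 : 0 < p by exact: lt_le_trans p1.
have s0 : 0 < Num.sqrt tau0 by rewrite sqrtr_gt0.
pose q := omega `^ 2^-1; pose delta := e / Num.sqrt tau0.
have q0 : 0 < q by exact: powR_gt0.
have q1 : q < 1.
  rewrite /q powR12_sqrt ?(ltW omega0)// -[ltRHS](sqrtr1 R) ltr_sqrt ?ltr01//.
have delta01 : 0 <= delta < 1.
  by rewrite /delta divr_ge0 ?(ltW s0)//= ltr_pdivrMr// mul1r.
have q10 : 0 < 1 - q by rewrite subr_gt0.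
have qq1 : 1 <= 2 / (1 - q).
  by rewrite ler_pdivlMr// mul1r; have := q0; lra.
have qE k : Num.sqrt (tau0 * omega ^+ k) = Num.sqrt tau0 * q ^+ k.
  rewrite sqrtrM ?(ltW tau00)//; congr (_ * _).
  rewrite -(powR12_sqrt (exprn_ge0 k (ltW omega0))).
  exact: powR_exprn (ltW omega0).
pose K := c * M * tau0 `^ (alpha / 2).
have K0 : 0 <= K by rewrite !mulr_ge0 ?powR_ge0.
pose t k := (q ^+ k) `^ alpha * Num.min 1 (delta / q ^+ k).
have min0 k : 0 <= Num.min 1 (delta / q ^+ k).
  by rewrite le_min ler01/= divr_ge0 ?exprn_ge0 ?(ltW q0)//; case/andP: delta01.
have t0 k : 0 <= t k by rewrite mulr_ge0 ?powR_ge0.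
have D0 : 0 <= Delta alpha p delta by exact: Delta_ge0.
rewrite /scale_metric.
set S := (\sum_(0 <= k <oo) _)%E.
have S0 : (0 <= S)%E.
  by apply: nneseries_ge0 => k _ _; rewrite mule_ge0 ?poweR_ge0//
    lee_fin powR_ge0.
have HS : (S <= (K `^ p * (2 / (1 - q) * Delta alpha p delta `^ p))%:E)%E.
  apply: nneseries_le => [k|n].
    by rewrite mule_ge0 ?poweR_ge0// lee_fin powR_ge0.
  apply: (@le_trans _ _ (\sum_(0 <= k < n) (K `^ p * t k `^ p)%:E)%E).
    apply: lee_sum => k _.
    have tk0 : 0 < tau0 * omega ^+ k by rewrite mulr_gt0// exprn_gt0.
    have kE : delta / q ^+ k = e / Num.sqrt (tau0 * omega ^+ k).
      by rewrite qE /delta invfM mulrA.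
    have Hk := HN _ tk0; rewrite -kE in Hk.
    have {}Hk := le_poweR p0 (Lnorm_ge0 _ _ _) Hk.
    have H0 : (0 <= ((tau0 * omega ^+ k) `^ (p * alpha / 2))%:E)%E.
      by rewrite lee_fin powR_ge0.
    apply: le_trans (lee_wpmul2l H0 Hk) _.
    rewrite poweR_EFin -EFinM lee_fin.
    have -> : (tau0 * omega ^+ k) `^ (p * alpha / 2) =
        (tau0 `^ (alpha / 2) * (q ^+ k) `^ alpha) `^ p.
      rewrite (_ : p * alpha / 2 = alpha / 2 * p); last by ring.
      rewrite powRrM (powRM _ (ltW tau00) (exprn_ge0 k (ltW omega0))).
      congr ((_ * _) `^ _); rewrite /q -(powR_exprn _ _ (ltW omega0)) -powRrM.
      by congr (_ `^ _); ring.
    have a0 : 0 <= tau0 `^ (alpha / 2) * (q ^+ k) `^ alpha.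
      by rewrite mulr_ge0 ?powR_ge0.
    have b0 : 0 <= c * Num.min 1 (delta / q ^+ k) * M by rewrite !mulr_ge0.
    apply: (@le_trans _ _ ((K * t k) `^ p));
      last by rewrite (powRM p K0 (t0 k)).
    rewrite le_eqVlt; apply/orP; left; apply/eqP.
    apply: etrans (esym (powRM p a0 b0)) _; congr (_ `^ _).
    by rewrite /K /t; ring.
  rewrite sumEFin lee_fin -mulr_sumr ler_wpM2l ?powR_ge0//.
  by apply: scale_sum_le => //; rewrite q0 q1.
have pi0 : 0 < p^-1 by rewrite invr_gt0.
apply: le_trans (le_poweR pi0 S0 HS) _.
rewrite poweR_EFin lee_fin.
have powRK x : 0 <= x -> (x `^ p) `^ p^-1 = x.
  by move=> x0; rewrite -powRrM mulfV ?gt_eqF// powRr1.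
have z0 : 0 <= 2 / (1 - q) by exact: le_trans qq1.
rewrite (powRM _ (powR_ge0 K p) (mulr_ge0 z0 (powR_ge0 _ p))).
rewrite (powRM _ z0 (powR_ge0 _ p)) (powRK _ K0) (powRK _ D0).
rewrite (_ : 2 * c * M * _ = K * (2 / (1 - q) * Delta alpha p delta));
  last first.
  by rewrite /K /delta; ring.
(* Since [2 / (1 - q) >= 1], its [p]-th root is at most itself, which makes the constant uniform in
   [p]. *)
apply: ler_wpM2l => //; apply: ler_wpM2r => //.
rewrite -[leRHS](powRr1 z0).
by apply: ler_powR => //; rewrite invf_le1.
Qed.

End scale_metric_bound.

Theorem theorem4p2 (R : realType) (d : nat) (d_gt0 : (1 <= d)%N) :
  exists C : R, 0 < C /\
    forall (D : nat) (A B : set 'rV[R]_D) (phi : 'rV[R]_D -> 'rV[R]_D)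
      (U : {vspace 'rV[R]_D}) (E : 'M[R]_(d, D)) (F : 'M[R]_(D - d, D))
      (r p alpha tau0 omega : R) (f : 'rV[R]_D -> R),
    (d <= D)%N ->
    open A -> open B -> set_bij B A phi -> C1_on B phi ->
    \dim U = d ->
    orthonormal_coordinates E [set` U] ->
    orthonormal_coordinates F (orthogonal_compl U) ->
    1 <= r -> 1 <= p -> 0 < alpha -> 0 < tau0 -> 0 < omega -> omega < 1 ->
    f \in Lfun (lebesgue_rV D) 1%:E -> f \in Lfun (lebesgue_rV D) r%:E ->
    (forall x, ~ A x -> f x = 0) ->
    (mixed_norm E F r (deform phi B f) <= mixed_norm E F r f)%E ->
    (mixed_norm E F r f < +oo)%E ->
    (displacement phi B < (Num.sqrt tau0)%:E)%E ->
    (scale_metric tau0 omega alpha p r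
       (subspace_proj E F f) (subspace_proj E F (deform phi B f)) <=
     C%:E * mixed_norm E F r f *
     (tau0 `^ (alpha / 2) / (1 - omega `^ 2^-1) *
      Delta alpha p (fine (displacement phi B) / Num.sqrt tau0))%:E)%E.

Proof.
pose c : R := 3 * expR 1 * 2 ^+ d.
have c_gt0 : 0 < c by rewrite !mulr_gt0 ?expR_gt0// exprn_gt0.
exists (2 * c); split; first by rewrite mulr_gt0.
move=> D A B phi U E F r p alpha tau0 omega f dD.
(* Trading [D] for [d + m] gives the matrices the dimensions of the block decomposition, so that no
   casts appear. *)
move: F; have : D = (d + (D - d))%N by rewrite subnKC.
move: (D - d)%N => m Dm; subst D => F.
move=> oA oB bij phi1 _ EU FU r1 p1 alpha0 tau00 omega0 omega1 f1 _ fA fd_le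
  f_lty disp.
have [EE _] := EU; have [FF _] := FU.
have EF := orthonormal_coordinates_orthogonal EU FU.
have fint : (lebesgue_rV (d + m)).-integrable setT (EFin \o f)
  by exact/Lfun1_integrable.
have s0 : 0 < Num.sqrt tau0 by rewrite sqrtr_gt0.
have [e0 es phi_e] := fine_displacement s0 disp.
have M0 : (0 <= mixed_norm E F r f)%E by exact: Lnorm_ge0.
have ME : mixed_norm E F r f = (fine (mixed_norm E F r f))%:E.
  by rewrite fineK// ge0_fin_numE.
rewrite ME -!EFinM.
apply: scale_metric_le => //; [exact: ltW|exact: fine_ge0|].
move=> tau tau_gt0; rewrite EFinM -ME.
exact: (Lnorm_proj_deform_le EE FF EF oA oB bij phi1 r1 tau_gt0 e0 phi_e fint fA
  fd_le).
Qed.
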